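(* Let $N\ge2$ be an integer. For any integer $m$, \[ \langle W_m\rangle^{{\rm SU}(N)_{-N-1/2}}(x;q)=\sum_{k=\lceil m/N\rceil}^{\infty}\sum_{i=1}^N Y_{i,m,k}(x,q), \] where the functions $Y_{i,m,k}(x,q)$ ($1\le i\le N$, $m,k\in\mathbb{Z}$) are defined as follows: \[ Y_{i,0,k}(x,q)=\begin{cases}\dfrac{(-x)^{Nk}q^{Nk^2/2}}{(q;q)_k},&k\ge0,\\ 0,&k<0;\end{cases} \] for $1\le m\le N$, \[ Y_{i,m,k}(x,q)=\begin{cases}\dfrac{(-1)^{Nk+1}x^{Nk-m}q^{(Nk^2+m)/2-(N+1-i)k}}{(q;q)_{k-1}},& N-i+1\le m\le N\text{ and }k>0,\\ 0,& 0<m<N-i+1\text{ or }k\le0;\end{cases} \] and for other $m$ recursively \[ Y_{i,m,k}(x,q)=\begin{cases}q^{1/2}x^{-1}\big(Y_{i,m-1,k}(x,q)+(-1)^Nq^{m+i-k-N-1}Y_{i,m-N-1,k-1}(x,q)\big),& m>N,\\ (-1)^{N-1}q^{k-i-m+1}\big(Y_{i,m+N,k+1}(x,q)-xq^{-1/2}Y_{i,m+N+1,k+1}(x,q)\big),& m<0.\end{cases} \]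
   Context: Let $|q|<1$, $x$ a nonzero parameter, $(a;q)_\infty=\prod_{k\ge0}(1-aq^k)$, $(a;q)_n=\prod_{k=0}^{n-1}(1-aq^k)$. Let $s_1,\dots,s_{N-1}$ be variables and $s_N:=(s_1\cdots s_{N-1})^{-1}$. For $m\in\mathbb{Z}$ define \[ \langle W_m\rangle^{{\rm SU}(N)_{-N-1/2}}(x;q):=\frac{(q;q)_\infty^{N-1}}{N!}\oint\prod_{i=1}^{N-1}\frac{ds_i}{2\pi i s_i}\prod_{\substack{i,j=1\\ i\ne j}}^N(s_is_j^{-1};q)_\infty\prod_{i=1}^N(q^{1/2}s_ix;q)_\infty\sum_{i=1}^N s_i^m, \] where the integral denotes the constant term in $s_1,\dots,s_{N-1}$ of the integrand expanded as a formal Laurent series in the $s_i$ (equivalently the contour integral over unit circles). $\lceil\cdot\rceil$ is the ceiling function. *)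

(* Defs.v *)
From Stdlib Require Import Reals ZArith List.
From Coquelicot Require Import Coquelicot.

Local Open Scope C_scope.

Fixpoint Cpown (z : C) (n : nat) : C :=
  match n with O => 1 | S n => z * Cpown z n end.

Definition Cpowz (z : C) (m : Z) : C :=
  if (0 <=? m)%Z then Cpown z (Z.to_nat m) else / Cpown z (Z.to_nat (- m)).

Definition cprod (l : list nat) (f : nat -> C) : C :=
  fold_right (fun i acc => f i * acc) 1 l.
Definition csum (l : list nat) (f : nat -> C) : C :=
  fold_right (fun i acc => f i + acc) 0 l.

Definition qpoch (a q : C) (n : nat) : C :=
  cprod (seq 0 n) (fun k => 1 - a * Cpown q k).

Definition qpoch_inf (a q : C) : C :=
  @lim (CompleteNormedModule.CompleteSpace _ C_CompleteNormedModule)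
    (filtermap (fun n => qpoch a q n) eventually).

Definition Ceith (th : R) : C := (cos th, sin th).

(* Normalized integral over the unit torus (T^1)^n:
   \oint prod_j ds_j/(2 pi i s_j) F(s_1,..,s_n), with s_j = e^{i theta_j}.
   The variables are passed to F as a list [s_1; ...; s_n]. *)
Fixpoint torus_int (n : nat) (F : list C -> C) : C :=
  match n with
  | O => F nil
  | S n' =>
      RtoC (/ (2 * PI)) *
      @RInt C_R_CompleteNormedModule
        (fun th => torus_int n' (fun l => F (Ceith th :: l))) 0 (2 * PI)
  end.

Definition svar (N : nat) (l : list C) (i : nat) : C :=
  if (i <? N)%nat then nth (i - 1) l 0
  else / cprod (seq 1 (N - 1)) (fun j => nth (j - 1) l 0).

(* The parameter t stands for q^{1/2}; q = t^2. *)
Definition Wloop (N : nat) (m : Z) (x t : C) : C :=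
  let q := t * t in
  Cpown (qpoch_inf q q) (N - 1) * / RtoC (INR (fact N)) *
  torus_int (N - 1) (fun l =>
    let s := svar N l in
    cprod (seq 1 N) (fun i =>
      cprod (filter (fun j => negb (Nat.eqb i j)) (seq 1 N)) (fun j =>
        qpoch_inf (s i * / s j) q)) *
    cprod (seq 1 N) (fun i => qpoch_inf (t * s i * x) q) *
    csum (seq 1 N) (fun i => Cpowz (s i) m)).

(* The functions Y_{i,m,k}(x,q), q = t^2, defined by the base cases
   m = 0 and 1 <= m <= N, and the recursion for m > N and m < 0.
   [fuel] bounds the recursion depth; fuel = |m| suffices (see Yfun). *)
Definition Ybase (N : nat) (i : nat) (m k : Z) (x t : C) : C :=
  let q := t * t in
  let NZ := Z.of_nat N in
  let iZ := Z.of_nat i in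
  if (m =? 0)%Z then
    (if (0 <=? k)%Z then
       Cpowz (- x) (NZ * k) * Cpowz t (NZ * k * k) / qpoch q q (Z.to_nat k)
     else 0)
  else
    (if ((NZ - iZ + 1 <=? m)%Z && (m <=? NZ)%Z && (0 <? k)%Z)%bool then
       Cpowz (-1) (NZ * k + 1) * Cpowz x (NZ * k - m)
       * Cpowz t (NZ * k * k + m - 2 * (NZ + 1 - iZ) * k)
       / qpoch q q (Z.to_nat (k - 1))
     else 0).

Fixpoint Yfuel (fuel : nat) (N : nat) (i : nat) (m k : Z) (x t : C) : C :=
  let NZ := Z.of_nat N in
  let iZ := Z.of_nat i in
  if ((0 <=? m)%Z && (m <=? NZ)%Z)%bool then Ybase N i m k x t
  else match fuel with
  | O => 0
  | S f =>
      if (NZ <? m)%Z then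
        t / x * (Yfuel f N i (m - 1) k x t
                 + Cpowz (-1) NZ * Cpowz t (2 * (m + iZ - k - NZ - 1))
                   * Yfuel f N i (m - NZ - 1) (k - 1) x t)
      else
        Cpowz (-1) (NZ - 1) * Cpowz t (2 * (k - iZ - m + 1))
        * (Yfuel f N i (m + NZ) (k + 1) x t
           - x / t * Yfuel f N i (m + NZ + 1) (k + 1) x t)
  end.

Definition Yfun (N : nat) (i : nat) (m k : Z) (x t : C) : C :=
  Yfuel (Z.to_nat (Z.abs m)) N i m k x t.

Definition Zceil_div (m : Z) (N : Z) : Z := (- ((- m) / N))%Z.

(* Main.v *)
(* The SU(N) integral is the sum over k of the U(N) constant terms of the integrand times
   (s_1 ... s_N)^(-k), which converge geometrically by moving the contour to radius 2 or 1/2.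
   Up to a Vandermonde factor, removed by antisymmetry at the price of N!, the product over
   roots is the alternating function A = prod_{i<j} theta(s_i/s_j) * prod_j s_j^j, so the
   k-th term splits into the integrals I_{i,m,k} of A (prod_j (a s_j;q)_inf) s^e with
   a = q^(1/2) x and e_j = -j - k + m [j = i].  They are antisymmetric in e, and the contour
   shift s_j -> q s_j gives a three-term relation which for j = i is the recursion of the
   Y_{N+1-i,m,k}.  For 0 <= m <= N one of its terms usually vanishes because two exponents
   coincide; together with cyclic rotation of the exponents this reduces every I_{i,m,k} to
   I_{1,0,k} and I_{1,0,k} to I_{1,0,k-1}.  The constant c_N = I_{1,0,0} is found by
   induction: rescaling s by q^(-M) in I_{1,0,M} and letting M tend to infinity turns the
   matter product into prod_j theta(1/s_j), the extra factor of the N+1 variable product,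
   so that c_{N+1} (q;q)_inf = c_N. *)

(* No complex analysis enters. All integrands are limits, uniform on every annulus, of Laurent
   polynomials, and a change of contour is a dilation of the variables: it multiplies each monomial
   by a constant, and the constant monomial by 1. The lower limit of the sum over k is a matter of
   degree. Since the theta product depends only on ratios of the variables, replacing s by rho s
   trades a for a rho at the price of rho^(m - N k). For a -> 0 the matter product tends to 1, so
   I_{i,m,k} vanishes when N k < m, and I_{1,0,0} does not depend on a. The prefactor disappears in
   two pieces: 1/N! against the N! of the antisymmetrization, and (q;q)_inf^(N-1) against c_N. The
   delicate point in passing from SU(N) to U(N) is that an approximating Laurent polynomial has
   finitely many nonzero charges, but their number is not controlled as the approximation improves.
   A bound on the charges that is uniform in the approximant closes this gap. *)
Require Import Defs.
From Stdlib Require Import Reals ZArith List Lra Lia ClassicalEpsilon FunctionalExtensionality.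
From Coquelicot Require Import Coquelicot.

Local Open Scope C_scope.

(** * Finite products, sums and integer powers *)

Lemma Cinv_nz (z : C) : z <> 0 -> / z <> 0.
Proof.
  intros H E. apply C1_nz. rewrite <- (Cinv_r z H), E. ring.
Qed.

Lemma cprod_ext (l : list nat) (f g : nat -> C) :
  (forall i, In i l -> f i = g i) -> cprod l f = cprod l g.
Proof.
  induction l as [|a l IH]; intros H; simpl; [reflexivity|].
  rewrite (H a) by (left; reflexivity).
  rewrite IH; [reflexivity|]. intros i Hi; apply H; right; exact Hi.
Qed.

Lemma csum_ext (l : list nat) (f g : nat -> C) :
  (forall i, In i l -> f i = g i) -> csum l f = csum l g.
Proof.
  induction l as [|a l IH]; intros H; simpl; [reflexivity|].
  rewrite (H a) by (left; reflexivity).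
  rewrite IH; [reflexivity|]. intros i Hi; apply H; right; exact Hi.
Qed.

Lemma cprod_ext_seq (n : nat) (f g : nat -> C) :
  (forall i, (1 <= i <= n)%nat -> f i = g i) -> cprod (seq 1 n) f = cprod (seq 1 n) g.
Proof. intros H; apply cprod_ext; intros i Hi; apply in_seq in Hi; apply H; lia. Qed.

Lemma csum_ext_seq (n : nat) (f g : nat -> C) :
  (forall i, (1 <= i <= n)%nat -> f i = g i) -> csum (seq 1 n) f = csum (seq 1 n) g.
Proof. intros H; apply csum_ext; intros i Hi; apply in_seq in Hi; apply H; lia. Qed.

Lemma cprod_mul (l : list nat) (f g : nat -> C) :
  cprod l (fun i => f i * g i) = cprod l f * cprod l g.
Proof. induction l as [|a l IH]; simpl; [ring|]. rewrite IH; ring. Qed.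

Lemma cprod_app (l l' : list nat) (f : nat -> C) :
  cprod (l ++ l') f = cprod l f * cprod l' f.
Proof. induction l as [|a l IH]; simpl; [ring|]. rewrite IH; ring. Qed.

Lemma csum_app (l l' : list nat) (f : nat -> C) :
  csum (l ++ l') f = csum l f + csum l' f.
Proof. induction l as [|a l IH]; simpl; [ring|]. rewrite IH; ring. Qed.

Lemma cprod_S (a n : nat) (f : nat -> C) :
  cprod (seq a (S n)) f = cprod (seq a n) f * f (a + n)%nat.
Proof. rewrite seq_S, cprod_app; simpl; ring. Qed.

Lemma csum_S (a n : nat) (f : nat -> C) :
  csum (seq a (S n)) f = csum (seq a n) f + f (a + n)%nat.
Proof. rewrite seq_S, csum_app; simpl; ring. Qed.

Lemma cprod_shift (a n : nat) (f : nat -> C) :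
  cprod (seq (S a) n) f = cprod (seq a n) (fun i => f (S i)).
Proof.
  revert a; induction n as [|n IH]; intros a; simpl; [reflexivity|].
  now rewrite IH.
Qed.

Lemma cprod_neq0 (l : list nat) (f : nat -> C) :
  (forall i, In i l -> f i <> 0) -> cprod l f <> 0.
Proof.
  induction l as [|a l IH]; intros H; simpl.
  - apply C1_nz.
  - apply Cmult_neq_0; [apply H; left; reflexivity|].
    apply IH; intros i Hi; apply H; right; exact Hi.
Qed.

Lemma cprod_one (l : list nat) (f : nat -> C) :
  (forall i, In i l -> f i = 1) -> cprod l f = 1.
Proof.
  induction l as [|a l IH]; intros H; simpl; [reflexivity|].
  rewrite (H a), IH; [ring| |left; reflexivity].
  intros i Hi; apply H; right; exact Hi.
Qed.

Lemma cprod_const (a n : nat) (c : C) : cprod (seq a n) (fun _ => c) = Cpown c n.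
Proof. revert a; induction n as [|n IH]; intros a; simpl; [reflexivity|]. now rewrite IH. Qed.

Lemma Cmod_cprod_le (l : list nat) (f : nat -> C) (B : R) :
  (forall i, In i l -> (Cmod (f i) <= B)%R) -> (Cmod (cprod l f) <= B ^ length l)%R.
Proof.
  induction l as [|a l IH]; intros H; simpl; [rewrite Cmod_1; lra|].
  rewrite Cmod_mult. apply Rmult_le_compat; try apply Cmod_ge_0.
  - apply H; left; reflexivity.
  - apply IH; intros i Hi; apply H; right; exact Hi.
Qed.

Lemma csum_scal (l : list nat) (f : nat -> C) (c : C) :
  csum l (fun i => c * f i) = c * csum l f.
Proof. induction l as [|a l IH]; simpl; [ring|]. rewrite IH; ring. Qed.

Lemma csum_plus (l : list nat) (f g : nat -> C) :
  csum l (fun i => f i + g i) = csum l f + csum l g.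
Proof. induction l as [|a l IH]; simpl; [ring|]. rewrite IH; ring. Qed.

Lemma csum_zero (l : list nat) (f : nat -> C) :
  (forall i, In i l -> f i = 0) -> csum l f = 0.
Proof.
  induction l as [|a l IH]; intros H; simpl; [reflexivity|].
  rewrite (H a), IH; [ring| |left; reflexivity].
  intros i Hi; apply H; right; exact Hi.
Qed.

Lemma csum_shift (a n : nat) (f : nat -> C) :
  csum (seq (S a) n) f = csum (seq a n) (fun i => f (S i)).
Proof.
  revert a; induction n as [|n IH]; intros a; simpl; [reflexivity|].
  now rewrite IH.
Qed.

Lemma csum_rev (n : nat) (f : nat -> C) :
  csum (seq 1 n) (fun i => f (n + 1 - i)%nat) = csum (seq 1 n) f.
Proof.
  induction n as [|n IH]; [reflexivity|].
  rewrite (csum_S 1 n f), <- IH.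
  change (f (S n + 1 - 1)%nat + csum (seq 2 n) (fun i => f (S n + 1 - i)%nat) =
    csum (seq 1 n) (fun i => f (n + 1 - i)%nat) + f (1 + n)%nat).
  rewrite csum_shift. replace (S n + 1 - 1)%nat with (1 + n)%nat by lia.
  apply Cplus_comm.
Qed.

Lemma Cpown_add (z : C) (a b : nat) : Cpown z (a + b) = Cpown z a * Cpown z b.
Proof. induction a as [|a IH]; simpl; [ring|]. rewrite IH; ring. Qed.

Lemma Cpown_neq0 (z : C) (a : nat) : z <> 0 -> Cpown z a <> 0.
Proof.
  intros H; induction a as [|a IH]; simpl; [apply C1_nz|now apply Cmult_neq_0].
Qed.

Lemma Cpown_mul_l (y z : C) (a : nat) : Cpown (y * z) a = Cpown y a * Cpown z a.
Proof. induction a as [|a IH]; simpl; [ring|]. rewrite IH; ring. Qed.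

Lemma Cmod_Cpown (z : C) (a : nat) : Cmod (Cpown z a) = (Cmod z ^ a)%R.
Proof.
  induction a as [|a IH]; simpl; [apply Cmod_1|]. now rewrite Cmod_mult, IH.
Qed.

Lemma Cpowz_nat (z : C) (n : nat) : Cpowz z (Z.of_nat n) = Cpown z n.
Proof.
  unfold Cpowz. replace (0 <=? Z.of_nat n)%Z with true.
  - now rewrite Nat2Z.id.
  - symmetry; apply Z.leb_le; lia.
Qed.

Lemma Cpowz_neg (z : C) (n : nat) : Cpowz z (- Z.of_nat n) = / Cpown z n.
Proof.
  unfold Cpowz. destruct (0 <=? - Z.of_nat n)%Z eqn:E.
  - apply Z.leb_le in E. assert (n = O) by lia; subst; simpl. field; apply C1_nz.
  - now rewrite Z.opp_involutive, Nat2Z.id.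
Qed.

Lemma Cpowz_0 (z : C) : Cpowz z 0 = 1.
Proof. reflexivity. Qed.

Lemma Cpowz_1 (z : C) : Cpowz z 1 = z.
Proof. change (z * 1 = z); ring. Qed.

Lemma Cpowz_neq0 (z : C) (m : Z) : z <> 0 -> Cpowz z m <> 0.
Proof.
  intros H; unfold Cpowz. destruct (0 <=? m)%Z; [now apply Cpown_neq0|].
  apply Cinv_nz; now apply Cpown_neq0.
Qed.

Lemma Cpowz_succ (z : C) (m : Z) : z <> 0 -> Cpowz z (m + 1) = z * Cpowz z m.
Proof.
  intros H. destruct (Z_le_gt_dec 0 m) as [Hm|Hm].
  - rewrite <- (Z2Nat.id m) by lia.
    replace (Z.of_nat (Z.to_nat m) + 1)%Z with (Z.of_nat (S (Z.to_nat m))) by lia.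
    now rewrite !Cpowz_nat.
  - replace m with (- Z.of_nat (S (Z.to_nat (- m - 1))))%Z by lia.
    replace (- Z.of_nat (S (Z.to_nat (- m - 1))) + 1)%Z
      with (- Z.of_nat (Z.to_nat (- m - 1)))%Z by lia.
    rewrite !Cpowz_neg; simpl. field. split; [now apply Cpown_neq0|exact H].
Qed.

Lemma Cpowz_add (z : C) (a b : Z) : z <> 0 -> Cpowz z (a + b) = Cpowz z a * Cpowz z b.
Proof.
  intros H. revert b. apply Z.bi_induction.
  - intros x y ->; reflexivity.
  - rewrite Z.add_0_r, Cpowz_0; ring.
  - intros b. rewrite <- (Z.add_1_r b), Z.add_assoc, !Cpowz_succ by exact H.
    split; intros E.
    + rewrite E; ring.
    + replace (Cpowz z (a + b)) with (/ z * (z * Cpowz z (a + b))) by (field; exact H).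
      rewrite E; field; exact H.
Qed.

Lemma Cpowz_opp (z : C) (a : Z) : z <> 0 -> Cpowz z (- a) = / Cpowz z a.
Proof.
  intros H. assert (E : Cpowz z (- a) * Cpowz z a = 1).
  { rewrite <- Cpowz_add by exact H. now rewrite Z.add_opp_diag_l. }
  replace (/ Cpowz z a) with (/ Cpowz z a * (Cpowz z (- a) * Cpowz z a)) by (rewrite E; ring).
  field. now apply Cpowz_neq0.
Qed.

Lemma Cpowz_mul_l (y z : C) (a : Z) :
  y <> 0 -> z <> 0 -> Cpowz (y * z) a = Cpowz y a * Cpowz z a.
Proof.
  intros Hy Hz. unfold Cpowz. rewrite !Cpown_mul_l. destruct (0 <=? a)%Z; [reflexivity|].
  field; split; now apply Cpown_neq0.
Qed.

Lemma Cpowz_1_l (a : Z) : Cpowz 1 a = 1.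
Proof.
  assert (H : forall n, Cpown 1 n = 1) by (induction n; simpl; [reflexivity|rewrite IHn; ring]).
  unfold Cpowz; rewrite !H. destruct (0 <=? a)%Z; [reflexivity|field; apply C1_nz].
Qed.

Lemma Cpowz_inv_l (z : C) (a : Z) : z <> 0 -> Cpowz (/ z) a = / Cpowz z a.
Proof.
  intros H. assert (E : Cpowz z a * Cpowz (/ z) a = 1).
  { rewrite <- Cpowz_mul_l by (try apply Cinv_nz; exact H).
    rewrite Cinv_r by exact H. apply Cpowz_1_l. }
  replace (Cpowz (/ z) a) with (/ Cpowz z a * (Cpowz z a * Cpowz (/ z) a))
    by (field; now apply Cpowz_neq0).
  rewrite E; ring.
Qed.

Lemma Cpowz_mul (z : C) (a b : Z) : z <> 0 -> Cpowz z (a * b) = Cpowz (Cpowz z a) b.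
Proof.
  intros H. revert b. apply Z.bi_induction.
  - intros x y ->; reflexivity.
  - now rewrite Z.mul_0_r.
  - intros b. rewrite <- (Z.add_1_r b), Z.mul_add_distr_l, Z.mul_1_r, Cpowz_add by exact H.
    rewrite Cpowz_succ by (now apply Cpowz_neq0).
    split; intros E; [rewrite E; ring|].
    replace (Cpowz z (a * b)) with (/ Cpowz z a * (Cpowz z (a * b) * Cpowz z a))
      by (field; now apply Cpowz_neq0).
    rewrite E. field. now apply Cpowz_neq0.
Qed.

Lemma Cmod_Cpowz (z : C) (m : Z) : z <> 0 -> Cmod (Cpowz z m) = powerRZ (Cmod z) m.
Proof.
  intros H. assert (HC : (Cmod z <> 0)%R) by (intros E; apply H, Cmod_eq_0, E).
  destruct (Z_le_gt_dec 0 m) as [Hm|Hm].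
  - rewrite <- (Z2Nat.id m) by lia. rewrite Cpowz_nat, Cmod_Cpown.
    now rewrite <- pow_powerRZ.
  - replace m with (- Z.of_nat (Z.to_nat (- m)))%Z by lia.
    rewrite Cpowz_neg, Cmod_inv, Cmod_Cpown by (now apply Cpown_neq0).
    now rewrite powerRZ_neg', <- pow_powerRZ.
Qed.

Lemma cprod_Cpowz (l : list nat) (f : nat -> C) (a : Z) :
  (forall i, In i l -> f i <> 0) -> cprod l (fun i => Cpowz (f i) a) = Cpowz (cprod l f) a.
Proof.
  induction l as [|b l IH]; intros H; simpl; [now rewrite Cpowz_1_l|].
  rewrite IH by (intros i Hi; apply H; right; exact Hi).
  rewrite Cpowz_mul_l; [reflexivity|apply H; left; reflexivity|].
  apply cprod_neq0; intros i Hi; apply H; right; exact Hi.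
Qed.

(** * Iterated integrals over the torus *)

Definition unit_list (n : nat) (l : list C) : Prop :=
  length l = n /\ (forall z, In z l -> Cmod z = 1%R).

(** [RInt] is linear only on integrable functions, so the slices have to be integrable for every
    value of the earlier angles. *)
Fixpoint torus_integrable (n : nat) (F : list C -> C) : Prop :=
  match n with
  | O => True
  | S n' =>
      (forall th, torus_integrable n' (fun l => F (Ceith th :: l))) /\
      @ex_RInt C_R_NormedModule
        (fun th => torus_int n' (fun l => F (Ceith th :: l))) 0 (2 * PI)
  end.

Lemma Cmod_Ceith (th : R) : Cmod (Ceith th) = 1%R.
Proof.
  unfold Cmod, Ceith; simpl. rewrite <- sqrt_1 at 3. f_equal.
  generalize (sin2_cos2 th); unfold Rsqr; lra.
Qed.

Lemma unit_list_cons (n : nat) (th : R) (l : list C) :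
  unit_list n l -> unit_list (S n) (Ceith th :: l).
Proof.
  intros [H1 H2]; split; simpl; [now rewrite H1|].
  intros z [<-|Hz]; [apply Cmod_Ceith|now apply H2].
Qed.

Lemma torus_int_ext (n : nat) (F G : list C -> C) :
  (forall l, unit_list n l -> F l = G l) -> torus_int n F = torus_int n G.
Proof.
  revert F G; induction n as [|n IH]; intros F G H; simpl.
  - apply H; split; [reflexivity|intros z []].
  - f_equal. apply RInt_ext. intros th _. apply IH. intros l Hl.
    apply H. now apply unit_list_cons.
Qed.

Lemma torus_integrable_ext (n : nat) (F G : list C -> C) :
  (forall l, unit_list n l -> F l = G l) -> torus_integrable n F -> torus_integrable n G.
Proof.
  revert F G; induction n as [|n IH]; intros F G H; simpl; [trivial|].
  intros [H1 H2]; split.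
  - intros th. apply (IH (fun l => F (Ceith th :: l))); [|apply H1].
    intros l Hl; apply H; now apply unit_list_cons.
  - apply (ex_RInt_ext (V := C_R_NormedModule)
      (fun th => torus_int n (fun l => F (Ceith th :: l)))); [|exact H2].
    intros th _. apply torus_int_ext. intros l Hl. apply H. now apply unit_list_cons.
Qed.

Lemma C_RInt_correct (f : R -> C) :
  @ex_RInt C_R_NormedModule f 0 (2 * PI) ->
  @is_RInt C_R_NormedModule f 0 (2 * PI) (@RInt C_R_CompleteNormedModule f 0 (2 * PI)).
Proof. exact (@RInt_correct C_R_CompleteNormedModule f 0 (2 * PI)). Qed.

Lemma C_is_RInt_unique (f : R -> C) (v : C) :
  @is_RInt C_R_NormedModule f 0 (2 * PI) v ->
  @RInt C_R_CompleteNormedModule f 0 (2 * PI) = v.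
Proof. exact (@is_RInt_unique C_R_CompleteNormedModule f 0 (2 * PI) v). Qed.

(** [C_R_NormedModule] is a module over the reals, so [is_RInt_scal] covers real factors only; a
    complex factor mixes the two components, which are therefore treated separately. *)
Lemma is_RInt_Cmult (f : R -> C) (a b : R) (c v : C) :
  @is_RInt C_R_NormedModule f a b v ->
  @is_RInt C_R_NormedModule (fun th => c * f th) a b (c * v).
Proof.
  intros H.
  pose proof (@is_RInt_fct_extend_fst R_NormedModule R_NormedModule _ _ _ _ H) as H1.
  pose proof (@is_RInt_fct_extend_snd R_NormedModule R_NormedModule _ _ _ _ H) as H2.
  apply (@is_RInt_fct_extend_pair R_NormedModule R_NormedModule); simpl.
  - apply (is_RInt_minus (V := R_NormedModule));
      apply (is_RInt_scal (V := R_NormedModule)); assumption.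
  - apply (is_RInt_plus (V := R_NormedModule));
      apply (is_RInt_scal (V := R_NormedModule)); assumption.
Qed.

Lemma torus_int_scal (n : nat) (F : list C -> C) (c : C) :
  torus_integrable n F ->
  torus_integrable n (fun l => c * F l) /\
  torus_int n (fun l => c * F l) = c * torus_int n F.
Proof.
  revert F; induction n as [|n IH]; intros F H; simpl; [auto|].
  destruct H as [H1 H2]. apply C_RInt_correct in H2.
  apply (is_RInt_Cmult _ _ _ c) in H2.
  assert (E : forall th, torus_int n (fun l => c * F (Ceith th :: l)) =
    c * torus_int n (fun l => F (Ceith th :: l))) by (intros th; apply IH, H1).
  apply (is_RInt_ext (V := C_R_NormedModule) _
    (fun th => torus_int n (fun l => c * F (Ceith th :: l)))) in H2;
    [|intros th _; symmetry; apply E].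
  split.
  - split; [intros th; apply IH, H1|eexists; exact H2].
  - rewrite (C_is_RInt_unique _ _ H2). ring.
Qed.

Lemma torus_int_plus (n : nat) (F G : list C -> C) :
  torus_integrable n F -> torus_integrable n G ->
  torus_integrable n (fun l => F l + G l) /\
  torus_int n (fun l => F l + G l) = torus_int n F + torus_int n G.
Proof.
  revert F G; induction n as [|n IH]; intros F G HF HG; simpl; [auto|].
  destruct HF as [F1 F2], HG as [G1 G2].
  apply C_RInt_correct in F2; apply C_RInt_correct in G2.
  assert (H2 := is_RInt_plus (V := C_R_NormedModule) _ _ _ _ _ _ F2 G2).
  apply (is_RInt_ext (V := C_R_NormedModule) _
    (fun th => torus_int n (fun l => F (Ceith th :: l) + G (Ceith th :: l)))) in H2;
    [|intros th _; symmetry; apply IH; [apply F1|apply G1]].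
  split.
  - split; [intros th; apply IH; [apply F1|apply G1]|eexists; exact H2].
  - rewrite (C_is_RInt_unique _ _ H2).
    change (@plus C_R_NormedModule) with Cplus. ring.
Qed.

Lemma twoPI_pos : (0 < 2 * PI)%R.
Proof. generalize PI_RGT_0; lra. Qed.

Lemma torus_int_bound (n : nat) (F : list C -> C) (M : R) :
  torus_integrable n F -> (forall l, unit_list n l -> (Cmod (F l) <= M)%R) ->
  (Cmod (torus_int n F) <= M)%R.
Proof.
  revert F; induction n as [|n IH]; intros F HF HM; simpl.
  - apply HM; split; [reflexivity|intros z []].
  - destruct HF as [F1 F2]. apply C_RInt_correct in F2.
    assert (P := twoPI_pos).
    rewrite Cmod_mult, Cmod_R, Rabs_pos_eq by (left; now apply Rinv_0_lt_compat).
    assert (H : (Cmod (@RInt C_R_CompleteNormedModule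
      (fun th => torus_int n (fun l => F (Ceith th :: l))) 0 (2 * PI)) <= (2 * PI - 0) * M)%R).
    { rewrite Cmod_norm.
      apply (norm_RInt_le_const (V := C_R_NormedModule)
        (fun th => torus_int n (fun l => F (Ceith th :: l)))); [lra| |exact F2].
      intros th _.
      apply Rle_trans with (Cmod (torus_int n (fun l => F (Ceith th :: l))));
        [right; symmetry; apply Cmod_norm|].
      apply IH; [apply F1|]. intros l Hl; apply HM; now apply unit_list_cons. }
    apply (Rmult_le_compat_l (/ (2 * PI))) in H; [|left; now apply Rinv_0_lt_compat].
    eapply Rle_trans; [exact H|]. right; field; lra.
Qed.

Lemma torus_int_dist (n : nat) (F G : list C -> C) (eps : R) :
  torus_integrable n F -> torus_integrable n G ->
  (forall l, unit_list n l -> (Cmod (F l - G l) <= eps)%R) ->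
  (Cmod (torus_int n F - torus_int n G) <= eps)%R.
Proof.
  intros HF HG H.
  destruct (torus_int_scal n G (-1) HG) as [HG' EG].
  destruct (torus_int_plus n F _ HF HG') as [HS ES].
  replace (torus_int n F - torus_int n G) with (torus_int n (fun l => F l + -1 * G l))
    by (rewrite ES, EG; ring).
  apply torus_int_bound; [exact HS|]. intros l Hl.
  replace (F l + -1 * G l) with (F l - G l) by ring. now apply H.
Qed.

(** This is how integrands built from infinite products become integrable: slices of uniform
    approximants are uniform approximants of the slices. *)
Lemma torus_integrable_limit (n : nat) (F : list C -> C) :
  (forall eps, (0 < eps)%R -> exists G, torus_integrable n G /\
     forall l, unit_list n l -> (Cmod (F l - G l) <= eps)%R) ->
  torus_integrable n F.
Proof.
  revert F; induction n as [|n IH]; intros F H; simpl; [trivial|].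
  assert (H1 : forall th, torus_integrable n (fun l => F (Ceith th :: l))).
  { intros th. apply IH. intros eps Heps. destruct (H eps Heps) as (G & [G1 _] & G3).
    exists (fun l => G (Ceith th :: l)); split; [apply G1|].
    intros l Hl; apply G3; now apply unit_list_cons. }
  split; [exact H1|].
  assert (Hpos : forall k, (0 < / (INR k + 1))%R)
    by (intros k; apply Rinv_0_lt_compat; generalize (pos_INR k); lra).
  (* [filterlim_RInt] asks for an indexed family, so one approximant is chosen for each tolerance
     1/(k+1). *)
  pose (G := fun k : nat => proj1_sig (constructive_indefinite_description _ (H _ (Hpos k)))).
  assert (HG : forall k, torus_integrable (S n) (G k) /\
     forall l, unit_list (S n) l -> (Cmod (F l - G k l) <= / (INR k + 1))%R)
    by (intros k; unfold G; apply proj2_sig).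
  destruct (filterlim_RInt (V := C_R_CompleteNormedModule)
    (fun k th => torus_int n (fun l => G k (Ceith th :: l))) 0 (2 * PI) eventually
    eventually_filter
    (fun th => torus_int n (fun l => F (Ceith th :: l)))
    (fun k => @RInt C_R_CompleteNormedModule
      (fun th => torus_int n (fun l => G k (Ceith th :: l))) 0 (2 * PI))) as (If & _ & HIf).
  - intros k. apply C_RInt_correct. apply HG.
  - apply filterlim_locally. intros eps.
    destruct (archimed_cor1 eps (cond_pos eps)) as (k0 & Hk0 & Hk0').
    exists k0. intros k Hk th. apply C_NormedModule_mixin_compat1.
    change (Cmod (torus_int n (fun l => G k (Ceith th :: l)) -
      torus_int n (fun l => F (Ceith th :: l))) < eps)%R.
    rewrite <- Cmod_opp, Copp_minus_distr.
    apply Rle_lt_trans with (/ (INR k + 1))%R.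
    + apply torus_int_dist; [apply H1|apply HG|].
      intros l Hl. apply HG; now apply unit_list_cons.
    + apply Rlt_trans with (2 := Hk0).
      apply Rinv_lt_contravar.
      * apply Rmult_lt_0_compat; [now apply lt_0_INR|generalize (pos_INR k); lra].
      * apply le_INR in Hk; lra.
  - exists If; exact HIf.
Qed.

Lemma Cpown_Ceith (th : R) (n : nat) : Cpown (Ceith th) n = Ceith (INR n * th).
Proof.
  induction n as [|n IH].
  - simpl. unfold Ceith. rewrite Rmult_0_l, cos_0, sin_0. reflexivity.
  - change (Ceith th * Cpown (Ceith th) n = Ceith (INR (S n) * th)).
    rewrite IH, S_INR. replace ((INR n + 1) * th)%R with (th + INR n * th)%R by ring.
    unfold Ceith, Cmult; simpl. rewrite cos_plus, sin_plus. f_equal; ring.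
Qed.

Lemma Ceith_neq0 (th : R) : Ceith th <> 0.
Proof. intros E. generalize (Cmod_Ceith th). rewrite E, Cmod_0. lra. Qed.

Lemma Cpowz_Ceith (th : R) (e : Z) : Cpowz (Ceith th) e = Ceith (IZR e * th).
Proof.
  destruct (Z_le_gt_dec 0 e) as [Hm|Hm].
  - rewrite <- (Z2Nat.id e) by lia. now rewrite Cpowz_nat, Cpown_Ceith, <- INR_IZR_INZ.
  - replace e with (- Z.of_nat (Z.to_nat (- e)))%Z by lia.
    rewrite Cpowz_neg, Cpown_Ceith, INR_IZR_INZ, opp_IZR.
    set (x := (IZR _ * th)%R).
    replace (- IZR (Z.of_nat (Z.to_nat (- e))) * th)%R with (- x)%R by (unfold x; ring).
    assert (E : Ceith (- x) * Ceith x = 1).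
    { unfold Ceith, Cmult; simpl. rewrite cos_neg, sin_neg.
      generalize (sin2_cos2 x); unfold Rsqr; intros E.
      apply injective_projections; simpl; [lra|ring]. }
    replace (/ Ceith x) with (Ceith (- x) * Ceith x * / Ceith x) by (rewrite E; ring).
    field. apply Ceith_neq0.
Qed.

Lemma is_RInt_Cpowz_Ceith (e : Z) :
  @is_RInt C_R_NormedModule (fun th => Cpowz (Ceith th) e) 0 (2 * PI)
    (if (e =? 0)%Z then RtoC (2 * PI) else RtoC 0).
Proof.
  apply (is_RInt_ext (V := C_R_NormedModule) (fun th => Ceith (IZR e * th)));
    [intros th _; symmetry; apply Cpowz_Ceith|].
  destruct (e =? 0)%Z eqn:E.
  - apply Z.eqb_eq in E; subst.
    apply (is_RInt_ext (V := C_R_NormedModule) (fun th => RtoC 1)).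
    + intros th _. unfold Ceith. now rewrite Rmult_0_l, cos_0, sin_0.
    + apply (@is_RInt_fct_extend_pair R_NormedModule R_NormedModule); simpl.
      * evar_last; [apply (is_RInt_const (V := R_NormedModule))|].
        change (scal (2 * PI - 0)%R 1%R) with ((2 * PI - 0) * 1)%R. ring.
      * evar_last; [apply (is_RInt_const (V := R_NormedModule))|].
        change (scal (2 * PI - 0)%R 0%R) with ((2 * PI - 0) * 0)%R. ring.
  - apply Z.eqb_neq in E. assert (HE : IZR e <> 0%R) by (intros H; apply E, eq_IZR, H).
    (* The values at integer multiples of 2 pi are read off from 1^k = 1. *)
    assert (Hp : forall k : Z, sin (IZR k * (2 * PI)) = 0%R /\ cos (IZR k * (2 * PI)) = 1%R).
    { intros k. assert (Ek := Cpowz_Ceith (2 * PI) k).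
      replace (Ceith (2 * PI)) with (RtoC 1) in Ek
        by (unfold Ceith; now rewrite cos_2PI, sin_2PI).
      rewrite Cpowz_1_l in Ek. unfold Ceith in Ek. now inversion Ek. }
    destruct (Hp e) as [Hs Hc].
    apply (@is_RInt_fct_extend_pair R_NormedModule R_NormedModule); simpl.
    + evar_last.
      * apply (is_RInt_derive (fun th => sin (IZR e * th) / IZR e)%R).
        -- intros th _. auto_derive; [trivial|field; exact HE].
        -- intros th _. apply (ex_derive_continuous (V := R_NormedModule)). auto_derive; trivial.
      * rewrite Hs, Rmult_0_r, sin_0. unfold minus, plus, opp; simpl. field; exact HE.
    + evar_last.
      * apply (is_RInt_derive (fun th => - cos (IZR e * th) / IZR e)%R).
        -- intros th _. auto_derive; [trivial|field; exact HE].
        -- intros th _. apply (ex_derive_continuous (V := R_NormedModule)). auto_derive; trivial.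
      * rewrite Hc, Rmult_0_r, cos_0. unfold minus, plus, opp; simpl. field; exact HE.
Qed.

(** * Constant terms of locally uniform limits of Laurent polynomials *)

(* Variables are functions [nat -> C] of which only the values at 1, ..., N matter;
   the default value 1 keeps all of them on the unit circle. *)
Definition lvar (l : list C) (i : nat) : C := nth (i - 1) l 1.

Definition CT (N : nat) (f : (nat -> C) -> C) : C := torus_int N (fun l => f (lvar l)).

Definition mono (N : nat) (e : nat -> Z) (s : nat -> C) : C :=
  cprod (seq 1 N) (fun i => Cpowz (s i) (e i)).

Definition nonvanishing (s : nat -> C) : Prop := forall i, s i <> 0.

Definition annulus (r : R) (s : nat -> C) : Prop :=
  forall i, (r <= Cmod (s i) <= / r)%R.

Definition leval (N : nat) (L : list (C * (nat -> Z))) (s : nat -> C) : C :=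
  fold_right (fun p acc => fst p * mono N (snd p) s + acc) 0 L.

Definition laurent (N : nat) (g : (nat -> C) -> C) : Prop :=
  exists L, forall s, nonvanishing s -> g s = leval N L s.

(** The holomorphic functions of N nonzero variables, in disguise. Approximation on every annulus,
    and not only on the torus, makes the class stable under dilations. *)
Definition laurent_limit (N : nat) (f : (nat -> C) -> C) : Prop :=
  forall r eps, (0 < r)%R -> (0 < eps)%R ->
    exists g, laurent N g /\ forall s, annulus r s -> (Cmod (f s - g s) <= eps)%R.

Lemma lvar_unit (n : nat) (l : list C) :
  unit_list n l -> forall i, Cmod (lvar l i) = 1%R.
Proof.
  intros [_ H] i. unfold lvar. destruct (nth_in_or_default (i - 1) l (RtoC 1)) as [Hi| ->].
  - now apply H.
  - apply Cmod_1.
Qed.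

Lemma Cmod_pos_neq0 (z : C) : (0 < Cmod z)%R -> z <> 0.
Proof. intros H ->. rewrite Cmod_0 in H. lra. Qed.

Lemma annulus_nonvanishing (r : R) (s : nat -> C) :
  (0 < r)%R -> annulus r s -> nonvanishing s.
Proof. intros Hr H i. apply Cmod_pos_neq0. generalize (H i); lra. Qed.

Lemma unit_annulus (r : R) (s : nat -> C) :
  (0 < r <= 1)%R -> (forall i, Cmod (s i) = 1%R) -> annulus r s.
Proof.
  intros Hr H i. rewrite H. split; [lra|].
  rewrite <- Rinv_1. apply Rinv_le_contravar; lra.
Qed.

Lemma unit_nonvanishing (s : nat -> C) :
  (forall i, Cmod (s i) = 1%R) -> nonvanishing s.
Proof. intros H. apply (annulus_nonvanishing 1); [lra|]. apply unit_annulus; [lra|exact H]. Qed.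

Lemma lvar_nonvanishing (n : nat) (l : list C) : unit_list n l -> nonvanishing (lvar l).
Proof. intros H. apply unit_nonvanishing, (lvar_unit n l H). Qed.

Lemma CT_ext (N : nat) (f g : (nat -> C) -> C) :
  (forall s, nonvanishing s -> f s = g s) -> CT N f = CT N g.
Proof.
  intros H. apply torus_int_ext. intros l Hl. apply H, (lvar_nonvanishing N), Hl.
Qed.

Lemma mono_cons (n : nat) (e : nat -> Z) (z : C) (l : list C) :
  mono (S n) e (lvar (z :: l)) = Cpowz z (e 1%nat) * mono n (fun i => e (S i)) (lvar l).
Proof.
  unfold mono. simpl seq. simpl cprod. f_equal. rewrite cprod_shift.
  apply cprod_ext_seq. intros i Hi. f_equal. unfold lvar.
  replace (S i - 1)%nat with (S (i - 1)) by lia. reflexivity.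
Qed.

Definition zero_exp (N : nat) (e : nat -> Z) : bool :=
  forallb (fun i => (e i =? 0)%Z) (seq 1 N).

Lemma zero_exp_true (N : nat) (e : nat -> Z) :
  zero_exp N e = true <-> (forall i, (1 <= i <= N)%nat -> e i = 0%Z).
Proof.
  unfold zero_exp. rewrite forallb_forall. split.
  - intros H i Hi. apply Z.eqb_eq, H, in_seq. lia.
  - intros H i Hi. apply in_seq in Hi. apply Z.eqb_eq, H. lia.
Qed.

Lemma zero_exp_S (n : nat) (e : nat -> Z) :
  zero_exp (S n) e = ((e 1%nat =? 0)%Z && zero_exp n (fun i => e (S i)))%bool.
Proof.
  apply Bool.eq_iff_eq_true. rewrite Bool.andb_true_iff, !zero_exp_true, Z.eqb_eq.
  split.
  - intros H; split; [apply H; lia|]. intros i Hi; apply H; lia.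
  - intros [H1 H2] [|[|i]] Hi; [lia|exact H1|]. apply (H2 (S i)). lia.
Qed.

Lemma torus_int_mono (N : nat) (e : nat -> Z) :
  torus_integrable N (fun l => mono N e (lvar l)) /\
  CT N (mono N e) = if zero_exp N e then 1 else 0.
Proof.
  revert e; induction N as [|n IH]; intros e; [split; [exact I|reflexivity]|].
  rewrite zero_exp_S. unfold CT in *. simpl.
  destruct (IH (fun i => e (S i))) as [IH1 IH2].
  assert (H : forall th, torus_integrable n (fun l => mono (S n) e (lvar (Ceith th :: l))) /\
    torus_int n (fun l => mono (S n) e (lvar (Ceith th :: l))) =
    (if zero_exp n (fun i => e (S i)) then 1 else 0) * Cpowz (Ceith th) (e 1%nat)).
  { intros th.
    destruct (torus_int_scal n _ (Cpowz (Ceith th) (e 1%nat)) IH1) as [A B].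
    split.
    - eapply torus_integrable_ext; [|exact A]. intros l _. now rewrite mono_cons.
    - erewrite torus_int_ext; [|intros l _; apply mono_cons].
      rewrite B, IH2. ring. }
  assert (HI := is_RInt_Cmult _ _ _ (if zero_exp n (fun i => e (S i)) then 1 else 0) _
    (is_RInt_Cpowz_Ceith (e 1%nat))).
  apply (is_RInt_ext (V := C_R_NormedModule) _
    (fun th => torus_int n (fun l => mono (S n) e (lvar (Ceith th :: l))))) in HI;
    [|intros th _; symmetry; apply H].
  split.
  - split; [intros th; apply H|eexists; exact HI].
  - rewrite (C_is_RInt_unique _ _ HI).
    assert (P := twoPI_pos).
    destruct (e 1%nat =? 0)%Z, (zero_exp n (fun i => e (S i))); simpl; try ring.
    rewrite RtoC_inv by lra. field. intros E; inversion E; lra.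
Qed.

Lemma mono_add (N : nat) (e e' : nat -> Z) (s : nat -> C) :
  nonvanishing s -> mono N (fun i => (e i + e' i)%Z) s = mono N e s * mono N e' s.
Proof.
  intros H. unfold mono. rewrite <- cprod_mul. apply cprod_ext. intros i _.
  now apply Cpowz_add.
Qed.

Lemma mono_ext (N : nat) (e e' : nat -> Z) (s : nat -> C) :
  (forall i, (1 <= i <= N)%nat -> e i = e' i) -> mono N e s = mono N e' s.
Proof. intros H. apply cprod_ext_seq. intros i Hi. now rewrite H. Qed.

Lemma mono_delta (N i : nat) (m : Z) (s : nat -> C) : (1 <= i <= N)%nat ->
  mono N (fun j => if (j =? i)%nat then m else 0%Z) s = Cpowz (s i) m.
Proof.
  unfold mono. induction N as [|N IH]; intros H; [lia|].
  rewrite cprod_S. replace (1 + N)%nat with (S N) by lia.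
  destruct (Nat.eq_dec i (S N)) as [->|Hi].
  - rewrite Nat.eqb_refl, cprod_one; [ring|].
    intros j Hj. apply in_seq in Hj. rewrite (proj2 (Nat.eqb_neq j (S N))) by lia. reflexivity.
  - rewrite IH by lia. rewrite (proj2 (Nat.eqb_neq (S N) i)) by lia. rewrite Cpowz_0. ring.
Qed.

Lemma mono_const (N : nat) (m : Z) (s : nat -> C) : nonvanishing s ->
  mono N (fun _ => m) s = Cpowz (cprod (seq 1 N) s) m.
Proof. intros H. unfold mono. apply cprod_Cpowz. intros i _; apply H. Qed.

Lemma leval_app (N : nat) (L L' : list (C * (nat -> Z))) (s : nat -> C) :
  leval N (L ++ L') s = leval N L s + leval N L' s.
Proof. induction L as [|p L IH]; simpl; [ring|]. rewrite IH. ring. Qed.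

Lemma laurent_mono (N : nat) (e : nat -> Z) : laurent N (mono N e).
Proof. exists ((RtoC 1, e) :: nil). intros s _. simpl. ring. Qed.

Lemma laurent_plus (N : nat) (f g : (nat -> C) -> C) :
  laurent N f -> laurent N g -> laurent N (fun s => f s + g s).
Proof.
  intros [L HL] [L' HL']. exists (L ++ L'). intros s Hs.
  now rewrite leval_app, HL, HL'.
Qed.

Lemma laurent_scal_mono (N : nat) (g : (nat -> C) -> C) (c : C) (e : nat -> Z) :
  laurent N g -> laurent N (fun s => c * mono N e s * g s).
Proof.
  intros [L HL]. exists (map (fun p => (c * fst p, fun i => (e i + snd p i)%Z)) L).
  intros s Hs. rewrite HL by exact Hs. clear HL. induction L as [|p L IH]; simpl; [ring|].
  rewrite <- IH, mono_add by exact Hs. ring.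
Qed.

Lemma laurent_ext (N : nat) (f g : (nat -> C) -> C) :
  (forall s, nonvanishing s -> f s = g s) -> laurent N f -> laurent N g.
Proof. intros H [L HL]. exists L. intros s Hs. rewrite <- H by exact Hs. now apply HL. Qed.

Lemma laurent_mult (N : nat) (f g : (nat -> C) -> C) :
  laurent N f -> laurent N g -> laurent N (fun s => f s * g s).
Proof.
  intros [L HL] Hg. apply (laurent_ext N (fun s => leval N L s * g s)).
  { intros s Hs. now rewrite HL. }
  clear f HL. induction L as [|p L IH].
  - exists nil. intros s _; simpl; ring.
  - apply (laurent_ext N (fun s => fst p * mono N (snd p) s * g s + leval N L s * g s)).
    + intros s _; simpl; ring.
    + apply laurent_plus; [now apply laurent_scal_mono|exact IH].
Qed.

Lemma laurent_const (N : nat) (c : C) : laurent N (fun _ => c).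
Proof.
  exists ((c, fun _ => 0%Z) :: nil). intros s _; simpl. unfold mono.
  rewrite cprod_one; [ring|reflexivity].
Qed.

Lemma Cmod_Cpowz_annulus (z : C) (r : R) (e : Z) : (0 < r)%R ->
  (r <= Cmod z <= / r)%R -> (Cmod (Cpowz z e) <= (/ r) ^ Z.to_nat (Z.abs e))%R.
Proof.
  intros Hr Hz. assert (Hz0 : z <> 0) by (apply Cmod_pos_neq0; lra).
  destruct (Z_le_gt_dec 0 e) as [He|He].
  - rewrite <- (Z2Nat.id e) at 1 by lia. rewrite Cpowz_nat, Cmod_Cpown, Z.abs_eq by lia.
    apply pow_incr. lra.
  - replace e with (- Z.of_nat (Z.to_nat (- e)))%Z at 1 by lia.
    rewrite Cpowz_neg, Cmod_inv, Cmod_Cpown by (now apply Cpown_neq0).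
    rewrite Z.abs_neq by lia. rewrite <- pow_inv. apply pow_incr.
    split; [left; apply Rinv_0_lt_compat; lra|]. apply Rinv_le_contravar; lra.
Qed.

Lemma laurent_bounded (N : nat) (g : (nat -> C) -> C) (r : R) : (0 < r)%R -> laurent N g ->
  exists B, (0 <= B)%R /\ forall s, annulus r s -> (Cmod (g s) <= B)%R.
Proof.
  intros Hr [L HL].
  assert (H : exists B, (0 <= B)%R /\ forall s, annulus r s -> (Cmod (leval N L s) <= B)%R).
  { clear g HL. induction L as [|p L (B & HB0 & HB)].
    - exists 0%R. split; [lra|]. intros s _; simpl. rewrite Cmod_0; lra.
    - assert (Hm : exists M, (0 <= M)%R /\
        forall s, annulus r s -> (Cmod (mono N (snd p) s) <= M)%R).
      { unfold mono. generalize (seq 1 N). intros l. induction l as [|a l (M & HM0 & HM)].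
        - exists 1%R. split; [lra|]. intros s _; simpl. rewrite Cmod_1; lra.
        - exists ((/ r) ^ Z.to_nat (Z.abs (snd p a)) * M)%R. split.
          + apply Rmult_le_pos; [|exact HM0]. apply pow_le. left; now apply Rinv_0_lt_compat.
          + intros s Hs; simpl. rewrite Cmod_mult.
            apply Rmult_le_compat; try apply Cmod_ge_0; [|now apply HM].
            now apply Cmod_Cpowz_annulus. }
      destruct Hm as (M & HM0 & HM).
      exists (Cmod (fst p) * M + B)%R. split.
      + apply Rplus_le_le_0_compat; [|exact HB0]. apply Rmult_le_pos; [apply Cmod_ge_0|exact HM0].
      + intros s Hs; simpl. eapply Rle_trans; [apply Cmod_triangle|].
        apply Rplus_le_compat; [|now apply HB]. rewrite Cmod_mult.
        apply Rmult_le_compat_l; [apply Cmod_ge_0|now apply HM]. }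
  destruct H as (B & HB0 & HB). exists B. split; [exact HB0|].
  intros s Hs. rewrite HL by (now apply (annulus_nonvanishing r)). now apply HB.
Qed.

Lemma laurent_limit_bounded (N : nat) (f : (nat -> C) -> C) (r : R) :
  (0 < r)%R -> laurent_limit N f ->
  exists B, (0 < B)%R /\ forall s, annulus r s -> (Cmod (f s) <= B)%R.
Proof.
  intros Hr Hf. destruct (Hf r 1%R Hr Rlt_0_1) as (g & Hg & Hfg).
  destruct (laurent_bounded N g r Hr Hg) as (B & HB0 & HB).
  exists (1 + B)%R. split; [lra|]. intros s Hs.
  replace (f s) with ((f s - g s) + g s) by ring.
  eapply Rle_trans; [apply Cmod_triangle|]. apply Rplus_le_compat; auto.
Qed.

Lemma laurent_limit_laurent (N : nat) (g : (nat -> C) -> C) : laurent N g -> laurent_limit N g.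
Proof.
  intros Hg r eps _ He. exists g. split; [exact Hg|]. intros s _.
  replace (g s - g s) with (RtoC 0) by ring. rewrite Cmod_0; lra.
Qed.

Lemma laurent_limit_ext (N : nat) (f g : (nat -> C) -> C) :
  (forall s, nonvanishing s -> f s = g s) -> laurent_limit N f -> laurent_limit N g.
Proof.
  intros H Hf r eps Hr He. destruct (Hf r eps Hr He) as (h & Hh & Hfh).
  exists h. split; [exact Hh|]. intros s Hs. rewrite <- H by (now apply (annulus_nonvanishing r)).
  now apply Hfh.
Qed.

Lemma laurent_limit_plus (N : nat) (f g : (nat -> C) -> C) :
  laurent_limit N f -> laurent_limit N g -> laurent_limit N (fun s => f s + g s).
Proof.
  intros Hf Hg r eps Hr He.
  destruct (Hf r (eps / 2)%R Hr ltac:(lra)) as (f' & Hf' & Hff).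
  destruct (Hg r (eps / 2)%R Hr ltac:(lra)) as (g' & Hg' & Hgg).
  exists (fun s => f' s + g' s). split; [now apply laurent_plus|]. intros s Hs.
  replace (f s + g s - (f' s + g' s)) with ((f s - f' s) + (g s - g' s)) by ring.
  eapply Rle_trans; [apply Cmod_triangle|]. specialize (Hff s Hs). specialize (Hgg s Hs). lra.
Qed.

Lemma laurent_limit_mult (N : nat) (f g : (nat -> C) -> C) :
  laurent_limit N f -> laurent_limit N g -> laurent_limit N (fun s => f s * g s).
Proof.
  intros Hf Hg r eps Hr He.
  destruct (laurent_limit_bounded N g r Hr Hg) as (B & HB0 & HB).
  destruct (Hf r (eps / 2 / B)%R Hr) as (f' & Hf' & Hff).
  { apply Rdiv_lt_0_compat; lra. }
  destruct (laurent_bounded N f' r Hr Hf') as (B' & HB0' & HB').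
  (* The tolerance for g depends on a bound for f', so f' is fixed first; B' may be 0, hence B' +
     1. *)
  destruct (Hg r (eps / 2 / (B' + 1))%R Hr) as (g' & Hg' & Hgg).
  { apply Rdiv_lt_0_compat; lra. }
  exists (fun s => f' s * g' s). split; [now apply laurent_mult|]. intros s Hs.
  replace (f s * g s - f' s * g' s) with ((f s - f' s) * g s + f' s * (g s - g' s)) by ring.
  eapply Rle_trans; [apply Cmod_triangle|]. rewrite !Cmod_mult.
  assert (A1 : (Cmod (f s - f' s) * Cmod (g s) <= eps / 2 / B * B)%R)
    by (apply Rmult_le_compat; try apply Cmod_ge_0; auto).
  assert (A2 : (Cmod (f' s) * Cmod (g s - g' s) <= (B' + 1) * (eps / 2 / (B' + 1)))%R).
  { apply Rmult_le_compat; try apply Cmod_ge_0; auto. specialize (HB' s Hs); lra. }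
  replace (eps / 2 / B * B)%R with (eps / 2)%R in A1 by (field; lra).
  replace ((B' + 1) * (eps / 2 / (B' + 1)))%R with (eps / 2)%R in A2 by (field; lra).
  lra.
Qed.

Lemma laurent_limit_limit (N : nat) (f : (nat -> C) -> C) :
  (forall r eps, (0 < r)%R -> (0 < eps)%R ->
    exists g, laurent_limit N g /\ forall s, annulus r s -> (Cmod (f s - g s) <= eps)%R) ->
  laurent_limit N f.
Proof.
  intros H r eps Hr He. destruct (H r (eps / 2)%R Hr ltac:(lra)) as (g & Hg & Hfg).
  destruct (Hg r (eps / 2)%R Hr ltac:(lra)) as (g' & Hg' & Hgg).
  exists g'. split; [exact Hg'|]. intros s Hs.
  replace (f s - g' s) with ((f s - g s) + (g s - g' s)) by ring.
  eapply Rle_trans; [apply Cmod_triangle|]. specialize (Hfg s Hs). specialize (Hgg s Hs). lra.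
Qed.

Lemma laurent_limit_const (N : nat) (c : C) : laurent_limit N (fun _ => c).
Proof. apply laurent_limit_laurent, laurent_const. Qed.

Lemma laurent_limit_mono (N : nat) (e : nat -> Z) : laurent_limit N (mono N e).
Proof. apply laurent_limit_laurent, laurent_mono. Qed.

Lemma laurent_limit_Cpowz (N i : nat) (m : Z) : (1 <= i <= N)%nat ->
  laurent_limit N (fun s => Cpowz (s i) m).
Proof.
  intros Hi. eapply laurent_limit_ext; [|apply (laurent_limit_mono N
    (fun j => if (j =? i)%nat then m else 0%Z))].
  intros s _. now apply mono_delta.
Qed.

Lemma laurent_limit_var (N i : nat) : (1 <= i <= N)%nat -> laurent_limit N (fun s => s i).
Proof.
  intros Hi. eapply laurent_limit_ext; [|apply (laurent_limit_Cpowz N i 1 Hi)].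
  intros s _. apply Cpowz_1.
Qed.

Lemma laurent_limit_inv (N i : nat) : (1 <= i <= N)%nat -> laurent_limit N (fun s => / s i).
Proof.
  intros Hi. eapply laurent_limit_ext; [|apply (laurent_limit_Cpowz N i (-1) Hi)].
  intros s _. change (/ Cpown (s i) 1 = / s i). simpl. now rewrite Cmult_1_r.
Qed.

Lemma laurent_limit_cprod (N : nat) (l : list nat) (F : nat -> (nat -> C) -> C) :
  (forall i, In i l -> laurent_limit N (F i)) ->
  laurent_limit N (fun s => cprod l (fun i => F i s)).
Proof.
  induction l as [|a l IH]; intros H; simpl; [apply laurent_limit_const|].
  apply laurent_limit_mult; [apply H; left; reflexivity|].
  apply IH; intros i Hi; apply H; right; exact Hi.
Qed.

Lemma laurent_limit_csum (N : nat) (l : list nat) (F : nat -> (nat -> C) -> C) :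
  (forall i, In i l -> laurent_limit N (F i)) ->
  laurent_limit N (fun s => csum l (fun i => F i s)).
Proof.
  induction l as [|a l IH]; intros H; simpl; [apply laurent_limit_const|].
  apply laurent_limit_plus; [apply H; left; reflexivity|].
  apply IH; intros i Hi; apply H; right; exact Hi.
Qed.

Lemma laurent_integrable (N : nat) (g : (nat -> C) -> C) :
  laurent N g -> torus_integrable N (fun l => g (lvar l)).
Proof.
  intros [L HL]. apply (torus_integrable_ext N (fun l => leval N L (lvar l))).
  { intros l Hl. symmetry. apply HL, (lvar_nonvanishing N), Hl. }
  clear g HL. induction L as [|p L IH]; simpl.
  - apply (torus_integrable_ext N (fun l => 0 * mono N (fun _ => 0%Z) (lvar l))).
    + intros l _; ring.
    + apply torus_int_scal, torus_int_mono.
  - apply torus_int_plus; [apply torus_int_scal, torus_int_mono|exact IH].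
Qed.

Lemma laurent_limit_integrable (N : nat) (f : (nat -> C) -> C) :
  laurent_limit N f -> torus_integrable N (fun l => f (lvar l)).
Proof.
  intros Hf. apply torus_integrable_limit. intros eps He.
  destruct (Hf 1%R eps Rlt_0_1 He) as (g & Hg & Hfg).
  exists (fun l => g (lvar l)). split; [now apply laurent_integrable|].
  intros l Hl. apply Hfg, unit_annulus; [lra|]. exact (lvar_unit N l Hl).
Qed.

Lemma CT_plus (N : nat) (f g : (nat -> C) -> C) :
  laurent_limit N f -> laurent_limit N g -> CT N (fun s => f s + g s) = CT N f + CT N g.
Proof.
  intros Hf Hg. unfold CT.
  exact (proj2 (torus_int_plus N _ _ (laurent_limit_integrable N f Hf)
    (laurent_limit_integrable N g Hg))).
Qed.

Lemma CT_scal (N : nat) (f : (nat -> C) -> C) (c : C) :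
  laurent_limit N f -> CT N (fun s => c * f s) = c * CT N f.
Proof.
  intros Hf. exact (proj2 (torus_int_scal N _ c (laurent_limit_integrable N f Hf))).
Qed.

Lemma CT_zero (N : nat) : CT N (fun _ => 0) = 0.
Proof.
  transitivity (CT N (fun _ => 0 * 0)); [apply CT_ext; intros s _; ring|].
  rewrite (CT_scal N (fun _ => 0)) by apply laurent_limit_const. ring.
Qed.

Lemma CT_csum (N : nat) (l : list nat) (F : nat -> (nat -> C) -> C) :
  (forall i, In i l -> laurent_limit N (F i)) ->
  CT N (fun s => csum l (fun i => F i s)) = csum l (fun i => CT N (F i)).
Proof.
  induction l as [|a l IH]; intros H; simpl; [apply CT_zero|].
  rewrite CT_plus.
  - rewrite IH; [reflexivity|]. intros i Hi; apply H; right; exact Hi.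
  - apply H; left; reflexivity.
  - apply laurent_limit_csum. intros i Hi; apply H; right; exact Hi.
Qed.

Lemma CT_bound (N : nat) (f : (nat -> C) -> C) (M : R) : laurent_limit N f ->
  (forall s, (forall i, Cmod (s i) = 1%R) -> (Cmod (f s) <= M)%R) -> (Cmod (CT N f) <= M)%R.
Proof.
  intros Hf HM. apply torus_int_bound; [now apply laurent_limit_integrable|].
  intros l Hl. apply HM. exact (lvar_unit N l Hl).
Qed.

Lemma CT_dist (N : nat) (f g : (nat -> C) -> C) (eps : R) :
  laurent_limit N f -> laurent_limit N g ->
  (forall s, (forall i, Cmod (s i) = 1%R) -> (Cmod (f s - g s) <= eps)%R) ->
  (Cmod (CT N f - CT N g) <= eps)%R.
Proof.
  intros Hf Hg H. apply torus_int_dist; try now apply laurent_limit_integrable.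
  intros l Hl. apply H. exact (lvar_unit N l Hl).
Qed.

Lemma CT_leval (N : nat) (L : list (C * (nat -> Z))) :
  CT N (leval N L) =
  fold_right (fun p acc => fst p * CT N (mono N (snd p)) + acc) 0 L.
Proof.
  induction L as [|p L IH]; simpl; [apply CT_zero|].
  rewrite <- IH, <- CT_scal by apply laurent_limit_mono.
  change (CT N (fun s => fst p * mono N (snd p) s + leval N L s) =
    CT N (fun s => fst p * mono N (snd p) s) + CT N (leval N L)).
  apply CT_plus.
  - apply laurent_limit_mult; [apply laurent_limit_const|apply laurent_limit_mono].
  - apply laurent_limit_laurent. exists L; reflexivity.
Qed.

Lemma Cmod_small_eq (z w : C) :
  (forall eps, (0 < eps)%R -> (Cmod (z - w) <= eps)%R) -> z = w.
Proof.
  intros H. assert (E : Cmod (z - w) = 0%R).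
  { apply Rle_antisym; [|apply Cmod_ge_0]. apply le_epsilon. intros eps He.
    rewrite Rplus_0_l. now apply H. }
  apply Cmod_eq_0 in E. replace z with ((z - w) + w) by ring. rewrite E. ring.
Qed.

(* A substitution sending each monomial to a multiple of a monomial with the same
   constant term preserves constant terms: for dilations this is the
   contour-shift invariance, without Cauchy's theorem. *)
Lemma CT_subst (N : nat) (phi : (nat -> C) -> nat -> C)
  (c : (nat -> Z) -> C) (sg : (nat -> Z) -> nat -> Z) :
  (forall r, (0 < r)%R -> exists r', (0 < r')%R /\
     forall s, annulus r s -> annulus r' (phi s)) ->
  (forall s, nonvanishing s -> nonvanishing (phi s)) ->
  (forall e s, nonvanishing s -> mono N e (phi s) = c e * mono N (sg e) s) ->
  (forall e, c e * CT N (mono N (sg e)) = CT N (mono N e)) ->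
  forall f, laurent_limit N f ->
    laurent_limit N (fun s => f (phi s)) /\ CT N (fun s => f (phi s)) = CT N f.
Proof.
  intros Hann Hnv Hmono HCT f Hf.
  assert (HL : forall L, exists L', (forall s, nonvanishing s ->
      leval N L (phi s) = leval N L' s) /\ CT N (leval N L') = CT N (leval N L)).
  { intros L. exists (map (fun p => (fst p * c (snd p), sg (snd p))) L). split.
    - intros s Hs. induction L as [|p L IH]; simpl; [reflexivity|].
      rewrite IH, Hmono by exact Hs. ring.
    - rewrite !CT_leval. induction L as [|p L IH]; simpl; [reflexivity|].
      rewrite IH, <- (HCT (snd p)). ring. }
  assert (Hlim : laurent_limit N (fun s => f (phi s))).
  { intros r eps Hr He. destruct (Hann r Hr) as (r' & Hr' & Hphi).
    destruct (Hf r' eps Hr' He) as (g & [L Hg] & Hfg).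
    destruct (HL L) as (L' & HL' & _).
    exists (leval N L'). split; [exists L'; reflexivity|]. intros s Hs.
    assert (Hs' := annulus_nonvanishing r s Hr Hs).
    rewrite <- HL', <- Hg by auto. auto. }
  split; [exact Hlim|]. apply Cmod_small_eq. intros eps He.
  destruct (Hann 1%R Rlt_0_1) as (r & Hr & Hphi).
  (* The approximant has to be good on the torus and on its image under [phi], so the annulus must
     contain both. *)
  assert (Hr1 : (0 < Rmin r 1 <= 1)%R)
    by (split; [apply Rmin_glb_lt; lra|apply Rmin_r]).
  destruct (Hf (Rmin r 1) (eps / 2)%R) as (g & [L Hg] & Hfg); [lra|lra|].
  destruct (HL L) as (L' & HL' & HE).
  assert (G : laurent_limit N g) by (apply laurent_limit_laurent; exists L; exact Hg).
  assert (G' : laurent_limit N (leval N L')) by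
    (apply laurent_limit_laurent; exists L'; reflexivity).
  replace (CT N (fun s => f (phi s)) - CT N f) with
    ((CT N (fun s => f (phi s)) - CT N (leval N L')) + (CT N g - CT N f))
    by (rewrite HE, (CT_ext N g (leval N L) Hg); ring).
  eapply Rle_trans; [apply Cmod_triangle|].
  assert (A1 : (Cmod (CT N (fun s => f (phi s)) - CT N (leval N L')) <= eps / 2)%R).
  { apply CT_dist; [exact Hlim|exact G'|]. intros s Hs.
    assert (Hs' := unit_nonvanishing s Hs).
    rewrite <- HL', <- Hg by auto. apply Hfg.
    assert (P := Hphi s (unit_annulus 1 s ltac:(lra) Hs)). intros i.
    generalize (P i) (Rmin_l r 1); intros [P1 P2] P3. split; [lra|].
    eapply Rle_trans; [exact P2|]. apply Rinv_le_contravar; lra. }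
  assert (A2 : (Cmod (CT N g - CT N f) <= eps / 2)%R).
  { apply CT_dist; [exact G|exact Hf|]. intros s Hs.
    rewrite <- Cmod_opp, Copp_minus_distr. apply Hfg. now apply unit_annulus. }
  lra.
Qed.

Lemma mono_scale (N : nat) (e : nat -> Z) (c s : nat -> C) :
  nonvanishing c -> nonvanishing s -> mono N e (fun i => c i * s i) = mono N e c * mono N e s.
Proof.
  intros Hc Hs. unfold mono. rewrite <- cprod_mul. apply cprod_ext. intros i _.
  now apply Cpowz_mul_l.
Qed.

(** The dilation multiplies s^e by c^e, and the only monomial with a nonzero constant term has e =
    0, where c^e = 1. *)
Lemma CT_scale (N : nat) (c : nat -> C) (r0 : R) (f : (nat -> C) -> C) :
  (0 < r0)%R -> annulus r0 c -> laurent_limit N f ->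
  laurent_limit N (fun s => f (fun i => c i * s i)) /\
  CT N (fun s => f (fun i => c i * s i)) = CT N f.
Proof.
  intros Hr0 Hc. assert (Hc' := annulus_nonvanishing r0 c Hr0 Hc).
  apply (CT_subst N (fun s i => c i * s i) (fun e => mono N e c) (fun e => e)).
  - intros r Hr. exists (r0 * r)%R. split; [now apply Rmult_lt_0_compat|].
    intros s Hs i. rewrite Cmod_mult. generalize (Hc i) (Hs i); intros A B.
    split; [apply Rmult_le_compat; lra|].
    rewrite Rinv_mult. apply Rmult_le_compat; try apply Cmod_ge_0; lra.
  - intros s Hs i. apply Cmult_neq_0; auto.
  - intros e s Hs. now apply mono_scale.
  - intros e. rewrite (proj2 (torus_int_mono N e)).
    destruct (zero_exp N e) eqn:E; [|ring].
    unfold mono. rewrite cprod_one; [ring|]. intros i Hi. apply in_seq in Hi.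
    rewrite (proj1 (zero_exp_true N e) E) by lia. apply Cpowz_0.
Qed.

Definition swap (j i : nat) : nat :=
  if (i =? j)%nat then S j else if (i =? S j)%nat then j else i.

Lemma swap_l (j : nat) : swap j j = S j.
Proof. unfold swap. now rewrite Nat.eqb_refl. Qed.

Lemma swap_r (j : nat) : swap j (S j) = j.
Proof. unfold swap. rewrite Nat.eqb_refl, (proj2 (Nat.eqb_neq (S j) j)) by lia. reflexivity. Qed.

Lemma swap_other (j i : nat) : i <> j -> i <> S j -> swap j i = i.
Proof.
  intros H1 H2. unfold swap. now rewrite (proj2 (Nat.eqb_neq i j)), (proj2 (Nat.eqb_neq i (S j))).
Qed.

Lemma swap_swap (j i : nat) : swap j (swap j i) = i.
Proof.
  destruct (Nat.eq_dec i j) as [->|H1]; [now rewrite swap_l, swap_r|].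
  destruct (Nat.eq_dec i (S j)) as [->|H2]; [now rewrite swap_r, swap_l|].
  now rewrite !(swap_other j i).
Qed.

Lemma swap_range (j N i : nat) :
  (1 <= j)%nat -> (j < N)%nat -> (1 <= i <= N)%nat -> (1 <= swap j i <= N)%nat.
Proof.
  intros. destruct (Nat.eq_dec i j) as [->|H3]; [rewrite swap_l; lia|].
  destruct (Nat.eq_dec i (S j)) as [->|H4]; [rewrite swap_r; lia|].
  rewrite swap_other by assumption. lia.
Qed.

Lemma cprod_swap (j N : nat) (f : nat -> C) : (1 <= j < N)%nat ->
  cprod (seq 1 N) (fun i => f (swap j i)) = cprod (seq 1 N) f.
Proof.
  induction N as [|N IH]; intros H; [lia|].
  rewrite !cprod_S. replace (1 + N)%nat with (S N) by lia.
  destruct (Nat.eq_dec j N) as [->|Hj].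
  - destruct N as [|N]; [lia|]. rewrite !cprod_S. replace (1 + N)%nat with (S N) by lia.
    rewrite swap_l, swap_r.
    rewrite (cprod_ext_seq N (fun i => f (swap (S N) i)) f); [ring|].
    intros i Hi. rewrite swap_other by lia. reflexivity.
  - rewrite IH, swap_other by lia. reflexivity.
Qed.

Lemma mono_swap (N j : nat) (e : nat -> Z) (s : nat -> C) : (1 <= j < N)%nat ->
  mono N e (fun i => s (swap j i)) = mono N (fun i => e (swap j i)) s.
Proof.
  intros Hj. unfold mono.
  rewrite <- (cprod_swap j N (fun i => Cpowz (s i) (e (swap j i)))) by exact Hj.
  apply cprod_ext. intros i _. now rewrite swap_swap.
Qed.

Lemma CT_swap (N j : nat) (f : (nat -> C) -> C) : (1 <= j < N)%nat -> laurent_limit N f ->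
  laurent_limit N (fun s => f (fun i => s (swap j i))) /\
  CT N (fun s => f (fun i => s (swap j i))) = CT N f.
Proof.
  intros Hj.
  apply (CT_subst N (fun s i => s (swap j i)) (fun _ => 1) (fun e i => e (swap j i))).
  - intros r Hr. exists r. split; [exact Hr|]. intros s Hs i. apply Hs.
  - intros s Hs i. apply Hs.
  - intros e s Hs. rewrite mono_swap by exact Hj. ring.
  - intros e. rewrite !(proj2 (torus_int_mono _ _)).
    replace (zero_exp N (fun i => e (swap j i))) with (zero_exp N e); [ring|].
    apply Bool.eq_iff_eq_true. rewrite !zero_exp_true. split; intros H i Hi.
    + apply H. apply swap_range; lia.
    + rewrite <- (swap_swap j i). apply H. apply swap_range; lia.
Qed.

(** * The q-Pochhammer symbol and the theta function *)

Lemma qpoch_S (a q : C) (n : nat) : qpoch a q (S n) = qpoch a q n * (1 - a * Cpown q n).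
Proof. unfold qpoch. now rewrite cprod_S. Qed.

Lemma qpoch_S_l (a q : C) (n : nat) : qpoch a q (S n) = (1 - a) * qpoch (a * q) q n.
Proof.
  unfold qpoch. change (seq 0 (S n)) with (0%nat :: seq 1 n).
  change ((1 - a * 1) * cprod (seq 1 n) (fun k => 1 - a * Cpown q k) =
    (1 - a) * cprod (seq 0 n) (fun k => 1 - a * q * Cpown q k)).
  rewrite cprod_shift, Cmult_1_r. f_equal. apply cprod_ext. intros k _. simpl. ring.
Qed.

Lemma one_minus_pow_neq0 (q : C) (n : nat) :
  (Cmod q < 1)%R -> (0 < n)%nat -> 1 - Cpown q n <> 0.
Proof.
  intros Hq Hn E. assert (E' : Cpown q n = 1).
  { replace (Cpown q n) with (1 - (1 - Cpown q n)) by ring. rewrite E. ring. }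
  assert (H := Cmod_Cpown q n). rewrite E', Cmod_1 in H.
  assert (H' := pow_lt_1_compat (Cmod q) n (conj (Cmod_ge_0 q) Hq) Hn). lra.
Qed.

Lemma qpoch_neq0 (q : C) (n : nat) : (Cmod q < 1)%R -> qpoch q q n <> 0.
Proof.
  intros Hq. apply cprod_neq0. intros k _. change (1 - Cpown q (S k) <> 0).
  apply one_minus_pow_neq0; [exact Hq|lia].
Qed.

(** With y = x/(1-|q|), exp y bounds all partial products and y |q|^n bounds the sum of the |a q^k|
    with k >= n and |a| = x; together they control the telescoped tail. *)
Definition qpoch_rate (q : C) (x : R) : R :=
  exp (x / (1 - Cmod q)) * (x / (1 - Cmod q)).

Lemma qpoch_rate_mono (q : C) (x y : R) : (Cmod q < 1)%R ->
  (0 <= x <= y)%R -> (qpoch_rate q x <= qpoch_rate q y)%R.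
Proof.
  intros Hq H. unfold qpoch_rate.
  assert (H1 : (0 <= x / (1 - Cmod q))%R) by (apply Rdiv_le_0_compat; lra).
  assert (H2 : (x / (1 - Cmod q) <= y / (1 - Cmod q))%R).
  { apply Rmult_le_compat_r; [left; apply Rinv_0_lt_compat|]; lra. }
  apply Rmult_le_compat; [left; apply exp_pos|exact H1| |exact H2].
  destruct H2 as [H2|H2]; [left; now apply exp_increasing|rewrite H2; lra].
Qed.

Lemma qpoch_bound (a q : C) (n : nat) : (Cmod q < 1)%R ->
  (Cmod (qpoch a q n) <= exp (Cmod a / (1 - Cmod q)))%R.
Proof.
  intros Hq. assert (Ha := Cmod_ge_0 a). assert (Hq0 := Cmod_ge_0 q).
  (* The partial geometric sum in the exponent lets the induction close, through 1 + y <= exp y. *)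
  assert (H : (Cmod (qpoch a q n) <= exp (Cmod a * ((1 - Cmod q ^ n) / (1 - Cmod q))))%R).
  { induction n as [|n IH].
    - simpl. unfold qpoch; simpl. rewrite Cmod_1, Rminus_diag, Rdiv_0_l, Rmult_0_r, exp_0. lra.
    - rewrite qpoch_S, Cmod_mult.
      replace (Cmod a * ((1 - Cmod q ^ S n) / (1 - Cmod q)))%R with
        (Cmod a * ((1 - Cmod q ^ n) / (1 - Cmod q)) + Cmod a * Cmod q ^ n)%R
        by (simpl; field; lra).
      rewrite exp_plus. apply Rmult_le_compat; try apply Cmod_ge_0; [exact IH|].
      eapply Rle_trans; [apply Cmod_triangle|].
      rewrite Cmod_1, Cmod_opp, Cmod_mult, Cmod_Cpown. apply exp_ineq1_le. }
  eapply Rle_trans; [exact H|].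
  assert (H' : (Cmod a * ((1 - Cmod q ^ n) / (1 - Cmod q)) <= Cmod a / (1 - Cmod q))%R).
  { unfold Rdiv. apply Rmult_le_compat_l; [exact Ha|].
    rewrite <- (Rmult_1_l (/ (1 - Cmod q))) at 2.
    apply Rmult_le_compat_r; [left; apply Rinv_0_lt_compat; lra|].
    assert (P := pow_le (Cmod q) n Hq0). lra. }
  destruct H' as [H'|H']; [left; now apply exp_increasing|rewrite H'; lra].
Qed.

Lemma qpoch_cauchy (a q : C) (n k : nat) : (Cmod q < 1)%R ->
  (Cmod (qpoch a q (n + k) - qpoch a q n) <= qpoch_rate q (Cmod a) * Cmod q ^ n)%R.
Proof.
  intros Hq. assert (Ha := Cmod_ge_0 a). assert (Hq0 := Cmod_ge_0 q).
  assert (H : (Cmod (qpoch a q (n + k) - qpoch a q n) <=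
    qpoch_rate q (Cmod a) * Cmod q ^ n * (1 - Cmod q ^ k))%R).
  { induction k as [|k IH].
    - rewrite Nat.add_0_r. replace (qpoch a q n - qpoch a q n) with (RtoC 0) by ring.
      rewrite Cmod_0. simpl. lra.
    - rewrite Nat.add_succ_r, qpoch_S.
      replace (qpoch a q (n + k) * (1 - a * Cpown q (n + k)) - qpoch a q n) with
        ((qpoch a q (n + k) - qpoch a q n) + - (qpoch a q (n + k) * (a * Cpown q (n + k)))) by ring.
      eapply Rle_trans; [apply Cmod_triangle|].
      rewrite Cmod_opp, !Cmod_mult, Cmod_Cpown, pow_add.
      assert (B := qpoch_bound a q (n + k) Hq).
      assert (P1 := pow_le (Cmod q) n Hq0). assert (P2 := pow_le (Cmod q) k Hq0).
      apply (Rmult_le_compat_r (Cmod a * (Cmod q ^ n * Cmod q ^ k))) in B;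
        [|repeat apply Rmult_le_pos; assumption].
      replace (qpoch_rate q (Cmod a) * Cmod q ^ n * (1 - Cmod q ^ S k))%R with
        (qpoch_rate q (Cmod a) * Cmod q ^ n * (1 - Cmod q ^ k) +
         exp (Cmod a / (1 - Cmod q)) * (Cmod a * (Cmod q ^ n * Cmod q ^ k)))%R; [lra|].
      unfold qpoch_rate. simpl. field. lra. }
  eapply Rle_trans; [exact H|].
  assert (P2 := pow_le (Cmod q) k Hq0).
  assert (P3 : (0 <= qpoch_rate q (Cmod a) * Cmod q ^ n)%R).
  { apply Rmult_le_pos; [|now apply pow_le]. unfold qpoch_rate.
    apply Rmult_le_pos; [left; apply exp_pos|]. apply Rdiv_le_0_compat; lra. }
  rewrite <- (Rmult_1_r (qpoch_rate q (Cmod a) * Cmod q ^ n)) at 2.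
  apply Rmult_le_compat_l; lra.
Qed.

Lemma pow_small (r : R) (eps K : R) : (0 <= r < 1)%R -> (0 < eps)%R ->
  exists n0, forall n, (n0 <= n)%nat -> (K * r ^ n <= eps)%R.
Proof.
  intros Hr He. destruct (pow_lt_1_zero r) with (y := (eps / (Rabs K + 1))%R) as (n0 & Hn0).
  - rewrite Rabs_pos_eq; lra.
  - apply Rdiv_lt_0_compat; [lra|]. generalize (Rabs_pos K); lra.
  - exists n0. intros n Hn. specialize (Hn0 n Hn).
    rewrite Rabs_pos_eq in Hn0 by (apply pow_le; lra).
    assert (HK := Rabs_pos K). assert (P := pow_le r n (proj1 Hr)).
    apply Rle_trans with ((Rabs K + 1) * r ^ n)%R.
    + apply Rmult_le_compat_r; [exact P|]. generalize (Rle_abs K); lra.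
    + apply Rlt_le in Hn0. apply (Rmult_le_compat_l (Rabs K + 1)) in Hn0; [|lra].
      eapply Rle_trans; [exact Hn0|]. right; field; lra.
Qed.

Lemma qpoch_inf_close (a q : C) (n : nat) : (Cmod q < 1)%R ->
  (Cmod (qpoch a q n - qpoch_inf a q) <= qpoch_rate q (Cmod a) * Cmod q ^ n)%R.
Proof.
  intros Hq. assert (Hq0 := Cmod_ge_0 q).
  set (F := filtermap (fun n => qpoch a q n) eventually).
  assert (PF : ProperFilter F) by (apply filtermap_proper_filter, eventually_filter).
  assert (HC : @cauchy (CompleteNormedModule.UniformSpace _ C_CompleteNormedModule) F).
  { intros eps. destruct (pow_small (Cmod q) (eps / 2) (qpoch_rate q (Cmod a)))
      as (n0 & Hn0); [lra|generalize (cond_pos eps); lra|].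
    exists (qpoch a q n0), n0. intros m Hm.
    apply C_NormedModule_mixin_compat1.
    change (Cmod (qpoch a q m - qpoch a q n0) < eps)%R.
    replace m with (n0 + (m - n0))%nat by lia.
    eapply Rle_lt_trans; [apply qpoch_cauchy, Hq|].
    eapply Rle_lt_trans; [apply Hn0; lia|]. generalize (cond_pos eps); lra. }
  apply le_epsilon. intros eps He.
  (* Balls of C are squares: membership in one of radius eps bounds the modulus only by sqrt 2
     eps. *)
  assert (Hs : (0 < sqrt 2)%R) by (apply sqrt_lt_R0; lra).
  assert (He' : (0 < eps / sqrt 2)%R) by (apply Rdiv_lt_0_compat; lra).
  destruct (@complete_cauchy (CompleteNormedModule.CompleteSpace _ C_CompleteNormedModule)
    F PF HC (mkposreal _ He')) as (n1 & Hn1).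
  specialize (Hn1 (n + n1)%nat ltac:(lia)).
  apply C_NormedModule_mixin_compat2 in Hn1.
  change (Cmod (qpoch a q (n + n1) - qpoch_inf a q) < sqrt 2 * (eps / sqrt 2))%R in Hn1.
  replace (sqrt 2 * (eps / sqrt 2))%R with eps in Hn1 by (field; lra).
  replace (qpoch a q n - qpoch_inf a q) with
    (- (qpoch a q (n + n1) - qpoch a q n) + (qpoch a q (n + n1) - qpoch_inf a q)) by ring.
  eapply Rle_trans; [apply Cmod_triangle|]. rewrite Cmod_opp.
  assert (B := qpoch_cauchy a q n n1 Hq). lra.
Qed.

Lemma qpoch_inf_S (a q : C) : (Cmod q < 1)%R ->
  qpoch_inf a q = (1 - a) * qpoch_inf (a * q) q.
Proof.
  intros Hq. set (K := (Cmod (1 - a) * qpoch_rate q (Cmod (a * q)))%R).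
  apply Cmod_small_eq. intros eps He.
  destruct (pow_small (Cmod q) eps (qpoch_rate q (Cmod a) + K)) as (n & Hn);
    [generalize (Cmod_ge_0 q); lra|exact He|].
  specialize (Hn n (Nat.le_refl n)).
  replace (qpoch_inf a q - (1 - a) * qpoch_inf (a * q) q) with
    (- (qpoch a q (S n) - qpoch_inf a q) +
     (1 - a) * (qpoch (a * q) q n - qpoch_inf (a * q) q)) by (rewrite qpoch_S_l; ring).
  eapply Rle_trans; [apply Cmod_triangle|]. rewrite Cmod_opp, Cmod_mult.
  assert (A := qpoch_inf_close a q (S n) Hq).
  assert (B := qpoch_inf_close (a * q) q n Hq).
  apply (Rmult_le_compat_l (Cmod (1 - a))) in B; [|apply Cmod_ge_0].
  assert (A' : (qpoch_rate q (Cmod a) * Cmod q ^ S n <= qpoch_rate q (Cmod a) * Cmod q ^ n)%R).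
  { assert (P := pow_le (Cmod q) n (Cmod_ge_0 q)). apply Rmult_le_compat_l.
    - unfold qpoch_rate. apply Rmult_le_pos; [left; apply exp_pos|].
      apply Rdiv_le_0_compat; [apply Cmod_ge_0|lra].
    - simpl. rewrite <- (Rmult_1_l (Cmod q ^ n)) at 2. apply Rmult_le_compat_r; lra. }
  unfold K in Hn. lra.
Qed.

Lemma qpoch_inf_split (a q : C) (n : nat) : (Cmod q < 1)%R ->
  qpoch_inf a q = qpoch a q n * qpoch_inf (a * Cpown q n) q.
Proof.
  intros Hq. induction n as [|n IH].
  - simpl. unfold qpoch; simpl. rewrite Cmult_1_r, Cmult_1_l. reflexivity.
  - rewrite IH, (qpoch_inf_S (a * Cpown q n)), qpoch_S by exact Hq.
    replace (a * Cpown q (S n)) with (a * Cpown q n * q) by (simpl; ring). ring.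
Qed.

Lemma laurent_limit_qpoch (N : nat) (q : C) (f : (nat -> C) -> C) (n : nat) :
  laurent_limit N f -> laurent_limit N (fun s => qpoch (f s) q n).
Proof.
  intros Hf. apply (laurent_limit_cprod N (seq 0 n) (fun k s => 1 - f s * Cpown q k)).
  intros k _. apply (laurent_limit_ext N (fun s => 1 + - Cpown q k * f s)).
  - intros s _; ring.
  - apply laurent_limit_plus; [apply laurent_limit_const|].
    apply laurent_limit_mult; [apply laurent_limit_const|exact Hf].
Qed.

Lemma laurent_limit_qpoch_inf (N : nat) (q : C) (f : (nat -> C) -> C) : (Cmod q < 1)%R ->
  laurent_limit N f -> laurent_limit N (fun s => qpoch_inf (f s) q).
Proof.
  intros Hq Hf. apply laurent_limit_limit. intros r eps Hr He.
  destruct (laurent_limit_bounded N f r Hr Hf) as (B & HB0 & HB).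
  destruct (pow_small (Cmod q) eps (qpoch_rate q B)) as (n & Hn);
    [generalize (Cmod_ge_0 q); lra|exact He|].
  specialize (Hn n (Nat.le_refl n)).
  exists (fun s => qpoch (f s) q n). split; [now apply laurent_limit_qpoch|].
  intros s Hs. rewrite <- Cmod_opp, Copp_minus_distr.
  eapply Rle_trans; [apply qpoch_inf_close, Hq|].
  eapply Rle_trans; [|exact Hn]. apply Rmult_le_compat_r; [apply pow_le, Cmod_ge_0|].
  apply qpoch_rate_mono; [exact Hq|]. split; [apply Cmod_ge_0|now apply HB].
Qed.

(** Jacobi's theta function without its factor (q;q)_inf. *)
Definition theta (q z : C) : C := qpoch_inf z q * qpoch_inf (q / z) q.

Lemma theta_inv (q z : C) : (Cmod q < 1)%R -> z <> 0 -> theta q (/ z) = - / z * theta q z.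
Proof.
  intros Hq Hz. unfold theta. rewrite (qpoch_inf_S z), (qpoch_inf_S (/ z)) by exact Hq.
  replace (q / / z) with (z * q) by (field; exact Hz).
  replace (/ z * q) with (q / z) by (field; exact Hz). field. exact Hz.
Qed.

Lemma theta_shift (q z : C) : (Cmod q < 1)%R -> q <> 0 -> z <> 0 ->
  theta q (q * z) = - / z * theta q z.
Proof.
  intros Hq Hq0 Hz. unfold theta. rewrite (qpoch_inf_S z), (qpoch_inf_S (q / (q * z))) by exact Hq.
  replace (q / (q * z) * q) with (q / z) by (field; auto).
  rewrite (Cmult_comm z q). field. auto.
Qed.

(** * The theta product and its symmetries *)

Definition theta_prod (q : C) (N : nat) (s : nat -> C) : C :=
  cprod (seq 1 N) (fun j => cprod (seq 1 (j - 1)) (fun i => theta q (s i / s j))).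

Lemma theta_prod_S (q : C) (N : nat) (s : nat -> C) :
  theta_prod q (S N) s =
  theta_prod q N s * cprod (seq 1 N) (fun i => theta q (s i / s (S N))).
Proof.
  unfold theta_prod. rewrite cprod_S. replace (1 + N)%nat with (S N) by lia.
  now replace (S N - 1)%nat with N by lia.
Qed.

Lemma theta_prod_ext (q : C) (N : nat) (s s' : nat -> C) :
  (forall i, (1 <= i <= N)%nat -> s i = s' i) -> theta_prod q N s = theta_prod q N s'.
Proof.
  intros H. apply cprod_ext_seq. intros j Hj. apply cprod_ext_seq. intros i Hi.
  rewrite !H by lia. reflexivity.
Qed.

Lemma laurent_limit_div (N i j : nat) : (1 <= i <= N)%nat -> (1 <= j <= N)%nat ->
  laurent_limit N (fun s => s i / s j).
Proof.
  intros Hi Hj. apply laurent_limit_mult; [now apply laurent_limit_var|now apply laurent_limit_inv].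
Qed.

Lemma laurent_limit_theta (N i j : nat) (q : C) : (Cmod q < 1)%R ->
  (1 <= i <= N)%nat -> (1 <= j <= N)%nat -> laurent_limit N (fun s => theta q (s i / s j)).
Proof.
  intros Hq Hi Hj. apply laurent_limit_mult.
  - apply laurent_limit_qpoch_inf; [exact Hq|now apply laurent_limit_div].
  - apply laurent_limit_qpoch_inf; [exact Hq|].
    apply (laurent_limit_ext N (fun s => q * (s j / s i))).
    + intros s Hs. field. split; apply Hs.
    + apply laurent_limit_mult; [apply laurent_limit_const|now apply laurent_limit_div].
Qed.

Lemma laurent_limit_theta_prod (q : C) (N : nat) :
  (Cmod q < 1)%R -> laurent_limit N (theta_prod q N).
Proof.
  intros Hq.
  apply (laurent_limit_cprod N (seq 1 N)
    (fun j s => cprod (seq 1 (j - 1)) (fun i => theta q (s i / s j)))).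
  intros j Hj. apply in_seq in Hj.
  apply (laurent_limit_cprod N (seq 1 (j - 1)) (fun i s => theta q (s i / s j))).
  intros i Hi. apply in_seq in Hi. apply laurent_limit_theta; [exact Hq|lia|lia].
Qed.

Lemma theta_prod_homogeneous (q : C) (N : nat) (c : C) (s : nat -> C) :
  c <> 0 -> nonvanishing s -> theta_prod q N (fun i => c * s i) = theta_prod q N s.
Proof.
  intros Hc Hs. apply cprod_ext. intros j _. apply cprod_ext. intros i _.
  f_equal. field. split; [apply Hs|exact Hc].
Qed.

Lemma cprod_S_l (n : nat) (f : nat -> C) :
  cprod (seq 1 (S n)) f = f 1%nat * cprod (seq 1 n) (fun i => f (S i)).
Proof. simpl. now rewrite cprod_shift. Qed.

Lemma theta_prod_S_l (q : C) (N : nat) (s : nat -> C) :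
  theta_prod q (S N) s =
  cprod (seq 1 N) (fun j => theta q (s 1%nat / s (S j))) * theta_prod q N (fun i => s (S i)).
Proof.
  induction N as [|N IH]; [unfold theta_prod; simpl; ring|].
  rewrite theta_prod_S, IH, (theta_prod_S q N), cprod_S_l, (cprod_S 1 N).
  replace (1 + N)%nat with (S N) by lia. ring.
Qed.

Lemma cprod_delta (N j : nat) (c : C) : (1 <= j <= N)%nat ->
  cprod (seq 1 N) (fun i => if (i =? j)%nat then c else 1) = c.
Proof.
  induction N as [|N IH]; intros H; [lia|].
  rewrite cprod_S. replace (1 + N)%nat with (S N) by lia.
  destruct (Nat.eq_dec j (S N)) as [->|Hj].
  - rewrite Nat.eqb_refl, cprod_one; [ring|]. intros i Hi. apply in_seq in Hi.
    now rewrite (proj2 (Nat.eqb_neq i (S N))) by lia.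
  - rewrite IH, (proj2 (Nat.eqb_neq (S N) j)) by lia. ring.
Qed.

Definition dilate (q : C) (j : nat) (i : nat) : C := if (i =? j)%nat then q else 1.

(** Each of the N - 1 pairs containing j contributes one quasi-periodicity factor: -s_i/(q s_j) for
    i < j and -s_i/s_j for i > j. The negative powers are moved to the left-hand side. *)
Lemma theta_prod_dilate (q : C) (N j : nat) (s : nat -> C) :
  (Cmod q < 1)%R -> q <> 0 -> nonvanishing s -> (1 <= j <= N)%nat ->
  theta_prod q N (fun i => dilate q j i * s i) * Cpown q (j - 1) * Cpown (s j) N =
  Cpown (-1) (N - 1) * cprod (seq 1 N) s * theta_prod q N s.
Proof.
  intros Hq Hq0 Hs. revert j. induction N as [|N IH]; intros j Hj; [lia|].
  rewrite !theta_prod_S, (cprod_S 1 N). replace (1 + N)%nat with (S N) by lia.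
  replace (S N - 1)%nat with N by lia.
  destruct (Nat.eq_dec j (S N)) as [->|HjN].
  - rewrite (theta_prod_ext q N (fun i => dilate q (S N) i * s i) s).
    2: { intros i Hi. unfold dilate. rewrite (proj2 (Nat.eqb_neq i (S N))) by lia. ring. }
    replace (S N - 1)%nat with N by lia.
    set (T := cprod _ (fun i => theta q (dilate _ _ _ * _ / _))).
    assert (ET : T * Cpown q N * Cpown (s (S N)) N =
      Cpown (-1) N * cprod (seq 1 N) s * cprod (seq 1 N) (fun i => theta q (s i / s (S N)))).
    { unfold T. rewrite <- !(cprod_const 1), <- !cprod_mul. apply cprod_ext_seq. intros i Hi.
      unfold dilate. rewrite (proj2 (Nat.eqb_neq i (S N))), Nat.eqb_refl by lia.
      set (z := s i / (q * s (S N))).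
      assert (Hz : z <> 0).
      { unfold z. apply Cmult_neq_0; [apply Hs|]. apply Cinv_nz, Cmult_neq_0; [exact Hq0|apply Hs]. }
      replace (1 * s i / (q * s (S N))) with z by (unfold z; now rewrite Cmult_1_l).
      replace (s i / s (S N)) with (q * z) by (unfold z; field; split; [apply Hs|exact Hq0]).
      rewrite theta_shift by assumption. unfold z.
      field. repeat split; try apply Hs; exact Hq0. }
    change (Cpown (s (S N)) (S N)) with (s (S N) * Cpown (s (S N)) N).
    transitivity (theta_prod q N s * (T * Cpown q N * Cpown (s (S N)) N) * s (S N)); [ring|].
    rewrite ET. ring.
  - assert (HjN' : (1 <= j <= N)%nat) by lia. specialize (IH j HjN').
    assert (EC : cprod (seq 1 N) (fun i => theta q (dilate q j i * s i / (dilate q j (S N) * s (S N))))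
      = (- s (S N) / s j) * cprod (seq 1 N) (fun i => theta q (s i / s (S N)))).
    { rewrite <- (cprod_delta N j (- s (S N) / s j) HjN'), <- cprod_mul.
      apply cprod_ext_seq. intros i Hi. unfold dilate.
      rewrite (proj2 (Nat.eqb_neq (S N) j)) by lia.
      destruct (i =? j)%nat eqn:E.
      - apply Nat.eqb_eq in E; subst i.
        replace (q * s j / (1 * s (S N))) with (q * (s j / s (S N))) by (field; apply Hs).
        rewrite theta_shift by
          (first [assumption | apply Cmult_neq_0; [apply Hs|apply Cinv_nz, Hs]]).
        field; split; apply Hs.
      - rewrite !Cmult_1_l. reflexivity. }
    rewrite EC. change (Cpown (s j) (S N)) with (s j * Cpown (s j) N).
    replace (Cpown (-1) N) with (-1 * Cpown (-1) (N - 1)).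
    2: { replace N with (S (N - 1)) at 2 by lia. reflexivity. }
    transitivity ((theta_prod q N (fun i => dilate q j i * s i) * Cpown q (j - 1) * Cpown (s j) N)
      * (- s (S N)) * cprod (seq 1 N) (fun i => theta q (s i / s (S N)))).
    + field. apply Hs.
    + rewrite IH. ring.
Qed.

Definition theta_alt (q : C) (N : nat) (s : nat -> C) : C :=
  theta_prod q N s * mono N (fun j => Z.of_nat j) s.

Lemma mono_S (N : nat) (e : nat -> Z) (s : nat -> C) :
  mono (S N) e s = mono N e s * Cpowz (s (S N)) (e (S N)).
Proof. unfold mono. rewrite cprod_S. reflexivity. Qed.

Lemma theta_alt_S (q : C) (N : nat) (s : nat -> C) :
  theta_alt q (S N) s =
  theta_alt q N s * (cprod (seq 1 N) (fun i => theta q (s i / s (S N))) *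
    Cpowz (s (S N)) (Z.of_nat (S N))).
Proof. unfold theta_alt. rewrite theta_prod_S, mono_S. ring. Qed.

Lemma theta_alt_ext (q : C) (N : nat) (s s' : nat -> C) :
  (forall i, (1 <= i <= N)%nat -> s i = s' i) -> theta_alt q N s = theta_alt q N s'.
Proof.
  intros H. unfold theta_alt. rewrite (theta_prod_ext q N s s' H). f_equal.
  apply cprod_ext_seq. intros i Hi. now rewrite H.
Qed.

(** The swap turns theta(s_j/s_(j+1)) into itself times -s_(j+1)/s_j, the monomial gains
    s_j/s_(j+1), and the pairs involving a third index are permuted. *)
Lemma theta_alt_swap (q : C) (N j : nat) (s : nat -> C) :
  (Cmod q < 1)%R -> nonvanishing s -> (1 <= j < N)%nat ->
  theta_alt q N (fun i => s (swap j i)) = - theta_alt q N s.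
Proof.
  intros Hq Hs. induction N as [|N IH]; intros Hj; [lia|].
  destruct (Nat.eq_dec j N) as [->|HjN].
  - destruct N as [|N]; [lia|].
    rewrite !theta_alt_S, !(cprod_S 1 N). replace (1 + N)%nat with (S N) by lia.
    rewrite swap_l, swap_r.
    rewrite (theta_alt_ext q N (fun i => s (swap (S N) i)) s).
    2: { intros i Hi. now rewrite swap_other by lia. }
    rewrite (cprod_ext_seq N (fun i => theta q (s (swap (S N) i) / s (S (S N))))
      (fun i => theta q (s i / s (S (S N)))))
      by (intros i Hi; now rewrite swap_other by lia).
    rewrite (cprod_ext_seq N (fun i => theta q (s (swap (S N) i) / s (S N)))
      (fun i => theta q (s i / s (S N))))
      by (intros i Hi; now rewrite swap_other by lia).
    replace (s (S (S N)) / s (S N)) with (/ (s (S N) / s (S (S N))))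
      by (field; split; apply Hs).
    rewrite theta_inv by
      (first [assumption | apply Cmult_neq_0; [apply Hs|apply Cinv_nz, Hs]]).
    rewrite (Nat2Z.inj_succ (S N)), <- Z.add_1_r, !Cpowz_succ by apply Hs.
    field. split; apply Hs.
  - rewrite !theta_alt_S, IH by lia. rewrite (swap_other j (S N)) by lia.
    rewrite (cprod_swap j N (fun i => theta q (s i / s (S N)))) by lia. ring.
Qed.

Lemma laurent_limit_theta_alt (q : C) (N : nat) :
  (Cmod q < 1)%R -> laurent_limit N (theta_alt q N).
Proof.
  intros Hq. apply laurent_limit_mult;
    [now apply laurent_limit_theta_prod|apply laurent_limit_mono].
Qed.

(** The monomial gains q^j and the theta product loses q^(j-1), so a single q remains, whatever j
    is. *)
Lemma theta_alt_dilate (q : C) (N j : nat) (s : nat -> C) :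
  (Cmod q < 1)%R -> q <> 0 -> nonvanishing s -> (1 <= j <= N)%nat ->
  theta_alt q N (fun i => dilate q j i * s i) =
  Cpown (-1) (N - 1) * q * mono N (fun _ => 1%Z) s * Cpowz (s j) (- Z.of_nat N) *
  theta_alt q N s.
Proof.
  intros Hq Hq0 Hs Hj. unfold theta_alt.
  assert (Hd : nonvanishing (dilate q j))
    by (intros i; unfold dilate; destruct (i =? j)%nat; [exact Hq0|apply C1_nz]).
  rewrite mono_scale by assumption.
  replace (mono N (fun j0 => Z.of_nat j0) (dilate q j)) with (q * Cpown q (j - 1)).
  2: { transitivity (Cpown q j).
       - replace j with (S (j - 1)) at 2 by lia. reflexivity.
       - symmetry. unfold mono. rewrite <- (cprod_delta N j (Cpown q j) Hj).
         apply cprod_ext_seq. intros i Hi. unfold dilate. destruct (i =? j)%nat eqn:E.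
         + apply Nat.eqb_eq in E; subst. apply Cpowz_nat.
         + apply Cpowz_1_l. }
  assert (E := theta_prod_dilate q N j s Hq Hq0 Hs Hj).
  rewrite mono_const, Cpowz_1 by exact Hs. rewrite Cpowz_neg.
  assert (Hn : Cpown (s j) N <> 0) by (apply Cpown_neq0, Hs).
  transitivity ((theta_prod q N (fun i => dilate q j i * s i) * Cpown q (j - 1) *
    Cpown (s j) N) * q * mono N (fun j0 => Z.of_nat j0) s / Cpown (s j) N).
  - field. exact Hn.
  - rewrite E. field. exact Hn.
Qed.

Definition vandermonde (N : nat) (s : nat -> C) : C :=
  cprod (seq 1 N) (fun j => cprod (seq 1 (j - 1)) (fun i => s i - s j)).

Lemma vandermonde_S (N : nat) (s : nat -> C) :
  vandermonde (S N) s = vandermonde N s * cprod (seq 1 N) (fun i => s i - s (S N)).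
Proof.
  unfold vandermonde. rewrite cprod_S. replace (1 + N)%nat with (S N) by lia.
  now replace (S N - 1)%nat with N by lia.
Qed.

Lemma cprod_filter (p : nat -> bool) (l : list nat) (f : nat -> C) :
  cprod (filter p l) f = cprod l (fun i => if p i then f i else 1).
Proof.
  induction l as [|a l IH]; simpl; [reflexivity|]. destruct (p a); simpl; rewrite IH; ring.
Qed.

Definition root_prod (q : C) (N : nat) (s : nat -> C) : C :=
  cprod (seq 1 N) (fun i =>
    cprod (filter (fun j => negb (Nat.eqb i j)) (seq 1 N)) (fun j =>
      qpoch_inf (s i * / s j) q)).

Lemma root_prod_S (q : C) (N : nat) (s : nat -> C) :
  root_prod q (S N) s = root_prod q N s *
    cprod (seq 1 N) (fun i => qpoch_inf (s i / s (S N)) q * qpoch_inf (s (S N) / s i) q).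
Proof.
  unfold root_prod. rewrite cprod_S. replace (1 + N)%nat with (S N) by lia.
  rewrite (cprod_mul _ _ (fun i => qpoch_inf (s (S N) / s i) q)), Cmult_assoc. f_equal.
  - rewrite <- cprod_mul. apply cprod_ext_seq. intros i Hi.
    rewrite !cprod_filter, cprod_S. replace (1 + N)%nat with (S N) by lia.
    rewrite (proj2 (Nat.eqb_neq i (S N))) by lia. reflexivity.
  - rewrite cprod_filter, cprod_S. replace (1 + N)%nat with (S N) by lia.
    rewrite Nat.eqb_refl. change (negb true) with false. cbv iota. rewrite Cmult_1_r.
    apply cprod_ext_seq. intros i Hi.
    rewrite (proj2 (Nat.eqb_neq (S N) i)) by lia. reflexivity.
Qed.

(** For i < j and z = s_i/s_j one has (z;q)_inf (1/z;q)_inf = theta(z) (1 - s_j/s_i). Clearing the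
    denominators costs s_i^(N-i), and the factor s_i^i of [theta_alt] completes it to s_i^N. *)
Lemma root_prod_vandermonde (q : C) (N : nat) (s : nat -> C) :
  (Cmod q < 1)%R -> nonvanishing s ->
  root_prod q N s * mono N (fun _ => Z.of_nat N) s = theta_alt q N s * vandermonde N s.
Proof.
  intros Hq Hs.
  assert (H : root_prod q N s * mono N (fun i => Z.of_nat N - Z.of_nat i)%Z s =
    theta_prod q N s * vandermonde N s).
  { induction N as [|N IH].
    - unfold root_prod, mono, theta_prod, vandermonde; simpl; ring.
    - rewrite root_prod_S, theta_prod_S, vandermonde_S, mono_S, Z.sub_diag, Cpowz_0.
      replace (mono N (fun i => Z.of_nat (S N) - Z.of_nat i)%Z s) with
        (mono N (fun i => Z.of_nat N - Z.of_nat i)%Z s * cprod (seq 1 N) s).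
      2: { unfold mono. rewrite <- cprod_mul. apply cprod_ext_seq. intros i Hi.
           replace (Z.of_nat (S N) - Z.of_nat i)%Z with (Z.of_nat N - Z.of_nat i + 1)%Z by lia.
           rewrite Cpowz_succ by apply Hs. ring. }
      set (X := cprod (seq 1 N) (fun i => _ * _)).
      assert (EX : X * cprod (seq 1 N) s = cprod (seq 1 N) (fun i => theta q (s i / s (S N))) *
        cprod (seq 1 N) (fun i => s i - s (S N))).
      { unfold X. rewrite <- !cprod_mul. apply cprod_ext_seq. intros i Hi. unfold theta.
        rewrite (qpoch_inf_S (s (S N) / s i)) by exact Hq.
        replace (s (S N) / s i * q) with (q / (s i / s (S N))) by (field; split; apply Hs).
        field. apply Hs. }
      transitivity ((root_prod q N s * mono N (fun i => Z.of_nat N - Z.of_nat i)%Z s) *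
        (X * cprod (seq 1 N) s)); [ring|]. rewrite IH, EX. ring. }
  unfold theta_alt.
  replace (mono N (fun _ => Z.of_nat N) s) with
    (mono N (fun i => Z.of_nat N - Z.of_nat i)%Z s * mono N (fun i => Z.of_nat i) s).
  - rewrite Cmult_assoc, H. ring.
  - rewrite <- mono_add by exact Hs. apply mono_ext. intros i _. lia.
Qed.

(** * Antisymmetric moments and the contour shift *)

Lemma Cpown_m1_sq (n : nat) : Cpown (-1) n * Cpown (-1) n = 1.
Proof. induction n as [|n IH]; simpl; [ring|]. transitivity (Cpown (-1) n * Cpown (-1) n); [ring|exact IH]. Qed.

Lemma Copp_eq_self (z : C) : z = - z -> z = 0.
Proof.
  intros E. replace z with (/ 2 * (z + z)) by field. rewrite E at 1. ring.
Qed.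

(** A cycle of adjacent transpositions: the exponent at p travels to r and those in between step
    back by one. *)
Definition move (p r : nat) (e : nat -> Z) (i : nat) : Z :=
  if ((p <=? i) && (i <? r))%nat%bool then e (S i) else if (i =? r)%nat then e p else e i.

Ltac nat_tests := repeat match goal with
  | |- context [(?a <=? ?b)%nat] => destruct (Nat.leb_spec a b)
  | |- context [(?a <? ?b)%nat] => destruct (Nat.ltb_spec a b)
  | |- context [(?a =? ?b)%nat] => destruct (Nat.eqb_spec a b)
  end; cbn [andb]; subst; try lia.

Section Moments.
Context (N n : nat) (u : (nat -> C) -> C).
Context (HnN : (n <= N)%nat) (Hu : laurent_limit N u).
Context (Hanti : forall j s, (1 <= j < n)%nat -> nonvanishing s ->
  u (fun i => s (swap j i)) = - u s).

Definition moment (e : nat -> Z) : C := CT N (fun s => u s * mono N e s).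

Lemma laurent_limit_moment (e : nat -> Z) : laurent_limit N (fun s => u s * mono N e s).
Proof. apply laurent_limit_mult; [exact Hu|apply laurent_limit_mono]. Qed.

Lemma moment_ext (e e' : nat -> Z) :
  (forall i, (1 <= i <= N)%nat -> e i = e' i) -> moment e = moment e'.
Proof.
  intros H. apply CT_ext. intros s _. now rewrite (mono_ext N e e' s H).
Qed.

Lemma moment_swap (j : nat) (e : nat -> Z) : (1 <= j < n)%nat ->
  moment (fun i => e (swap j i)) = - moment e.
Proof.
  intros Hj. assert (HjN : (1 <= j < N)%nat) by lia. unfold moment.
  rewrite <- (proj2 (CT_swap N j _ HjN (laurent_limit_moment (fun i => e (swap j i))))).
  transitivity (CT N (fun s => -1 * (u s * mono N e s))).
  - apply CT_ext. intros s Hs. rewrite Hanti, mono_swap by assumption.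
    rewrite (mono_ext N (fun i => e (swap j (swap j i))) e); [ring|].
    intros i _. now rewrite swap_swap.
  - rewrite CT_scal by apply laurent_limit_moment. ring.
Qed.

(** Adjacent swaps bring the equal exponents next to each other; one more swap then fixes e, so the
    moment equals its own negative. Antisymmetry in the first n variables is enough, which the
    Vandermonde expansion exploits with n < N. *)
Lemma moment_repeat (e : nat -> Z) (i i' : nat) :
  (1 <= i <= n)%nat -> (1 <= i' <= n)%nat -> i <> i' -> e i = e i' -> moment e = 0.
Proof.
  assert (H : forall d i e, (1 <= i)%nat -> (i + S d <= n)%nat -> e i = e (i + S d)%nat ->
    moment e = 0).
  { clear e i i'. induction d as [|d IH]; intros i e Hi Hn E.
    - apply Copp_eq_self. rewrite <- (moment_swap i) by lia. apply moment_ext. intros l _.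
      replace (i + 1)%nat with (S i) in E by lia. unfold swap. nat_tests; congruence.
    - assert (H : moment (fun l => e (swap (i + S d) l)) = 0).
      { apply (IH i); [lia|lia|]. rewrite swap_l, swap_other by lia. rewrite E. f_equal. lia. }
      rewrite moment_swap in H by lia.
      replace (moment e) with (- - moment e) by ring. rewrite H. ring. }
  intros Hi Hi' Hne E. destruct (Nat.lt_ge_cases i i').
  - apply (H (i' - i - 1)%nat i e); [lia|lia|]. rewrite E. f_equal. lia.
  - apply (H (i - i' - 1)%nat i' e); [lia|lia|]. rewrite <- E. f_equal. lia.
Qed.

Lemma moment_move (p d : nat) (e : nat -> Z) : (1 <= p)%nat -> (p + d <= n)%nat ->
  moment (move p (p + d) e) = Cpown (-1) d * moment e.
Proof.
  intros Hp. induction d as [|d IH]; intros Hd.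
  - simpl. rewrite Cmult_1_l. apply moment_ext. intros i _. unfold move. nat_tests; f_equal; lia.
  - transitivity (moment (fun i => move p (p + d) e (swap (p + d) i))).
    + apply moment_ext. intros i _. unfold move, swap. nat_tests; f_equal; lia.
    + rewrite moment_swap, IH by lia. simpl. ring.
Qed.
End Moments.

Definition matter (q : C) (N : nat) (a : C) (s : nat -> C) : C :=
  cprod (seq 1 N) (fun i => qpoch_inf (a * s i) q).

Definition shift_at (j : nat) (m : Z) (e : nat -> Z) (i : nat) : Z :=
  if (i =? j)%nat then (e i + m)%Z else e i.

Lemma mono_shift_at (N j : nat) (m : Z) (e : nat -> Z) (s : nat -> C) :
  nonvanishing s -> (1 <= j <= N)%nat -> mono N (shift_at j m e) s = Cpowz (s j) m * mono N e s.
Proof.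
  intros Hs Hj. rewrite <- (mono_delta N j m s Hj), <- mono_add by exact Hs.
  apply mono_ext. intros i _. unfold shift_at. destruct (i =? j)%nat; lia.
Qed.

Section Shift.
Context (q : C) (N : nat) (a : C).
Context (Hq : (Cmod q < 1)%R) (Hq0 : q <> 0).

Definition Jint (e : nat -> Z) : C :=
  moment N (fun s => theta_alt q N s * matter q N a s) e.

Lemma laurent_limit_matter : laurent_limit N (matter q N a).
Proof.
  apply (laurent_limit_cprod N (seq 1 N) (fun i s => qpoch_inf (a * s i) q)).
  intros i Hi. apply in_seq in Hi. apply laurent_limit_qpoch_inf; [exact Hq|].
  apply laurent_limit_mult; [apply laurent_limit_const|apply laurent_limit_var; lia].
Qed.

Lemma laurent_limit_Jint : laurent_limit N (fun s => theta_alt q N s * matter q N a s).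
Proof.
  apply laurent_limit_mult; [now apply laurent_limit_theta_alt|apply laurent_limit_matter].
Qed.

Lemma Jint_alternating (j : nat) (s : nat -> C) : (1 <= j < N)%nat -> nonvanishing s ->
  theta_alt q N (fun i => s (swap j i)) * matter q N a (fun i => s (swap j i)) =
  - (theta_alt q N s * matter q N a s).
Proof.
  intros Hj Hs. rewrite theta_alt_swap by assumption. unfold matter.
  rewrite (cprod_swap j N (fun i => qpoch_inf (a * s i) q)) by exact Hj. ring.
Qed.

Lemma Jint_ext (e e' : nat -> Z) :
  (forall i, (1 <= i <= N)%nat -> e i = e' i) -> Jint e = Jint e'.
Proof. apply moment_ext. Qed.

Lemma Jint_repeat (e : nat -> Z) (i i' : nat) :
  (1 <= i <= N)%nat -> (1 <= i' <= N)%nat -> i <> i' -> e i = e i' -> Jint e = 0.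
Proof.
  apply (moment_repeat N N); [lia|apply laurent_limit_Jint|apply Jint_alternating].
Qed.

Lemma Jint_rotate (e : nat -> Z) : (1 <= N)%nat ->
  Jint (move 1 N e) = Cpown (-1) (N - 1) * Jint e.
Proof.
  intros HN. unfold Jint.
  rewrite <- (moment_move N N) with (p := 1%nat);
    [|lia|apply laurent_limit_Jint|apply Jint_alternating|lia|lia].
  now replace (1 + (N - 1))%nat with N by lia.
Qed.

(* Invariance of the constant term of [theta_alt * matter * s^e * (1 - (a/q) s_j)]
   under [s_j -> q s_j]. *)
Lemma Jint_shift (e : nat -> Z) (j : nat) : (1 <= j <= N)%nat ->
  Jint e - a / q * Jint (shift_at j 1 e) =
  Cpown (-1) (N - 1) * Cpowz q (1 + e j) *
  Jint (fun i => shift_at j (- Z.of_nat N) e i + 1)%Z.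
Proof.
  intros Hj. set (u := fun s => theta_alt q N s * matter q N a s).
  set (f := fun s => u s * mono N e s + - (a / q) * (u s * mono N (shift_at j 1 e) s)).
  assert (H1 := laurent_limit_moment N u laurent_limit_Jint e).
  assert (H2 := laurent_limit_moment N u laurent_limit_Jint (shift_at j 1 e)).
  assert (H3 := laurent_limit_mult N _ _ (laurent_limit_const N (- (a / q))) H2).
  assert (Hf : laurent_limit N f) by (now apply laurent_limit_plus).
  assert (Ef : CT N f = Jint e - a / q * Jint (shift_at j 1 e)).
  { unfold f. rewrite CT_plus, CT_scal by assumption. unfold Jint, moment, u. ring. }
  rewrite <- Ef.
  assert (Hq1 : (0 < Cmod q)%R) by (now apply Cmod_gt_0).
  assert (Hd : annulus (Cmod q) (dilate q j)).
  { intros i. unfold dilate. assert (1 <= / Cmod q)%R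
      by (rewrite <- Rinv_1; apply Rinv_le_contravar; lra).
    destruct (i =? j)%nat; [lra|]. rewrite Cmod_1. lra. }
  assert (Hdn := annulus_nonvanishing _ _ Hq1 Hd).
  rewrite <- (proj2 (CT_scale N (dilate q j) (Cmod q) f Hq1 Hd Hf)).
  unfold Jint at 1, moment.
  rewrite <- CT_scal by (apply laurent_limit_moment, laurent_limit_Jint).
  apply CT_ext. intros s Hs. unfold f, u.
  rewrite theta_alt_dilate, !mono_scale, !mono_shift_at by assumption.
  rewrite (mono_add N (shift_at j (- Z.of_nat N) e) (fun _ => 1%Z)) by assumption.
  rewrite mono_shift_at, !Cpowz_1 by assumption.
  replace (mono N e (dilate q j)) with (Cpowz q (e j)).
  2: { unfold mono. rewrite <- (cprod_delta N j (Cpowz q (e j)) Hj). apply cprod_ext_seq.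
       intros i _. unfold dilate. destruct (i =? j)%nat eqn:E.
       - apply Nat.eqb_eq in E; now subst.
       - symmetry; apply Cpowz_1_l. }
  replace (dilate q j j) with q by (unfold dilate; now rewrite Nat.eqb_refl).
  (* Dilation turns the factor 1 - (a/q) s_j of f into 1 - a s_j, exactly the factor that the
     dilated matter product has lost. *)
  replace (matter q N a s) with ((1 - a * s j) * matter q N a (fun i => dilate q j i * s i)).
  2: { unfold matter. rewrite <- (cprod_delta N j (1 - a * s j) Hj), <- cprod_mul.
       apply cprod_ext_seq. intros i _. unfold dilate. destruct (i =? j)%nat eqn:E.
       - apply Nat.eqb_eq in E; subst. rewrite (qpoch_inf_S (a * s j)) by exact Hq.
         replace (a * s j * q) with (a * (q * s j)) by ring. reflexivity.
       - rewrite !Cmult_1_l. reflexivity. }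
  rewrite (Z.add_comm 1), Cpowz_succ by exact Hq0.
  field. exact Hq0.
Qed.
End Shift.

(** * The U(N) integrals at fixed determinant charge *)

(* The exponents of [theta_alt * s^e = theta_prod * s_i^m * (s_1 ... s_N)^(-k)]. *)
Definition charge_exp (k : Z) (i : nat) (m : Z) (j : nat) : Z :=
  (- Z.of_nat j - k + if (j =? i)%nat then m else 0)%Z.

Lemma Cpowz_Cpown (z : C) (m : Z) (n : nat) :
  z <> 0 -> Cpowz z (m * Z.of_nat n) = Cpown (Cpowz z m) n.
Proof. intros Hz. now rewrite Cpowz_mul, Cpowz_nat. Qed.

Definition triangular (n : nat) : nat := Nat.div2 (n * S n).

Lemma triangular_double (n : nat) : (2 * triangular n = n * S n)%nat.
Proof.
  unfold triangular. rewrite (Nat.div2_odd (n * S n)) at 2.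
  replace (Nat.odd (n * S n)) with false; [simpl; lia|].
  rewrite Nat.odd_mul, Nat.odd_succ, <- Nat.negb_odd. now destruct (Nat.odd n).
Qed.

Lemma triangular_S (n : nat) : triangular (S n) = (triangular n + S n)%nat.
Proof. generalize (triangular_double n) (triangular_double (S n)). nia. Qed.

Section Charge.
Context (q : C) (N : nat) (a : C).
Context (Hq : (Cmod q < 1)%R) (Hq0 : q <> 0) (Ha : a <> 0) (HN : (1 <= N)%nat).

Definition Iint (i : nat) (m k : Z) : C := Jint q N a (charge_exp k i m).

Lemma Iint_0 (i j : nat) (k : Z) : Iint i 0 k = Iint j 0 k.
Proof.
  apply Jint_ext. intros l _. unfold charge_exp. now destruct (l =? i)%nat, (l =? j)%nat.
Qed.

(** Adding 1 to every exponent lowers k by 1, so for j = i the contour shift stays inside the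
    family. *)
Lemma Iint_rec (i : nat) (m k : Z) : (1 <= i <= N)%nat ->
  Iint i m k - a / q * Iint i (m + 1) k =
  Cpown (-1) (N - 1) * Cpowz q (1 - Z.of_nat i - k + m) * Iint i (m - Z.of_nat N) (k - 1).
Proof.
  intros Hi. unfold Iint.
  rewrite (Jint_ext q N a (charge_exp k i (m + 1)) (shift_at i 1 (charge_exp k i m))).
  2: { intros l _. unfold charge_exp, shift_at. nat_tests. }
  rewrite (Jint_shift q N a Hq Hq0) by exact Hi. f_equal; [f_equal; f_equal|].
  - unfold charge_exp. rewrite Nat.eqb_refl. lia.
  - apply Jint_ext. intros l _. unfold charge_exp, shift_at. nat_tests.
Qed.

(** The factor s_i^m puts at position i the exponent -(i-m)-k, which already stands at position i -
    m. *)
Lemma Iint_vanish (i : nat) (m k : Z) : (1 <= i <= N)%nat -> m <> 0%Z ->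
  (1 <= Z.of_nat i - m <= Z.of_nat N)%Z -> Iint i m k = 0.
Proof.
  intros Hi Hm Him. apply (Jint_repeat q N a Hq _ i (Z.to_nat (Z.of_nat i - m))); [lia|lia|lia|].
  unfold charge_exp. nat_tests.
Qed.

(** In this range of m the right-hand side of [Iint_rec] has exponent m - N, and position i - m + N
    holds the same exponent as position i. *)
Lemma Iint_raise (i : nat) (m k : Z) : (1 <= i <= N)%nat ->
  (Z.of_nat i <= m < Z.of_nat N)%Z -> Iint i (m + 1) k = q / a * Iint i m k.
Proof.
  intros Hi Hm. assert (E := Iint_rec i m k Hi).
  rewrite (Iint_vanish i (m - Z.of_nat N)) in E by lia. rewrite Cmult_0_r in E.
  replace (Iint i m k) with (a / q * Iint i (m + 1) k +
    (Iint i m k - a / q * Iint i (m + 1) k)) by ring.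
  rewrite E. field. auto.
Qed.

Lemma Iint_raise_iter (i d : nat) (k : Z) : (1 <= i)%nat -> (i + d <= N)%nat ->
  Iint i (Z.of_nat (i + d)) k = Cpown (q / a) d * Iint i (Z.of_nat i) k.
Proof.
  intros Hi. induction d as [|d IH]; intros Hd.
  - rewrite Nat.add_0_r. simpl. ring.
  - replace (Z.of_nat (i + S d)) with (Z.of_nat (i + d) + 1)%Z by lia.
    rewrite Iint_raise, IH by lia. simpl. ring.
Qed.

Lemma Iint_first (k : Z) :
  a / q * Iint 1 1 k = (1 - Cpowz q (- k)) * Iint 1 0 k.
Proof.
  assert (E := Iint_rec 1 0 k ltac:(lia)).
  (* At charge k - 1 the exponents are -N-k, -1-k, ..., -(N-1)-k; moving the first to the end gives
     those of I_{1,0,k}. *)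
  assert (ER : Iint 1 (0 - Z.of_nat N) (k - 1) = Cpown (-1) (N - 1) * Iint 1 0 k).
  { replace (Iint 1 0 k) with (Jint q N a (move 1 N (charge_exp (k - 1) 1 (0 - Z.of_nat N)))).
    2: { apply Jint_ext. intros l Hl. unfold charge_exp, move. nat_tests. }
    rewrite (Jint_rotate q N a Hq), Cmult_assoc, Cpown_m1_sq by exact HN.
    unfold Iint. ring. }
  rewrite ER in E. change (0 + 1)%Z with 1%Z in E.
  replace (1 - Z.of_nat 1 - k + 0)%Z with (- k)%Z in E by lia.
  replace (Cpown (-1) (N - 1) * Cpowz q (- k) * (Cpown (-1) (N - 1) * Iint 1 0 k))
    with (Cpown (-1) (N - 1) * Cpown (-1) (N - 1) * Cpowz q (- k) * Iint 1 0 k) in E by ring.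
  rewrite Cpown_m1_sq in E.
  replace (a / q * Iint 1 1 k) with (Iint 1 0 k - (Iint 1 0 k - a / q * Iint 1 1 k)) by ring.
  rewrite E. ring.
Qed.

(** Here the contour shift is taken in s_1 although the Wilson exponent sits at i + 1. One term
    vanishes because s_1 s_(i+1)^(i+1) gives positions 1 and i + 1 the same exponent -k; the other
    is a rotation of I_{i,i+1,k}. *)
Lemma Iint_next (i : nat) (k : Z) : (1 <= i < N)%nat ->
  Iint (S i) (Z.of_nat (S i)) k = Cpowz q (- k) * (q / a) * Iint i (Z.of_nat i) k.
Proof.
  intros Hi. rewrite <- Cmult_assoc, <- Iint_raise by lia.
  set (e := charge_exp k (S i) (Z.of_nat (S i))).
  assert (E := Jint_shift q N a Hq Hq0 e 1 ltac:(lia)).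
  rewrite (Jint_repeat q N a Hq (shift_at 1 1 e) 1 (S i)) in E; [|lia|lia|lia|].
  2: { unfold e, charge_exp, shift_at. nat_tests. }
  set (e' := fun l => (shift_at 1 (- Z.of_nat N) e l + 1)%Z) in E.
  assert (ER : Iint i (Z.of_nat i + 1) k = Cpown (-1) (N - 1) * Jint q N a e').
  { rewrite <- (Jint_rotate q N a Hq) by exact HN. apply Jint_ext. intros l Hl.
    unfold e', e, charge_exp, shift_at, move. nat_tests. }
  rewrite ER. change (Iint (S i) (Z.of_nat (S i)) k) with (Jint q N a e).
  replace (Jint q N a e) with (Jint q N a e - a / q * 0) by ring. rewrite E.
  replace (1 + e 1%nat)%Z with (- k)%Z; [ring|]. unfold e, charge_exp. nat_tests.
Qed.

Lemma Iint_diag (i : nat) (k : Z) : (1 <= i <= N)%nat ->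
  Iint i (Z.of_nat i) k = Cpown (Cpowz q (- k) * (q / a)) (i - 1) * Iint 1 1 k.
Proof.
  induction i as [|i IH]; intros Hi; [lia|].
  destruct (Nat.eq_dec i 0) as [->|Hi0]; [simpl; ring|].
  rewrite Iint_next, IH by lia. replace (S i - 1)%nat with (S (i - 1)) by lia. simpl. ring.
Qed.

(** The exponents -1-k, ..., -(N-1)-k, -k are a rotation of -k, -1-k, ..., -(N-1)-k, those of charge
    k - 1. *)
Lemma Iint_last (k : Z) : Iint N (Z.of_nat N) k = Cpown (-1) (N - 1) * Iint 1 0 (k - 1).
Proof.
  unfold Iint. rewrite <- (Jint_rotate q N a Hq) by exact HN. apply Jint_ext. intros l Hl.
  unfold charge_exp, move. nat_tests.
Qed.

(** Closes the chain I_{1,0,k}, I_{1,1,k}, I_{N,N,k}, I_{1,0,k-1}. The factor 1 - q^k is left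
    undivided, so k = 0 is not excluded. *)
Lemma Iint_0_rec (k : Z) :
  (1 - Cpowz q k) * Iint 1 0 k =
  Cpown (- (a / q)) N * Cpowz q (k * Z.of_nat N) * Iint 1 0 (k - 1).
Proof.
  assert (E := Iint_last k). rewrite Iint_diag in E by lia.
  assert (F := Iint_first k).
  assert (Hk : Cpowz q k <> 0) by (now apply Cpowz_neq0).
  rewrite Cpowz_opp in E, F by exact Hq0.
  rewrite Cpowz_Cpown by exact Hq0.
  assert (Hd : - (a / q) <> 0).
  { intros H. apply Ha. replace a with (- (- (a / q)) * q) by (field; exact Hq0). rewrite H. ring. }
  replace (Iint 1 0 (k - 1)) with (Cpown (-1) (N - 1) * (Cpown (-1) (N - 1) * Iint 1 0 (k - 1)))
    by (rewrite Cmult_assoc, Cpown_m1_sq; ring).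
  rewrite <- E. replace N with (S (N - 1)) at 1 2 by lia.
  change (Cpown (- (a / q)) (S (N - 1))) with (- (a / q) * Cpown (- (a / q)) (N - 1)).
  change (Cpown (Cpowz q k) (S (N - 1))) with (Cpowz q k * Cpown (Cpowz q k) (N - 1)).
  transitivity (- Cpowz q k * (a / q * Iint 1 1 k) *
    (Cpown (- (a / q)) (N - 1) * Cpown (Cpowz q k) (N - 1) * Cpown (-1) (N - 1) *
     Cpown (/ Cpowz q k * (q / a)) (N - 1))).
  - rewrite <- !Cpown_mul_l.
    replace (- (a / q) * Cpowz q k * -1 * (/ Cpowz q k * (q / a))) with (RtoC 1)
      by (field; auto).
    replace (Cpown 1 (N - 1)) with (RtoC 1)
      by (symmetry; rewrite <- Cpowz_nat; apply Cpowz_1_l).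
    rewrite F. field. exact Hk.
  - ring.
Qed.

Lemma Iint_0_nat (n : nat) :
  Iint 1 0 (Z.of_nat n) * qpoch q q n =
  Cpown (- (a / q)) (N * n) * Cpown q (N * triangular n) * Iint 1 0 0.
Proof.
  induction n as [|n IH].
  - change (triangular 0) with 0%nat. rewrite Nat.mul_0_r. simpl. unfold qpoch; simpl. ring.
  - rewrite qpoch_S, triangular_S.
    transitivity ((1 - Cpowz q (Z.of_nat (S n))) * Iint 1 0 (Z.of_nat (S n)) * qpoch q q n).
    { rewrite Cpowz_nat. simpl. ring. }
    rewrite Iint_0_rec. replace (Z.of_nat (S n) - 1)%Z with (Z.of_nat n) by lia.
    rewrite <- Nat2Z.inj_mul, Cpowz_nat.
    transitivity (Cpown (- (a / q)) N * Cpown q (S n * N) * (Iint 1 0 (Z.of_nat n) * qpoch q q n));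
      [ring|].
    rewrite IH. replace (N * S n)%nat with (N + N * n)%nat by lia.
    replace (N * (triangular n + S n))%nat with (S n * N + N * triangular n)%nat by lia.
    rewrite !Cpown_add. ring.
Qed.
End Charge.

(** * Homogeneity and normalization *)

Lemma CT_dilation (N : nat) (rho : C) (f : (nat -> C) -> C) : rho <> 0 ->
  laurent_limit N f ->
  laurent_limit N (fun s => f (fun i => rho * s i)) /\
  CT N (fun s => f (fun i => rho * s i)) = CT N f.
Proof.
  intros Hr Hf. apply Cmod_gt_0 in Hr.
  apply (CT_scale N (fun _ => rho) (Rmin (Cmod rho) (/ Cmod rho))); [| |exact Hf].
  - apply Rmin_glb_lt; [exact Hr|now apply Rinv_0_lt_compat].
  - intros _. split; [apply Rmin_l|].
    rewrite <- (Rinv_inv (Cmod rho)) at 1. apply Rinv_le_contravar; [|apply Rmin_r].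
    apply Rmin_glb_lt; [exact Hr|now apply Rinv_0_lt_compat].
Qed.

Lemma Cpown_mul_exp (z : C) (n m : nat) : Cpown z (n * m) = Cpown (Cpown z m) n.
Proof. induction n as [|n IH]; simpl; [reflexivity|]. now rewrite Cpown_add, IH. Qed.

(** The constants c_n = 2^n - 1 solve c_(n+1) = 2 c_n + 1, where 2 bounds each factor. *)
Lemma cprod_close (l : list nat) (f : nat -> C) (x : R) : (0 <= x <= 1)%R ->
  (forall i, In i l -> (Cmod (f i - 1) <= x)%R) ->
  (Cmod (cprod l f - 1) <= (2 ^ length l - 1) * x)%R.
Proof.
  intros Hx. induction l as [|a l IH]; intros H; simpl.
  - replace (1 - 1) with (RtoC 0) by ring. rewrite Cmod_0. lra.
  - replace (f a * cprod l f - 1) with (f a * (cprod l f - 1) + (f a - 1)) by ring.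
    eapply Rle_trans; [apply Cmod_triangle|]. rewrite Cmod_mult.
    assert (Ha := H a (or_introl eq_refl)).
    specialize (IH (fun i Hi => H i (or_intror Hi))).
    assert (H2 : (Cmod (f a) <= 2)%R).
    { replace (f a) with ((f a - 1) + 1) by ring.
      eapply Rle_trans; [apply Cmod_triangle|]. rewrite Cmod_1. lra. }
    assert (P : (Cmod (f a) * Cmod (cprod l f - 1) <= 2 * ((2 ^ length l - 1) * x))%R)
      by (apply Rmult_le_compat; try apply Cmod_ge_0; assumption).
    lra.
Qed.

Lemma qpoch_inf_near_1 (q z : C) (d : R) : (Cmod q < 1)%R -> (Cmod z <= d <= 1)%R ->
  (Cmod (qpoch_inf z q - 1) <= exp (1 / (1 - Cmod q)) * / (1 - Cmod q) * d)%R.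
Proof.
  intros Hq Hz. assert (H := qpoch_inf_close z q 0 Hq).
  change (qpoch z q 0) with (RtoC 1) in H. rewrite pow_O, Rmult_1_r in H.
  rewrite <- Cmod_opp, Copp_minus_distr. eapply Rle_trans; [exact H|].
  assert (Hq0 := Cmod_ge_0 q). assert (Hz0 := Cmod_ge_0 z).
  eapply Rle_trans; [apply (qpoch_rate_mono q _ d Hq); lra|].
  unfold qpoch_rate. rewrite Rmult_assoc.
  assert (P : (0 < / (1 - Cmod q))%R) by (apply Rinv_0_lt_compat; lra).
  apply Rmult_le_compat; [left; apply exp_pos|apply Rdiv_le_0_compat; lra| |right; unfold Rdiv; ring].
  assert (E : (d / (1 - Cmod q) <= 1 / (1 - Cmod q))%R)
    by (apply Rmult_le_compat_r; lra).
  destruct E as [E|E]; [left; now apply exp_increasing|rewrite E; lra].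
Qed.

Lemma matter_near_1 (q : C) (N : nat) (eps : R) : (Cmod q < 1)%R -> (0 < eps)%R ->
  exists d, (0 < d <= 1)%R /\ forall b s, (Cmod b <= d)%R -> (forall i, Cmod (s i) = 1%R) ->
    (Cmod (matter q N b s - 1) <= eps)%R.
Proof.
  intros Hq He. set (K := (exp (1 / (1 - Cmod q)) * / (1 - Cmod q))%R).
  assert (HK : (0 < K)%R).
  { apply Rmult_lt_0_compat; [apply exp_pos|apply Rinv_0_lt_compat; lra]. }
  assert (H2 : (1 <= 2 ^ N)%R) by (apply pow_R1_Rle; lra).
  set (d := Rmin 1 (Rmin (/ K) (eps / (2 ^ N * K)))).
  assert (Hd1 : (d <= 1)%R) by apply Rmin_l.
  assert (Hd2 : (d <= / K)%R) by (eapply Rle_trans; [apply Rmin_r|apply Rmin_l]).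
  assert (Hd3 : (d <= eps / (2 ^ N * K))%R) by (eapply Rle_trans; [apply Rmin_r|apply Rmin_r]).
  assert (Hd0 : (0 < d)%R).
  { repeat apply Rmin_glb_lt; [lra|now apply Rinv_0_lt_compat|].
    apply Rdiv_lt_0_compat; [lra|]. apply Rmult_lt_0_compat; lra. }
  exists d. split; [lra|]. intros b s Hb Hs.
  assert (HKd : (0 <= K * d <= 1)%R).
  { split; [apply Rmult_le_pos; lra|].
    apply (Rmult_le_compat_l K) in Hd2; [|lra]. rewrite Rinv_r in Hd2 by lra. exact Hd2. }
  eapply Rle_trans.
  - apply (cprod_close (seq 1 N) (fun i => qpoch_inf (b * s i) q) (K * d) HKd).
    intros i _. apply qpoch_inf_near_1; [exact Hq|]. rewrite Cmod_mult, Hs. lra.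
  - rewrite length_seq. apply (Rmult_le_compat_l (2 ^ N * K)) in Hd3; [|apply Rmult_le_pos; lra].
    replace (2 ^ N * K * (eps / (2 ^ N * K)))%R with eps in Hd3
      by (field; split; lra).
    assert (0 <= K * d)%R by lra. lra.
Qed.

Section Homogeneity.
Context (q : C) (N : nat) (Hq : (Cmod q < 1)%R) (Hq0 : q <> 0).

Lemma charge_integrand (a : C) (i : nat) (m k : Z) (s : nat -> C) :
  nonvanishing s -> (1 <= i <= N)%nat ->
  theta_alt q N s * matter q N a s * mono N (charge_exp k i m) s =
  theta_prod q N s * matter q N a s * (Cpowz (s i) m * Cpowz (cprod (seq 1 N) s) (- k)).
Proof.
  intros Hs Hi. unfold theta_alt.
  rewrite <- (mono_delta N i m s Hi), <- mono_const, <- mono_add by exact Hs.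
  transitivity (theta_prod q N s * matter q N a s *
    (mono N (fun j => Z.of_nat j) s * mono N (charge_exp k i m) s)); [ring|].
  rewrite <- mono_add by exact Hs. f_equal. apply mono_ext. intros l _.
  unfold charge_exp. lia.
Qed.

Lemma Iint_CT (a : C) (i : nat) (m k : Z) : (1 <= i <= N)%nat ->
  Iint q N a i m k = CT N (fun s => theta_prod q N s * matter q N a s *
    (Cpowz (s i) m * Cpowz (cprod (seq 1 N) s) (- k))).
Proof. intros Hi. apply CT_ext. intros s Hs. now apply charge_integrand. Qed.

Lemma cprod_scale (rho : C) (s : nat -> C) :
  cprod (seq 1 N) (fun i => rho * s i) = Cpown rho N * cprod (seq 1 N) s.
Proof. now rewrite cprod_mul, cprod_const. Qed.

(** Under s -> rho s the theta product is unchanged and the matter product absorbs rho into a; what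
    remains is the degree of s_i^m (s_1 ... s_N)^(-k). *)
Lemma Iint_scale (a rho : C) (i : nat) (m k : Z) : rho <> 0 -> (1 <= i <= N)%nat ->
  Iint q N a i m k = Cpowz rho (m - Z.of_nat N * k) * Iint q N (a * rho) i m k.
Proof.
  intros Hr Hi. unfold Iint, Jint, moment.
  assert (H : forall b, laurent_limit N
    (fun s => theta_alt q N s * matter q N b s * mono N (charge_exp k i m) s))
    by (intros b; apply laurent_limit_moment, laurent_limit_Jint, Hq).
  rewrite <- CT_scal by apply H.
  rewrite <- (proj2 (CT_dilation N rho _ Hr (H a))).
  apply CT_ext. intros s Hs.
  assert (Hs' : nonvanishing (fun i => rho * s i))
    by (intros j; apply Cmult_neq_0; [exact Hr|apply Hs]).
  rewrite !charge_integrand, theta_prod_homogeneous, cprod_scale by assumption.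
  replace (matter q N a (fun i => rho * s i)) with (matter q N (a * rho) s).
  2: { apply cprod_ext. intros j _. f_equal. ring. }
  assert (HP : cprod (seq 1 N) s <> 0) by (apply cprod_neq0; intros j _; apply Hs).
  rewrite !Cpowz_mul_l by (try assumption; try apply Hs; now apply Cpown_neq0).
  rewrite <- (Cpowz_nat rho N), <- Cpowz_mul by exact Hr.
  replace (m - Z.of_nat N * k)%Z with (m + Z.of_nat N * - k)%Z by lia.
  rewrite Cpowz_add by exact Hr. ring.
Qed.

Lemma Iint_near (i : nat) (m k : Z) (eps : R) : (1 <= i <= N)%nat -> (0 < eps)%R ->
  exists d, (0 < d <= 1)%R /\ forall b, (Cmod b <= d)%R ->
    (Cmod (Iint q N b i m k - CT N (fun s => theta_alt q N s * mono N (charge_exp k i m) s)%C)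
      <= eps)%R.
Proof.
  intros Hi He.
  assert (HL : laurent_limit N (fun s => theta_alt q N s * mono N (charge_exp k i m) s)).
  { apply laurent_limit_mult; [now apply laurent_limit_theta_alt|apply laurent_limit_mono]. }
  destruct (laurent_limit_bounded N _ 1 Rlt_0_1 HL) as (B & HB0 & HB).
  destruct (matter_near_1 q N (eps / B) Hq) as (d & Hd & Hm).
  { apply Rdiv_lt_0_compat; lra. }
  exists d. split; [exact Hd|]. intros b Hb. apply CT_dist.
  - apply laurent_limit_moment, laurent_limit_Jint, Hq.
  - exact HL.
  - intros s Hs.
    replace (theta_alt q N s * matter q N b s * mono N (charge_exp k i m) s -
      theta_alt q N s * mono N (charge_exp k i m) s) with
      (theta_alt q N s * mono N (charge_exp k i m) s * (matter q N b s - 1)) by ring.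
    rewrite Cmod_mult. replace eps with (B * (eps / B))%R by (field; lra).
    apply Rmult_le_compat; try apply Cmod_ge_0; [|now apply Hm].
    apply HB, unit_annulus; [lra|exact Hs].
Qed.

Lemma Cmod_scaled (a : C) (d : R) : (0 < d)%R ->
  exists rho : R, (0 < rho <= d)%R /\ (Cmod (a * rho) <= d)%R.
Proof.
  intros Hd. assert (Ha := Cmod_ge_0 a). exists (d / (1 + Cmod a))%R.
  assert (P : (0 < d / (1 + Cmod a))%R) by (apply Rdiv_lt_0_compat; lra).
  assert (E : (d / (1 + Cmod a) * (1 + Cmod a) = d)%R) by (field; lra).
  assert (P' := Rmult_le_pos _ _ (Rlt_le _ _ P) Ha).
  split; [split; [exact P|lra]|].
  rewrite Cmod_mult, Cmod_R, Rabs_pos_eq by lra. lra.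
Qed.

(** In [Iint_scale] the power of rho is positive, so the prefactor tends to 0 with rho while the
    integral stays bounded. *)
Lemma Iint_below (a : C) (i : nat) (m k : Z) : (1 <= i <= N)%nat ->
  (Z.of_nat N * k < m)%Z -> Iint q N a i m k = 0.
Proof.
  intros Hi Hk. apply Cmod_small_eq. intros eps He.
  set (T := CT N (fun s => theta_alt q N s * mono N (charge_exp k i m) s)).
  destruct (Iint_near i m k 1 Hi Rlt_0_1) as (d & Hd & Hn).
  (* The first bound keeps the rescaled integral within 1 of T; the second makes the power of rho at
     most eps/(1+|T|). *)
  set (d' := Rmin d (eps / (1 + Cmod T))).
  assert (HT := Cmod_ge_0 T).
  assert (Hd' : (0 < d')%R)
    by (apply Rmin_glb_lt; [lra|apply Rdiv_lt_0_compat; lra]).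
  destruct (Cmod_scaled a d' Hd') as (rho & Hr & Har).
  assert (H1 : (d' <= d)%R) by apply Rmin_l.
  assert (H2 : (d' <= eps / (1 + Cmod T))%R) by apply Rmin_r.
  assert (Hr0 : RtoC rho <> 0) by (apply Cmod_gt_0; rewrite Cmod_R, Rabs_pos_eq; lra).
  rewrite (Iint_scale a rho) by assumption.
  replace (m - Z.of_nat N * k)%Z with (Z.of_nat (S (Z.to_nat (m - Z.of_nat N * k - 1)))) by lia.
  set (p := Z.to_nat _). rewrite Cpowz_nat.
  unfold Cminus. replace (- 0) with (RtoC 0) by ring. rewrite Cplus_0_r.
  rewrite Cmod_mult, Cmod_Cpown, Cmod_R, Rabs_pos_eq by lra.
  specialize (Hn (a * rho) ltac:(lra)). fold T in Hn.
  assert (HI : (Cmod (Iint q N (a * rho) i m k) <= 1 + Cmod T)%R).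
  { replace (Iint q N (a * rho) i m k) with ((Iint q N (a * rho) i m k - T) + T) by ring.
    eapply Rle_trans; [apply Cmod_triangle|]. lra. }
  assert (Hp : (0 <= rho ^ S p <= eps / (1 + Cmod T))%R).
  { split; [apply pow_le; lra|]. apply Rle_trans with rho; [|lra].
    rewrite <- (Rmult_1_r rho) at 2. simpl. apply Rmult_le_compat_l; [lra|].
    rewrite <- (pow1 p). apply pow_incr. lra. }
  apply Rle_trans with (eps / (1 + Cmod T) * (1 + Cmod T))%R.
  - apply Rmult_le_compat; [lra|apply Cmod_ge_0|lra|exact HI].
  - right; field; lra.
Qed.

(** In degree 0 the integral does not change with a, so the matter product can be removed by letting
    a tend to 0. *)
Lemma Iint_0_0 (a : C) : (1 <= N)%nat -> Iint q N a 1 0 0 = CT N (theta_prod q N).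
Proof.
  intros HN. apply Cmod_small_eq. intros eps He.
  destruct (Iint_near 1 0 0 eps ltac:(lia) He) as (d & Hd & Hn).
  destruct (Cmod_scaled a d ltac:(lra)) as (rho & Hr & Har).
  assert (Hr0 : RtoC rho <> 0) by (apply Cmod_gt_0; rewrite Cmod_R, Rabs_pos_eq; lra).
  rewrite (Iint_scale a rho) by (try assumption; lia).
  replace (0 - Z.of_nat N * 0)%Z with 0%Z by lia. rewrite Cpowz_0, Cmult_1_l.
  replace (CT N (theta_prod q N)) with
    (CT N (fun s => theta_alt q N s * mono N (charge_exp 0 1 0) s)); [now apply Hn|].
  apply CT_ext. intros s Hs. unfold theta_alt. rewrite <- Cmult_assoc, <- mono_add by exact Hs.
  replace (mono N (fun i => (Z.of_nat i + charge_exp 0 1 0 i)%Z) s) with (RtoC 1); [ring|].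
  symmetry. apply cprod_one. intros i _. unfold charge_exp.
  replace (Z.of_nat i + _)%Z with 0%Z; [reflexivity|]. nat_tests.
Qed.
End Homogeneity.

(** The integrand of I_{1,0,M} at a = q after s -> q^(-M) s, up to constants: the first M matter
    factors are reflected into (1/s_i;q)_M and the rest is (q s_i;q)_inf. The value a = q is the one
    for which the limit in M is theta(1/s_i). *)
Definition half_theta (q : C) (N M : nat) (s : nat -> C) : C :=
  theta_prod q N s * cprod (seq 1 N) (fun i => qpoch (/ s i) q M * qpoch_inf (q * s i) q).

Definition full_theta (q : C) (N : nat) (s : nat -> C) : C :=
  theta_prod q N s * cprod (seq 1 N) (fun i => theta q (/ s i)).

Section Normalization.
Context (q : C) (Hq : (Cmod q < 1)%R) (Hq0 : q <> 0).

Lemma laurent_limit_matter_var (N i : nat) (b : C) : (1 <= i <= N)%nat ->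
  laurent_limit N (fun s => qpoch_inf (b * s i) q).
Proof.
  intros Hi. apply laurent_limit_qpoch_inf; [exact Hq|].
  apply laurent_limit_mult; [apply laurent_limit_const|now apply laurent_limit_var].
Qed.

Lemma laurent_limit_half_theta (N M : nat) : laurent_limit N (half_theta q N M).
Proof.
  apply laurent_limit_mult; [now apply laurent_limit_theta_prod|].
  apply (laurent_limit_cprod N (seq 1 N)
    (fun i s => qpoch (/ s i) q M * qpoch_inf (q * s i) q)).
  intros i Hi. apply in_seq in Hi. apply laurent_limit_mult.
  - apply laurent_limit_qpoch, laurent_limit_inv. lia.
  - apply laurent_limit_matter_var. lia.
Qed.

Lemma laurent_limit_full_theta (N : nat) : laurent_limit N (full_theta q N).
Proof.
  apply laurent_limit_mult; [now apply laurent_limit_theta_prod|].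
  apply (laurent_limit_cprod N (seq 1 N) (fun i s => theta q (/ s i))).
  intros i Hi. apply in_seq in Hi.
  apply (laurent_limit_ext N (fun s => qpoch_inf (/ s i) q * qpoch_inf (q * s i) q)).
  - intros s Hs. unfold theta. do 2 f_equal. field. apply Hs.
  - apply laurent_limit_mult; [|apply laurent_limit_matter_var; lia].
    apply laurent_limit_qpoch_inf; [exact Hq|]. apply laurent_limit_inv. lia.
Qed.

(** By homogeneity the other variables can be divided by the first, after which the integrand of the
    outer integral is constant. *)
Lemma CT_theta_prod_S (N : nat) : CT (S N) (theta_prod q (S N)) = CT N (full_theta q N).
Proof.
  unfold CT at 1. simpl.
  assert (H : forall th, torus_int N (fun l => theta_prod q (S N) (lvar (Ceith th :: l))) =
    CT N (full_theta q N)).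
  { intros th. set (w := Ceith th). assert (Hw : w <> 0) by apply Ceith_neq0.
    transitivity (CT N (fun s => full_theta q N (fun i => / w * s i))).
    - apply torus_int_ext. intros l Hl. rewrite theta_prod_S_l. unfold full_theta.
      assert (Hs := lvar_nonvanishing N l Hl).
      rewrite theta_prod_homogeneous by (try exact Hs; now apply Cinv_nz).
      rewrite Cmult_comm. f_equal.
      + apply theta_prod_ext. intros i Hi. unfold lvar.
        replace (S i - 1)%nat with (S (i - 1)) by lia. reflexivity.
      + apply cprod_ext_seq. intros i Hi. f_equal.
        replace (lvar (w :: l) (S i)) with (lvar l i).
        2: { unfold lvar. replace (S i - 1)%nat with (S (i - 1)) by lia. reflexivity. }
        change (lvar (w :: l) 1) with w. field. split; [exact Hw|apply Hs].
    - apply CT_dilation; [now apply Cinv_nz|apply laurent_limit_full_theta]. }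
  replace (fun th => torus_int N (fun l => theta_prod q (S N) (lvar (Ceith th :: l))))
    with (fun _ : R => CT N (full_theta q N))
    by (apply functional_extensionality; intros th; now rewrite H).
  assert (P := twoPI_pos).
  rewrite (C_is_RInt_unique _ (CT N (full_theta q N) * RtoC (2 * PI))).
  - rewrite RtoC_inv by lra. field. intros E; inversion E; lra.
  - apply (is_RInt_ext (V := C_R_NormedModule)
      (fun th => CT N (full_theta q N) * Cpowz (Ceith th) 0)).
    + intros th _. rewrite Cpowz_0. apply Cmult_1_r.
    + apply is_RInt_Cmult. exact (is_RInt_Cpowz_Ceith 0).
Qed.

(** Factor by factor, 1 - q^(-j) z = -z q^(-j) (1 - q^j/z) for 0 <= j < M, and the powers of q
    multiply to q^(M - M(M+1)/2). *)
Lemma qpoch_reflect (z : C) (M : nat) : z <> 0 ->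
  qpoch (Cpowz q (1 - Z.of_nat M) * z) q M * Cpown q (triangular M) =
  Cpown (- z) M * Cpown q M * qpoch (/ z) q M.
Proof.
  intros Hz. induction M as [|M IH]; [unfold qpoch; simpl; ring|].
  rewrite qpoch_S_l, qpoch_S, triangular_S, Cpown_add.
  replace (1 - Z.of_nat (S M))%Z with (- Z.of_nat M)%Z by lia.
  replace (Cpowz q (- Z.of_nat M) * z * q) with (Cpowz q (1 - Z.of_nat M) * z).
  2: { replace (1 - Z.of_nat M)%Z with (- Z.of_nat M + 1)%Z by lia.
       rewrite Cpowz_succ by exact Hq0. ring. }
  rewrite Cpowz_neg. assert (HM : Cpown q M <> 0) by (now apply Cpown_neq0).
  transitivity ((1 - / Cpown q M * z) * Cpown q (S M) *
    (qpoch (Cpowz q (1 - Z.of_nat M) * z) q M * Cpown q (triangular M))); [ring|].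
  rewrite IH. simpl. field. auto.
Qed.

(** I_{1,0,M} at a = q is evaluated twice, by the recursion in k and by rescaling. The result is
    exact for every M; only afterwards does M tend to infinity. *)
Lemma CT_half_theta (N M : nat) : (1 <= N)%nat ->
  CT N (half_theta q N M) * qpoch q q M = CT N (theta_prod q N).
Proof.
  intros HN. assert (E := Iint_0_nat q N q Hq Hq0 Hq0 HN M).
  rewrite (Iint_0_0 q N Hq) in E by exact HN.
  set (rho := Cpowz q (- Z.of_nat M)).
  assert (Hr : rho <> 0) by (now apply Cpowz_neq0).
  rewrite (Iint_scale q N Hq q rho) in E by (try exact Hr; lia).
  assert (EI : Iint q N (q * rho) 1 0 (Z.of_nat M) * Cpown q (N * triangular M) =
    Cpown (-1) (N * M) * Cpown q (N * M) * CT N (half_theta q N M)).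
  { rewrite Iint_CT by lia.
    assert (HL : laurent_limit N (fun s => theta_prod q N s * matter q N (q * rho) s *
      (Cpowz (s 1%nat) 0 * Cpowz (cprod (seq 1 N) s) (- Z.of_nat M)))).
    { apply (laurent_limit_ext N (fun s => theta_alt q N s * matter q N (q * rho) s *
        mono N (charge_exp (Z.of_nat M) 1 0) s)).
      - intros s Hs. apply charge_integrand; [exact Hs|lia].
      - apply laurent_limit_moment, laurent_limit_Jint, Hq. }
    rewrite Cmult_comm, <- CT_scal by exact HL.
    rewrite <- CT_scal by apply laurent_limit_half_theta.
    apply CT_ext. intros s Hs. unfold half_theta, matter.
    rewrite Cpowz_0, Cmult_1_l, Cpowz_neg.
    assert (HP : Cpown (cprod (seq 1 N) s) M <> 0)
      by (apply Cpown_neq0, cprod_neq0; intros j _; apply Hs).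
    assert (EP : Cpown q (N * triangular M) * cprod (seq 1 N) (fun i => qpoch_inf (q * rho * s i) q)
      = Cpown (-1) (N * M) * Cpown q (N * M) * Cpown (cprod (seq 1 N) s) M *
        cprod (seq 1 N) (fun i => qpoch (/ s i) q M * qpoch_inf (q * s i) q)).
    { assert (Hpow : forall z n, Cpown z (N * n) = cprod (seq 1 N) (fun _ => Cpown z n)).
      { intros z n. rewrite cprod_const. apply Cpown_mul_exp. }
      rewrite !Hpow, <- (Cpowz_nat (cprod _ _)), <- cprod_Cpowz by (intros i _; apply Hs).
      rewrite <- !cprod_mul. apply cprod_ext_seq. intros i Hi. rewrite Cpowz_nat.
      rewrite (qpoch_inf_split (q * rho * s i) q M) by exact Hq.
      replace (q * rho * s i * Cpown q M) with (q * s i).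
      2: { unfold rho. rewrite Cpowz_neg. field. now apply Cpown_neq0. }
      replace (q * rho) with (Cpowz q (1 - Z.of_nat M)).
      2: { replace (1 - Z.of_nat M)%Z with (- Z.of_nat M + 1)%Z by lia.
           now rewrite Cpowz_succ. }
      rewrite Cmult_assoc, (Cmult_comm (Cpown q _)), qpoch_reflect by apply Hs.
      replace (- s i) with (-1 * s i) by ring. rewrite Cpown_mul_l. ring. }
    transitivity (theta_prod q N s * (Cpown q (N * triangular M) *
      cprod (seq 1 N) (fun i => qpoch_inf (q * rho * s i) q)) / Cpown (cprod (seq 1 N) s) M).
    - field. exact HP.
    - rewrite EP. field. exact HP. }
  (* The scaling gives q^(N M^2) and the reflection q^(N M), together q^(N M (M+1)). *)
  assert (Er : Cpowz rho (0 - Z.of_nat N * Z.of_nat M) * Cpown q (N * M) =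
    Cpown q (N * triangular M) * Cpown q (N * triangular M)).
  { unfold rho. rewrite <- Cpowz_mul by exact Hq0.
    replace (- Z.of_nat M * (0 - Z.of_nat N * Z.of_nat M))%Z with (Z.of_nat (M * (N * M))) by lia.
    rewrite Cpowz_nat, <- !Cpown_add. f_equal. generalize (triangular_double M). nia. }
  assert (HT : Cpown q (N * triangular M) <> 0) by (now apply Cpown_neq0).
  replace (- (q / q)) with (RtoC (-1)) in E by (field; exact Hq0).
  assert (Hs1 := Cpown_m1_sq (N * M)).
  set (sg := Cpown (-1) (N * M)) in *. set (T := Cpown q (N * triangular M)) in *.
  assert (E2 : T * T * (CT N (half_theta q N M) * qpoch q q M) = T * T * CT N (theta_prod q N)).
  { transitivity (sg * (Cpowz rho (0 - Z.of_nat N * Z.of_nat M) *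
      Iint q N (q * rho) 1 0 (Z.of_nat M) * qpoch q q M) * T).
    - transitivity (sg * Cpowz rho (0 - Z.of_nat N * Z.of_nat M) * qpoch q q M *
        (Iint q N (q * rho) 1 0 (Z.of_nat M) * T)); [|ring].
      rewrite EI, <- Er.
      transitivity ((sg * sg) * (Cpowz rho (0 - Z.of_nat N * Z.of_nat M) * Cpown q (N * M) *
        (CT N (half_theta q N M) * qpoch q q M))); [rewrite Hs1; ring|ring].
    - rewrite E. transitivity ((sg * sg) * (T * T * CT N (theta_prod q N))); [ring|].
      rewrite Hs1; ring. }
  transitivity (/ (T * T) * (T * T * (CT N (half_theta q N M) * qpoch q q M))).
  - field. exact HT.
  - rewrite E2. field. exact HT.
Qed.

(** The quotient of the two integrands is the product of the (q^M/s_i;q)_inf, a matter product in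
    the inverse variables with a small parameter. *)
Lemma CT_half_theta_limit (N : nat) (eps : R) : (0 < eps)%R ->
  exists M0, forall M, (M0 <= M)%nat ->
    (Cmod (CT N (full_theta q N) - CT N (half_theta q N M)) <= eps)%R.
Proof.
  intros He.
  (* The bound must not depend on M; on the torus [qpoch_bound] gives |(1/s_i;q)_M| <=
     exp(1/(1-|q|)). *)
  assert (HB : exists B, (0 < B)%R /\ forall M s, (forall i, Cmod (s i) = 1%R) ->
    (Cmod (half_theta q N M s) <= B)%R).
  { destruct (laurent_limit_bounded N _ 1 Rlt_0_1 (laurent_limit_theta_prod q N Hq))
      as (B1 & HB1 & HB1').
    destruct (laurent_limit_bounded N _ 1 Rlt_0_1 (laurent_limit_matter q N q Hq))
      as (B2 & HB2 & HB2').
    set (B3 := exp (1 / (1 - Cmod q))).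
    assert (HB3 : (0 < B3)%R) by apply exp_pos.
    exists (B1 * (B3 ^ N * B2))%R. split.
    - repeat apply Rmult_lt_0_compat; try assumption. now apply pow_lt.
    - intros M s Hs. assert (Ha : annulus 1 s) by (apply unit_annulus; [lra|exact Hs]).
      unfold half_theta. rewrite cprod_mul, !Cmod_mult.
      apply Rmult_le_compat; [apply Cmod_ge_0| |now apply HB1'|].
      { apply Rmult_le_pos; apply Cmod_ge_0. }
      apply Rmult_le_compat; [apply Cmod_ge_0|apply Cmod_ge_0| |now apply HB2'].
      rewrite <- (length_seq N 1) at 2. apply Cmod_cprod_le. intros i _.
      eapply Rle_trans; [apply qpoch_bound, Hq|].
      rewrite Cmod_inv, Hs, Rinv_1 by (apply unit_nonvanishing, Hs). apply Rle_refl. }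
  destruct HB as (B & HB0 & HB).
  destruct (matter_near_1 q N (eps / B) Hq) as (d & Hd & Hm).
  { apply Rdiv_lt_0_compat; lra. }
  destruct (pow_small (Cmod q) d 1) as (M0 & HM0); [generalize (Cmod_ge_0 q); lra|lra|].
  exists M0. intros M HM. specialize (HM0 M HM).
  apply CT_dist; [apply laurent_limit_full_theta|apply laurent_limit_half_theta|].
  intros s Hs. assert (Hs' := unit_nonvanishing s Hs).
  replace (full_theta q N s) with
    (half_theta q N M s * matter q N (Cpown q M) (fun i => / s i)).
  2: { unfold full_theta, half_theta, matter. rewrite <- Cmult_assoc, <- cprod_mul. f_equal.
       apply cprod_ext. intros i _. unfold theta.
       rewrite (qpoch_inf_split (/ s i) q M) by exact Hq.
       replace (q / / s i) with (q * s i) by (field; apply Hs').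
       rewrite (Cmult_comm (Cpown q M)). ring. }
  replace (half_theta q N M s * matter q N (Cpown q M) (fun i => / s i) - half_theta q N M s)
    with (half_theta q N M s * (matter q N (Cpown q M) (fun i => / s i) - 1)) by ring.
  rewrite Cmod_mult. replace eps with (B * (eps / B))%R by (field; lra).
  apply Rmult_le_compat; try apply Cmod_ge_0; [now apply HB|].
  apply Hm; [rewrite Cmod_Cpown; lra|]. intros i. rewrite Cmod_inv, Hs by apply Hs'. apply Rinv_1.
Qed.

Lemma CT_theta_prod_step (N : nat) : (1 <= N)%nat ->
  CT (S N) (theta_prod q (S N)) * qpoch_inf q q = CT N (theta_prod q N).
Proof.
  intros HN. rewrite CT_theta_prod_S. apply Cmod_small_eq. intros eps He.
  set (F := CT N (full_theta q N)). assert (HF := Cmod_ge_0 F).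
  set (E := exp (Cmod q / (1 - Cmod q))). assert (HE : (0 < E)%R) by apply exp_pos.
  destruct (CT_half_theta_limit N (eps / 2 / E)) as (M0 & HM0).
  { apply Rdiv_lt_0_compat; lra. }
  destruct (pow_small (Cmod q) (eps / 2) (Cmod F * qpoch_rate q (Cmod q))) as (M1 & HM1);
    [generalize (Cmod_ge_0 q); lra|lra|].
  set (M := (M0 + M1)%nat). specialize (HM0 M ltac:(lia)). specialize (HM1 M ltac:(lia)).
  rewrite <- (CT_half_theta N M HN). fold F in HM0.
  replace (F * qpoch_inf q q - CT N (half_theta q N M) * qpoch q q M) with
    (- (F * (qpoch q q M - qpoch_inf q q)) + (F - CT N (half_theta q N M)) * qpoch q q M) by ring.
  eapply Rle_trans; [apply Cmod_triangle|]. rewrite Cmod_opp, !Cmod_mult.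
  assert (A := qpoch_inf_close q q M Hq).
  apply (Rmult_le_compat_l (Cmod F)) in A; [|exact HF].
  assert (B : (Cmod (F - CT N (half_theta q N M)) * Cmod (qpoch q q M) <= eps / 2 / E * E)%R).
  { apply Rmult_le_compat; try apply Cmod_ge_0; [exact HM0|now apply qpoch_bound]. }
  replace (eps / 2 / E * E)%R with (eps / 2)%R in B by (field; lra). lra.
Qed.

Lemma CT_theta_prod (N : nat) : (1 <= N)%nat ->
  Cpown (qpoch_inf q q) (N - 1) * CT N (theta_prod q N) = 1.
Proof.
  induction N as [|N IH]; intros HN; [lia|].
  destruct (Nat.eq_dec N 0) as [->|HN0].
  - rewrite CT_theta_prod_S. unfold full_theta, theta_prod, CT; simpl. ring.
  - rewrite <- IH by lia. rewrite <- (CT_theta_prod_step N) by lia.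
    replace (S N - 1)%nat with (S (N - 1)) by lia. simpl. ring.
Qed.
End Normalization.

(** * Removing the Vandermonde factor *)

(** The exponents of the diagonal term s_1^(n-1) s_2^(n-2) ... s_n^0 of the Vandermonde product. *)
Definition staircase (n : nat) (i : nat) : Z :=
  if (i <=? n)%nat then (Z.of_nat n - Z.of_nat i)%Z else 0%Z.

(* The exponents met after choosing [s_j] from the factors [s_j - s_(n+1)] with
   [j <= p] and [- s_(n+1)] from those with [p < j <= l]. *)
Definition expand_exp (n p l : nat) (i : nat) : Z :=
  if (i <=? p)%nat then (Z.of_nat (S n) - Z.of_nat i)%Z
  else if (i <=? n)%nat then (Z.of_nat n - Z.of_nat i)%Z
  else if (i =? S n)%nat then (Z.of_nat l - Z.of_nat p)%Z else 0%Z.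

Section VandermondeStep.
Context (N n : nat) (u : (nat -> C) -> C).
Context (HnN : (S n <= N)%nat) (Hu : laurent_limit N u).
Context (Hanti : forall j s, (1 <= j < S n)%nat -> nonvanishing s ->
  u (fun i => s (swap j i)) = - u s).

(** u with the factors s_j - s_(n+1) not yet expanded, those with l < j <= n. It still alternates in
    the first l variables. *)
Definition tail_factor (l : nat) (s : nat -> C) : C :=
  u s * cprod (seq (S l) (n - l)) (fun j => s j - s (S n)).

Lemma laurent_limit_tail_factor (l : nat) : laurent_limit N (tail_factor l).
Proof.
  apply laurent_limit_mult; [exact Hu|].
  apply (laurent_limit_cprod N (seq (S l) (n - l)) (fun j s => s j - s (S n))).
  intros j Hj. apply in_seq in Hj.
  apply (laurent_limit_ext N (fun s => s j + -1 * s (S n))); [intros s _; ring|].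
  apply laurent_limit_plus; [apply laurent_limit_var; lia|].
  apply laurent_limit_mult; [apply laurent_limit_const|apply laurent_limit_var; lia].
Qed.

Lemma tail_factor_alternating (l j : nat) (s : nat -> C) : (l <= n)%nat ->
  (1 <= j < l)%nat -> nonvanishing s ->
  tail_factor l (fun i => s (swap j i)) = - tail_factor l s.
Proof.
  intros Hl Hj Hs. unfold tail_factor. rewrite Hanti by (lia || exact Hs).
  rewrite (cprod_ext _ (fun i => s (swap j i) - s (swap j (S n))) (fun i => s i - s (S n))); [ring|].
  intros i Hi. apply in_seq in Hi. rewrite !swap_other by lia. reflexivity.
Qed.

Lemma tail_moment_repeat (l j : nat) (e : nat -> Z) : (l <= n)%nat -> (1 <= j < l)%nat ->
  e j = e (S j) -> moment N (tail_factor l) e = 0.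
Proof.
  intros Hl Hj E. apply (moment_repeat N l) with (i := j) (i' := S j); try lia; [|].
  - apply laurent_limit_tail_factor.
  - intros i s Hi Hs. now apply tail_factor_alternating.
Qed.

Lemma tail_moment_expand (l : nat) (e : nat -> Z) : (l < n)%nat ->
  moment N (tail_factor l) e =
  moment N (tail_factor (S l)) (shift_at (S l) 1 e) -
  moment N (tail_factor (S l)) (shift_at (S n) 1 e).
Proof.
  intros Hl. unfold moment.
  assert (H : forall e', laurent_limit N (fun s => tail_factor (S l) s * mono N e' s)).
  { intros e'. apply laurent_limit_moment, laurent_limit_tail_factor. }
  unfold Cminus.
  replace (- CT N (fun s => tail_factor (S l) s * mono N (shift_at (S n) 1 e) s))
    with (CT N (fun s => -1 * (tail_factor (S l) s * mono N (shift_at (S n) 1 e) s)))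
    by (rewrite CT_scal by apply H; ring).
  rewrite <- CT_plus; [|apply H|apply laurent_limit_mult; [apply laurent_limit_const|apply H]].
  apply CT_ext. intros s Hs. rewrite !mono_shift_at, !Cpowz_1 by (exact Hs || lia).
  unfold tail_factor. replace (n - l)%nat with (S (n - S l)) by lia. simpl seq. simpl cprod. ring.
Qed.

(** Once -s_(n+1) has been taken from factor p + 1, taking s_j from a later factor raises the
    exponent at j to the one at j - 1 and gives 0. Hence -s_(n+1) is forced from there on. *)
Lemma tail_moment_choose_last (p d : nat) : (p + S d <= n)%nat ->
  moment N (tail_factor (S p)) (expand_exp n p (S p)) =
  Cpown (-1) d * moment N (tail_factor (p + S d)) (expand_exp n p (p + S d)).
Proof.
  induction d as [|d IH]; intros Hd.
  - replace (p + 1)%nat with (S p) by lia. simpl. ring.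
  - rewrite IH, tail_moment_expand by lia.
    rewrite (tail_moment_repeat (S (p + S d)) (p + S d)); [|lia|lia|].
    2: { unfold shift_at, expand_exp. nat_tests. }
    rewrite (moment_ext N (tail_factor (S (p + S d))) (shift_at (S n) 1 _)
      (expand_exp n p (p + S (S d)))).
    + replace (S (p + S d)) with (p + S (S d))%nat by lia. simpl. ring.
    + intros i Hi. unfold shift_at, expand_exp. nat_tests.
Qed.

Lemma tail_moment_end (e : nat -> Z) : moment N (tail_factor n) e = moment N u e.
Proof.
  apply CT_ext. intros s _. unfold tail_factor. rewrite Nat.sub_diag. simpl. ring.
Qed.

(** In the branch with -s_(n+1) the n - p factors give (-1)^(n-p), which cancels against the sign of
    the cycle sorting the exponents into the staircase. *)
Lemma tail_moment_step (p : nat) : (p < n)%nat ->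
  moment N (tail_factor p) (expand_exp n p p) =
  moment N (tail_factor (S p)) (expand_exp n (S p) (S p)) + moment N u (staircase (S n)).
Proof.
  intros Hp. rewrite tail_moment_expand by exact Hp.
  rewrite (moment_ext N _ (shift_at (S p) 1 (expand_exp n p p)) (expand_exp n (S p) (S p))).
  2: { intros i Hi. unfold shift_at, expand_exp. nat_tests. }
  rewrite (moment_ext N _ (shift_at (S n) 1 (expand_exp n p p)) (expand_exp n p (S p))).
  2: { intros i Hi. unfold shift_at, expand_exp. nat_tests. }
  rewrite (tail_moment_choose_last p (n - S p)) by lia.
  replace (p + S (n - S p))%nat with n by lia. rewrite tail_moment_end.
  rewrite (moment_ext N u (expand_exp n p n) (move (S p) (S p + (n - p)) (staircase (S n)))).
  2: { intros i Hi. unfold expand_exp, move, staircase. nat_tests. }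
  rewrite (moment_move N (S n) u HnN Hu Hanti) by lia.
  replace (n - p)%nat with (S (n - S p)) by lia.
  change (Cpown (-1) (S (n - S p))) with (-1 * Cpown (-1) (n - S p)).
  transitivity (moment N (tail_factor (S p)) (expand_exp n (S p) (S p)) +
    (Cpown (-1) (n - S p) * Cpown (-1) (n - S p)) * moment N u (staircase (S n))); [ring|].
  rewrite Cpown_m1_sq. ring.
Qed.

(** The surviving choices are indexed by p = 0, ..., n, the number of factors from which s_j is
    taken, and contribute equally; this is the factor n + 1 of (n+1)!. *)
Lemma tail_moment_total :
  moment N (tail_factor 0) (staircase n) = RtoC (INR (S n)) * moment N u (staircase (S n)).
Proof.
  assert (H : forall d, (d <= n)%nat ->
    moment N (tail_factor (n - d)) (expand_exp n (n - d) (n - d)) =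
    RtoC (INR (S d)) * moment N u (staircase (S n))).
  { induction d as [|d IH]; intros Hd.
    - rewrite Nat.sub_0_r, tail_moment_end. simpl. rewrite Cmult_1_l.
      apply moment_ext. intros i Hi. unfold expand_exp, staircase. nat_tests.
    - rewrite tail_moment_step by lia.
      replace (S (n - S d)) with (n - d)%nat by lia. rewrite IH by lia.
      rewrite (S_INR (S d)), RtoC_plus. ring. }
  rewrite <- (H n (Nat.le_refl n)), Nat.sub_diag. apply moment_ext.
  intros i Hi. unfold expand_exp, staircase. nat_tests.
Qed.
End VandermondeStep.

(* Each of the n! terms of the Vandermonde determinant contributes equally. *)
Lemma CT_vandermonde (N n : nat) (u : (nat -> C) -> C) :
  (n <= N)%nat -> laurent_limit N u ->
  (forall j s, (1 <= j < n)%nat -> nonvanishing s -> u (fun i => s (swap j i)) = - u s) ->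
  CT N (fun s => u s * vandermonde n s) = RtoC (INR (fact n)) * moment N u (staircase n).
Proof.
  revert u. induction n as [|n IH]; intros u HnN Hu Hanti.
  - simpl. rewrite Cmult_1_l. apply CT_ext. intros s _. unfold vandermonde; simpl.
    f_equal. symmetry. apply cprod_one. intros i Hi. apply in_seq in Hi. unfold staircase.
    now rewrite (proj2 (Nat.leb_gt i 0)) by lia.
  (* The factors containing s_(n+1) are absorbed into u, which then alternates in the first n
     variables only. *)
  - transitivity (CT N (fun s => tail_factor n u 0 s * vandermonde n s)).
    { apply CT_ext. intros s _. unfold tail_factor. rewrite vandermonde_S, Nat.sub_0_r. ring. }
    rewrite IH; [|lia|now apply laurent_limit_tail_factor|].
    + rewrite tail_moment_total by assumption.
      rewrite fact_simpl, mult_INR, RtoC_mult. ring.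
    + intros j s Hj Hs. unfold tail_factor. rewrite Hanti by (lia || exact Hs).
      rewrite (swap_other j (S n)), Nat.sub_0_r by lia.
      rewrite (cprod_swap j n (fun i => s i - s (S n))) by exact Hj. ring.
Qed.

(** * From SU(N) to U(N) *)

(** [svar] with default value 1 in place of 0, so that every index gives a point of the unit
    circle. *)
Definition su_var (N : nat) (l : list C) (i : nat) : C :=
  if (i <? N)%nat then lvar l i else / cprod (seq 1 (N - 1)) (lvar l).

Lemma svar_su_var (N : nat) (l : list C) : (2 <= N)%nat -> length l = (N - 1)%nat ->
  svar N l = su_var N l.
Proof.
  intros HN Hl. apply functional_extensionality. intros i. unfold svar, su_var, lvar.
  destruct (i <? N)%nat eqn:E.
  - apply Nat.ltb_lt in E. apply nth_indep. lia.
  - f_equal. apply cprod_ext_seq. intros j Hj. apply nth_indep. lia.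
Qed.

Lemma su_var_unit (N : nat) (l : list C) (i : nat) : unit_list (N - 1) l ->
  Cmod (su_var N l i) = 1%R.
Proof.
  intros Hl. unfold su_var. destruct (i <? N)%nat; [exact (lvar_unit _ l Hl i)|].
  assert (H : forall L, Cmod (cprod L (lvar l)) = 1%R).
  { induction L as [|a L IH]; simpl; [apply Cmod_1|].
    rewrite Cmod_mult, IH, (lvar_unit _ l Hl). ring. }
  rewrite Cmod_inv, H by (apply Cmod_pos_neq0; rewrite H; lra). apply Rinv_1.
Qed.

Lemma su_var_det (N : nat) (l : list C) : (1 <= N)%nat -> unit_list (N - 1) l ->
  cprod (seq 1 N) (su_var N l) = 1.
Proof.
  intros HN Hl. replace N with (S (N - 1)) at 1 by lia. rewrite cprod_S.
  replace (1 + (N - 1))%nat with N by lia.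
  rewrite (cprod_ext_seq (N - 1) (su_var N l) (lvar l)).
  - unfold su_var. rewrite Nat.ltb_irrefl. apply Cinv_r.
    apply cprod_neq0. intros j _. apply (lvar_nonvanishing _ l Hl).
  - intros i Hi. unfold su_var. now rewrite (proj2 (Nat.ltb_lt i N)) by lia.
Qed.

Definition su_int (N : nat) (f : (nat -> C) -> C) : C :=
  torus_int (N - 1) (fun l => f (su_var N l)).

Definition charge_CT (N : nat) (f : (nat -> C) -> C) (k : Z) : C :=
  CT N (fun s => f s * Cpowz (cprod (seq 1 N) s) (- k)).

Definition charge_sum (N : nat) (f : (nat -> C) -> C) (lo : Z) (len : nat) : C :=
  csum (seq 0 len) (fun n => charge_CT N f (lo + Z.of_nat n)).

(** As s_1 ... s_N = 1, the exponent of s_N can be subtracted from all exponents. *)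
Lemma mono_su_var (N : nat) (e : nat -> Z) (l : list C) : (1 <= N)%nat ->
  unit_list (N - 1) l ->
  mono N e (su_var N l) = mono (N - 1) (fun i => e i - e N)%Z (lvar l).
Proof.
  intros HN Hl. assert (Hs : nonvanishing (su_var N l))
    by (apply unit_nonvanishing; intros i; now apply su_var_unit).
  transitivity (mono N (fun i => e i - e N)%Z (su_var N l)).
  - rewrite (mono_ext N e (fun i => (e i - e N) + e N)%Z) by (intros; lia).
    rewrite mono_add, mono_const, su_var_det, Cpowz_1_l by assumption. ring.
  - replace N with (S (N - 1)) at 1 by lia. rewrite mono_S.
    replace (S (N - 1)) with N by lia. rewrite Z.sub_diag, Cpowz_0, Cmult_1_r.
    apply cprod_ext_seq. intros i Hi. unfold su_var.
    now rewrite (proj2 (Nat.ltb_lt i N)) by lia.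
Qed.

Lemma laurent_limit_charge (N : nat) (f : (nat -> C) -> C) (k : Z) : laurent_limit N f ->
  laurent_limit N (fun s => f s * Cpowz (cprod (seq 1 N) s) (- k)).
Proof.
  intros Hf. apply laurent_limit_mult; [exact Hf|].
  apply (laurent_limit_ext N (mono N (fun _ => (- k)%Z))); [|apply laurent_limit_mono].
  intros s Hs. now apply mono_const.
Qed.

Lemma charge_sum_plus (N : nat) (f g : (nat -> C) -> C) (lo : Z) (len : nat) :
  laurent_limit N f -> laurent_limit N g ->
  charge_sum N (fun s => f s + g s) lo len = charge_sum N f lo len + charge_sum N g lo len.
Proof.
  intros Hf Hg. unfold charge_sum. rewrite <- csum_plus. apply csum_ext. intros n _.
  unfold charge_CT. rewrite <- CT_plus by (now apply laurent_limit_charge).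
  apply CT_ext. intros s _. ring.
Qed.

Lemma charge_sum_scal (N : nat) (f : (nat -> C) -> C) (c : C) (lo : Z) (len : nat) :
  laurent_limit N f -> charge_sum N (fun s => c * f s) lo len = c * charge_sum N f lo len.
Proof.
  intros Hf. unfold charge_sum. rewrite <- csum_scal. apply csum_ext. intros n _.
  unfold charge_CT. rewrite <- CT_scal by (now apply laurent_limit_charge).
  apply CT_ext. intros s _. ring.
Qed.

Lemma csum_single (n c : nat) (v : C) : (c < n)%nat ->
  csum (seq 0 n) (fun i => if (i =? c)%nat then v else 0) = v.
Proof.
  induction n as [|n IH]; intros H; [lia|]. rewrite csum_S. simpl.
  destruct (Nat.eq_dec c n) as [->|Hc].
  - rewrite Nat.eqb_refl, csum_zero; [ring|]. intros i Hi. apply in_seq in Hi.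
    now rewrite (proj2 (Nat.eqb_neq i n)) by lia.
  - rewrite IH, (proj2 (Nat.eqb_neq n c)) by lia. ring.
Qed.

(** A monomial survives the SU(N) integral exactly when its exponents all agree, and their common
    value is the only charge it has. K bounds these charges, so any window covering [-K, K] gives
    the full sum. *)
Lemma su_int_leval (N : nat) (L : list (C * (nat -> Z))) : (1 <= N)%nat ->
  torus_integrable (N - 1) (fun l => leval N L (su_var N l)) /\
  exists K, forall lo len, (lo <= - K)%Z -> (K < lo + Z.of_nat len)%Z ->
    su_int N (leval N L) = charge_sum N (leval N L) lo len.
Proof.
  intros HN. induction L as [|[c e] L [IH1 [K IH2]]].
  - split.
    + apply (torus_integrable_ext (N - 1) (fun l => 0 * mono (N - 1) (fun _ => 0%Z) (lvar l)));
        [intros; simpl; ring|]. apply torus_int_scal, torus_int_mono.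
    + exists 0%Z. intros lo len _ _. unfold su_int, charge_sum.
      rewrite csum_zero.
      * exact (CT_zero (N - 1)).
      * intros n _. unfold charge_CT. rewrite <- (CT_zero N). apply CT_ext. intros s _.
        simpl. ring.
  - assert (HM : torus_integrable (N - 1) (fun l => mono N e (su_var N l))).
    { eapply torus_integrable_ext; [|apply (torus_int_mono (N - 1) (fun i => e i - e N)%Z)].
      intros l Hl. symmetry. now apply mono_su_var. }
    assert (HcM := torus_int_scal (N - 1) _ c HM).
    assert (HS := torus_int_plus (N - 1) _ _ (proj1 HcM) IH1).
    split; [exact (proj1 HS)|].
    exists (Z.max K (Z.abs (e N))). intros lo len Hlo Hhi.
    transitivity (c * su_int N (mono N e) + su_int N (leval N L)).
    { unfold su_int. simpl leval. rewrite (proj2 HS), (proj2 HcM). reflexivity. }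
    assert (HLL : laurent_limit N (leval N L))
      by (apply laurent_limit_laurent; exists L; reflexivity).
    change (leval N ((c, e) :: L)) with (fun s => c * mono N e s + leval N L s).
    rewrite charge_sum_plus, charge_sum_scal, (IH2 lo len);
      [|lia|lia|apply laurent_limit_mono| |exact HLL].
    2: { apply laurent_limit_mult; [apply laurent_limit_const|apply laurent_limit_mono]. }
    f_equal. f_equal. unfold su_int.
    rewrite (torus_int_ext _ _ (fun l => mono (N - 1) (fun i => e i - e N)%Z (lvar l)))
      by (intros l Hl; now apply mono_su_var).
    fold (CT (N - 1) (mono (N - 1) (fun i => e i - e N)%Z)).
    rewrite (proj2 (torus_int_mono _ _)). unfold charge_sum.
    assert (HC : forall k, charge_CT N (mono N e) k =
      if zero_exp N (fun i => e i + - k)%Z then 1 else 0).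
    { intros k. rewrite <- (proj2 (torus_int_mono N (fun i => e i + - k)%Z)).
      apply CT_ext. intros s Hs. now rewrite mono_add, mono_const. }
    destruct (zero_exp (N - 1) _) eqn:E.
    + assert (E' := proj1 (zero_exp_true _ _) E). symmetry.
      rewrite (csum_ext _ _ (fun n => if (n =? Z.to_nat (e N - lo))%nat then 1 else 0)).
      * apply csum_single. lia.
      * intros n Hn. rewrite HC. destruct (n =? Z.to_nat (e N - lo))%nat eqn:En.
        -- apply Nat.eqb_eq in En. rewrite (proj2 (zero_exp_true _ _)); [reflexivity|].
           intros i Hi. destruct (Nat.eq_dec i N) as [->|HiN]; [lia|].
           specialize (E' i ltac:(lia)). lia.
        -- apply Nat.eqb_neq in En. destruct (zero_exp N _) eqn:E2; [|reflexivity].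
           assert (E3 := proj1 (zero_exp_true _ _) E2 N ltac:(lia)). simpl in E3. lia.
    + symmetry. apply csum_zero. intros n _. rewrite HC.
      destruct (zero_exp N _) eqn:E2; [|reflexivity].
      assert (E3 := proj1 (zero_exp_true _ _) E2).
      exfalso. rewrite (proj2 (zero_exp_true _ _)) in E; [discriminate|].
      intros i Hi. generalize (E3 i ltac:(lia)) (E3 N ltac:(lia)). simpl. lia.
Qed.

Lemma Cmod_cprod_unit (l : list nat) (s : nat -> C) :
  (forall i, Cmod (s i) = 1%R) -> Cmod (cprod l s) = 1%R.
Proof.
  intros H. induction l as [|a l IH]; simpl; [apply Cmod_1|]. rewrite Cmod_mult, IH, H. ring.
Qed.

(* Moving the contour to radius 2 or 1/2. *)
Lemma charge_CT_bound (N : nat) (f : (nat -> C) -> C) (B : R) (k : Z) :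
  (1 <= N)%nat -> laurent_limit N f ->
  (forall s, annulus (/ 2) s -> (Cmod (f s) <= B)%R) ->
  (Cmod (charge_CT N f k) <= B * (/ 2) ^ Z.to_nat (Z.abs k))%R.
Proof.
  intros HN Hf HB. assert (HF := laurent_limit_charge N f k Hf).
  assert (H : forall rho : R, (/ 2 <= rho <= 2)%R ->
    (Cmod (Cpowz (Cpown (RtoC rho) N) (- k)) <= (/ 2) ^ Z.to_nat (Z.abs k))%R ->
    (Cmod (charge_CT N f k) <= B * (/ 2) ^ Z.to_nat (Z.abs k))%R).
  { intros rho Hr Hp. assert (Hr0 : RtoC rho <> 0)
      by (apply Cmod_gt_0; rewrite Cmod_R, Rabs_pos_eq; lra).
    destruct (CT_dilation N rho _ Hr0 HF) as [HF' E].
    unfold charge_CT. rewrite <- E. apply CT_bound; [exact HF'|].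
    intros s Hs. rewrite Cmod_mult. apply Rmult_le_compat; try apply Cmod_ge_0.
    - apply HB. intros i. rewrite Cmod_mult, Hs, Cmod_R, Rabs_pos_eq by lra.
      rewrite Rinv_inv. lra.
    - rewrite cprod_scale. assert (HP : cprod (seq 1 N) s <> 0)
        by (apply cprod_neq0; intros j _; apply unit_nonvanishing, Hs).
      rewrite Cpowz_mul_l by (try exact HP; now apply Cpown_neq0).
      rewrite Cmod_mult, (Cmod_Cpowz (cprod _ _)), Cmod_cprod_unit by assumption.
      rewrite powerRZ_R1. lra. }
  assert (Hpow : forall x n, (0 <= x <= / 2)%R -> (x ^ n <= (/ 2) ^ n)%R)
    by (intros; apply pow_incr; lra).
  destruct (Z_le_gt_dec 0 k) as [Hk|Hk].
  - apply (H 2%R); [lra|]. rewrite Z.abs_eq by lia.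
    replace (- k)%Z with (- Z.of_nat (Z.to_nat k))%Z at 1 by lia.
    assert (H2 : RtoC 2 <> 0) by (intros E; inversion E; lra).
    rewrite Cpowz_neg, Cmod_inv, !Cmod_Cpown by (now apply Cpown_neq0, Cpown_neq0).
    rewrite Cmod_R, Rabs_pos_eq, <- pow_inv by lra. apply Hpow.
    assert (H1 : (2 <= 2 ^ N)%R).
    { replace N with (S (N - 1)) by lia. simpl.
      assert (1 <= 2 ^ (N - 1))%R by (apply pow_R1_Rle; lra). lra. }
    split; [left; apply Rinv_0_lt_compat; lra|apply Rinv_le_contravar; lra].
  - apply (H (/ 2)%R); [lra|]. rewrite Z.abs_neq by lia.
    replace (- k)%Z with (Z.of_nat (Z.to_nat (- k))) at 1 by lia.
    rewrite Cpowz_nat, !Cmod_Cpown, Cmod_R, Rabs_pos_eq by lra. apply Hpow.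
    split; [apply pow_le; lra|]. replace N with (S (N - 1)) by lia. simpl.
    assert ((/ 2) ^ (N - 1) <= 1)%R by (rewrite <- (pow1 (N - 1)); apply pow_incr; lra). lra.
Qed.

(** The factor 1 - (1/2)^d is the exact partial geometric sum, which makes the induction on d
    close. *)
Lemma charge_sum_right (N : nat) (f : (nat -> C) -> C) (B : R) (lo : Z) (len d : nat) :
  (1 <= N)%nat -> laurent_limit N f ->
  (forall s, annulus (/ 2) s -> (Cmod (f s) <= B)%R) -> (0 <= lo + Z.of_nat len)%Z ->
  (Cmod (charge_sum N f lo (len + d) - charge_sum N f lo len) <=
    2 * B * (/ 2) ^ Z.to_nat (lo + Z.of_nat len) * (1 - (/ 2) ^ d))%R.
Proof.
  intros HN Hf HB Hlen. induction d as [|d IH].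
  - rewrite Nat.add_0_r. unfold Cminus. rewrite Cplus_opp_r, Cmod_0. simpl. lra.
  - rewrite Nat.add_succ_r. unfold charge_sum at 1. rewrite csum_S. fold (charge_sum N f lo (len + d)).
    set (T := charge_CT _ _ _).
    replace (charge_sum N f lo (len + d) + T - charge_sum N f lo len) with
      ((charge_sum N f lo (len + d) - charge_sum N f lo len) + T) by ring.
    eapply Rle_trans; [apply Cmod_triangle|].
    assert (HT : (Cmod T <= B * ((/ 2) ^ Z.to_nat (lo + Z.of_nat len) * (/ 2) ^ d))%R).
    { unfold T. eapply Rle_trans; [apply (charge_CT_bound N f B); assumption|].
      rewrite <- pow_add. right. do 2 f_equal. lia. }
    simpl pow. lra.
Qed.

Lemma charge_sum_left (N : nat) (f : (nat -> C) -> C) (B : R) (lo : Z) (len d : nat) :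
  (1 <= N)%nat -> laurent_limit N f ->
  (forall s, annulus (/ 2) s -> (Cmod (f s) <= B)%R) -> (lo <= 0)%Z ->
  (Cmod (charge_sum N f (lo - Z.of_nat d) (d + len) - charge_sum N f lo len) <=
    2 * B * (/ 2) ^ Z.to_nat (- lo) * (1 - (/ 2) ^ d))%R.
Proof.
  intros HN Hf HB Hlo. induction d as [|d IH].
  - rewrite Z.sub_0_r. simpl plus. unfold Cminus. rewrite Cplus_opp_r, Cmod_0. simpl. lra.
  - assert (E : charge_sum N f (lo - Z.of_nat (S d)) (S d + len) =
      charge_CT N f (lo - Z.of_nat (S d)) + charge_sum N f (lo - Z.of_nat d) (d + len)).
    { unfold charge_sum. simpl seq. simpl csum. f_equal; [f_equal; lia|].
      rewrite csum_shift. apply csum_ext. intros n _. f_equal. lia. }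
    rewrite E. set (T := charge_CT _ _ _).
    replace (T + charge_sum N f (lo - Z.of_nat d) (d + len) - charge_sum N f lo len) with
      ((charge_sum N f (lo - Z.of_nat d) (d + len) - charge_sum N f lo len) + T) by ring.
    eapply Rle_trans; [apply Cmod_triangle|].
    assert (HT : (Cmod T <= B * ((/ 2) ^ Z.to_nat (- lo) * (/ 2) ^ d))%R).
    { assert (HB0 : (0 <= B)%R).
      { eapply Rle_trans; [apply Cmod_ge_0|].
        apply (HB (fun _ => 1)). intros i. rewrite Cmod_1, Rinv_inv. lra. }
      unfold T. eapply Rle_trans; [apply (charge_CT_bound N f B); assumption|].
      rewrite <- pow_add. apply Rmult_le_compat_l; [exact HB0|].
      replace (Z.to_nat (Z.abs (lo - Z.of_nat (S d)))) with (S (Z.to_nat (- lo) + d)) by lia.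
      simpl. assert (0 <= (/ 2) ^ (Z.to_nat (- lo) + d))%R by (apply pow_le; lra). lra. }
    simpl pow. lra.
Qed.

(** The identity for Laurent polynomials is transferred on a fixed window of charges; the charges of
    the approximant outside the window are bounded geometrically, however far they extend. *)
Lemma su_int_approx (N : nat) (f : (nat -> C) -> C) : (1 <= N)%nat -> laurent_limit N f ->
  torus_integrable (N - 1) (fun l => f (su_var N l)) /\
  exists B, (0 < B)%R /\ forall lo len, (lo <= 0)%Z -> (0 <= lo + Z.of_nat len)%Z ->
    (Cmod (su_int N f - charge_sum N f lo len) <=
      B * ((/ 2) ^ Z.to_nat (- lo) + (/ 2) ^ Z.to_nat (lo + Z.of_nat len)))%R.
Proof.
  intros HN Hf.
  assert (Happrox : forall eps, (0 < eps)%R -> exists L,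
    (forall s, annulus (/ 2) s -> (Cmod (f s - leval N L s) <= eps)%R)).
  { intros eps He. destruct (Hf (/ 2)%R eps ltac:(lra) He) as (g & [L HL] & Hg).
    exists L. intros s Hs. rewrite <- HL; [now apply Hg|].
    apply (annulus_nonvanishing (/ 2)); [lra|exact Hs]. }
  assert (Hann : forall l, unit_list (N - 1) l -> annulus (/ 2) (su_var N l)).
  { intros l Hl. apply unit_annulus; [lra|]. intros i. now apply su_var_unit. }
  assert (Hint : torus_integrable (N - 1) (fun l => f (su_var N l))).
  { apply torus_integrable_limit. intros eps He. destruct (Happrox eps He) as (L & HL).
    exists (fun l => leval N L (su_var N l)). split; [now apply su_int_leval|].
    intros l Hl. apply HL. now apply Hann. }
  split; [exact Hint|].
  destruct (laurent_limit_bounded N f (/ 2)) as (B & HB0 & HB); [lra|exact Hf|].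
  exists (2 * (B + 1))%R. split; [lra|]. intros lo len Hlo Hlen.
  apply le_epsilon. intros eps He.
  assert (Hlen0 := pos_INR len).
  (* e <= 1 bounds the approximant by B + 1; e (1 + len) <= eps pays for the integral and for the
     len charges of the window. *)
  set (e := Rmin 1 (eps / (1 + INR len))).
  assert (Hd : (0 < eps / (1 + INR len))%R) by (apply Rdiv_lt_0_compat; lra).
  assert (He0 : (0 < e)%R) by (apply Rmin_glb_lt; lra).
  assert (He1 : (e <= 1)%R) by apply Rmin_l.
  assert (He2 : (e * (1 + INR len) <= eps)%R).
  { assert (e <= eps / (1 + INR len))%R by apply Rmin_r.
    apply Rle_trans with (eps / (1 + INR len) * (1 + INR len))%R.
    - apply Rmult_le_compat_r; lra.
    - right; field; lra. }
  destruct (Happrox e He0) as (L & HL).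
  destruct (su_int_leval N L HN) as [HLint [K HK]].
  assert (HLL : laurent_limit N (leval N L))
    by (apply laurent_limit_laurent; exists L; reflexivity).
  assert (HLB : forall s, annulus (/ 2) s -> (Cmod (leval N L s) <= B + 1)%R).
  { intros s Hs. replace (leval N L s) with (f s + - (f s - leval N L s)) by ring.
    eapply Rle_trans; [apply Cmod_triangle|]. rewrite Cmod_opp.
    generalize (HB s Hs) (HL s Hs); lra. }
  (* Extending the window by d on both sides makes it cover all charges of the approximant. *)
  set (d := Z.to_nat (Z.abs K + 1)).
  specialize (HK (lo - Z.of_nat d)%Z (d + (len + d))%nat ltac:(lia) ltac:(lia)).
  assert (A1 : (Cmod (su_int N f - su_int N (leval N L)) <= e)%R).
  { apply torus_int_dist; [exact Hint|exact HLint|]. intros l Hl. now apply HL, Hann. }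
  assert (A2 := charge_sum_left N (leval N L) (B + 1) lo (len + d) d HN HLL HLB Hlo).
  assert (A3 := charge_sum_right N (leval N L) (B + 1) lo len d HN HLL HLB Hlen).
  assert (A4 : (Cmod (charge_sum N (leval N L) lo len - charge_sum N f lo len) <= e * INR len)%R).
  { clearbody e. clear - HL Hf HLL He0. induction len as [|len IH].
    - unfold charge_sum; simpl. unfold Cminus. rewrite Cplus_opp_r, Cmod_0. lra.
    - unfold charge_sum in *. rewrite !csum_S, S_INR.
      match goal with |- (Cmod (?a + ?b - (?c + ?d))%C <= _)%R =>
        replace (a + b - (c + d))%C with ((a - c) + (b - d))%C by ring end.
      eapply Rle_trans; [apply Cmod_triangle|].
      rewrite Rmult_plus_distr_l. apply Rplus_le_compat; [exact IH|]. rewrite Rmult_1_r.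
      apply CT_dist; try now apply laurent_limit_charge.
      intros s Hs. rewrite <- Cmod_opp.
      match goal with |- (Cmod (- (?a * ?p - ?b * ?p))%C <= _)%R =>
        replace (- (a * p - b * p))%C with ((b - a) * p)%C by ring end.
      rewrite Cmod_mult, Cmod_Cpowz, Cmod_cprod_unit, powerRZ_R1, Rmult_1_r;
        [|exact Hs|apply cprod_neq0; intros i _; apply unit_nonvanishing, Hs].
      apply HL. apply unit_annulus; [lra|exact Hs]. }
  rewrite <- HK in A2.
  set (T1 := ((/ 2) ^ Z.to_nat (- lo))%R) in *.
  set (T2 := ((/ 2) ^ Z.to_nat (lo + Z.of_nat len))%R) in *.
  assert (P1 : (0 <= (B + 1) * T1)%R) by (apply Rmult_le_pos; [lra|apply pow_le; lra]).
  assert (P2 : (0 <= (B + 1) * T2)%R) by (apply Rmult_le_pos; [lra|apply pow_le; lra]).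
  assert (Pd : (0 <= (/ 2) ^ d)%R) by (apply pow_le; lra).
  assert (Q1 := Rmult_le_pos _ _ P1 Pd). assert (Q2 := Rmult_le_pos _ _ P2 Pd).
  replace (su_int N f - charge_sum N f lo len) with
    ((su_int N f - su_int N (leval N L)) +
     ((su_int N (leval N L) - charge_sum N (leval N L) lo (len + d)) +
      ((charge_sum N (leval N L) lo (len + d) - charge_sum N (leval N L) lo len) +
       (charge_sum N (leval N L) lo len - charge_sum N f lo len)))) by ring.
  set (Z1 := su_int N f - _) in *. set (Z2 := su_int N (leval N L) - _) in *.
  set (Z3 := charge_sum N (leval N L) lo (len + d) - _) in *.
  set (Z4 := charge_sum N (leval N L) lo len - _) in *.
  generalize (Cmod_triangle Z1 (Z2 + (Z3 + Z4))) (Cmod_triangle Z2 (Z3 + Z4))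
    (Cmod_triangle Z3 Z4). lra.
Qed.

Lemma csum_S_l (a n : nat) (f : nat -> C) :
  csum (seq a (S n)) f = f a + csum (seq a n) (fun i => f (S i)).
Proof. simpl. now rewrite csum_shift. Qed.

Lemma sum_n_csum (a : nat -> C) (n : nat) :
  @sum_n (NormedModule.AbelianMonoid C_AbsRing C_NormedModule) a n = csum (seq 0 (S n)) a.
Proof.
  induction n as [|n IH].
  - rewrite sum_O. simpl. ring.
  - rewrite sum_Sn, IH, (csum_S 0 (S n)). reflexivity.
Qed.

Lemma su_int_series (N : nat) (f : (nat -> C) -> C) (k0 : Z) :
  (1 <= N)%nat -> laurent_limit N f ->
  (forall k, (k < k0)%Z -> charge_CT N f k = 0) ->
  @is_series C_AbsRing C_NormedModule (fun n => charge_CT N f (k0 + Z.of_nat n)) (su_int N f).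
Proof.
  intros HN Hf H0. destruct (su_int_approx N f HN Hf) as (_ & B & HB0 & HB).
  apply filterlim_locally. intros eps.
  destruct (pow_small (/ 2) (eps / 2) (2 * B)) as (n0 & Hn0);
    [lra|generalize (cond_pos eps); lra|].
  (* For n >= c0 the window used below contains 0, with both ends at distance at least n - c0 from
     it. *)
  set (c0 := Z.to_nat (Z.abs k0)).
  exists (n0 + c0)%nat. intros n Hn. apply C_NormedModule_mixin_compat1.
  match goal with |- (Cmod (minus ?u ?v) < _)%R => change (Cmod (u - v) < eps)%R end.
  rewrite sum_n_csum, <- Cmod_opp, Copp_minus_distr.
  specialize (HB (k0 - Z.of_nat (n + c0))%Z ((n + c0) + S n)%nat ltac:(lia) ltac:(lia)).
  (* The n + c0 terms added on the left vanish by [H0]; they let the lower end of the window recede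
     as well. *)
  replace (csum (seq 0 (S n)) _) with (charge_sum N f (k0 - Z.of_nat (n + c0)) (n + c0 + S n)).
  2: { generalize (n + c0)%nat; intros d. induction d as [|d IH].
       - unfold charge_sum. apply csum_ext. intros i _. f_equal. lia.
       - rewrite <- IH. unfold charge_sum. change (S d + S n)%nat with (S (d + S n)).
         rewrite csum_S_l, H0, Cplus_0_l by lia. apply csum_ext. intros i _. f_equal. lia. }
  eapply Rle_lt_trans; [exact HB|].
  specialize (Hn0 (n - c0)%nat ltac:(lia)).
  assert (Hp : forall a, (n - c0 <= a)%nat -> ((/ 2) ^ a <= (/ 2) ^ (n - c0))%R).
  { intros a Ha. replace a with ((n - c0) + (a - (n - c0)))%nat by lia. rewrite pow_add.
    rewrite <- (Rmult_1_r ((/ 2) ^ (n - c0))) at 2. apply Rmult_le_compat_l; [apply pow_le; lra|].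
    rewrite <- (pow1 (a - (n - c0))). apply pow_incr. lra. }
  assert (P1 := Hp (Z.to_nat (- (k0 - Z.of_nat (n + c0)))) ltac:(lia)).
  assert (P2 := Hp (Z.to_nat (k0 - Z.of_nat (n + c0) + Z.of_nat (n + c0 + S n))) ltac:(lia)).
  assert (P := Rmult_le_compat_l B _ _ (Rlt_le _ _ HB0) (Rplus_le_compat _ _ _ _ P1 P2)).
  generalize (cond_pos eps). lra.
Qed.

(** * Identification with the recursively defined functions *)

Lemma csum_swap (j N : nat) (f : nat -> C) : (1 <= j < N)%nat ->
  csum (seq 1 N) (fun i => f (swap j i)) = csum (seq 1 N) f.
Proof.
  induction N as [|N IH]; intros H; [lia|].
  rewrite !csum_S. replace (1 + N)%nat with (S N) by lia.
  destruct (Nat.eq_dec j N) as [->|Hj].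
  - destruct N as [|N]; [lia|]. rewrite !csum_S. replace (1 + N)%nat with (S N) by lia.
    rewrite swap_l, swap_r.
    rewrite (csum_ext_seq N (fun i => f (swap (S N) i)) f); [ring|].
    intros i Hi. rewrite swap_other by lia. reflexivity.
  - rewrite IH, swap_other by lia. reflexivity.
Qed.

Section Final.
Context (N : nat) (x t : C) (HN : (1 <= N)%nat) (Hx : x <> 0) (Ht0 : t <> 0)
  (Ht : (Cmod (t * t) < 1)%R).

Let q := t * t.
Let kappa := Cpown (qpoch_inf q q) (N - 1).

Definition wilson_integrand (m : Z) (s : nat -> C) : C :=
  root_prod q N s * matter q N (t * x) s * csum (seq 1 N) (fun i => Cpowz (s i) m).

Lemma q_neq0 : q <> 0.
Proof. now apply Cmult_neq_0. Qed.

Lemma tx_neq0 : t * x <> 0.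
Proof. now apply Cmult_neq_0. Qed.

Lemma laurent_limit_root_prod : laurent_limit N (root_prod q N).
Proof.
  apply (laurent_limit_cprod N (seq 1 N) (fun i s =>
    cprod (filter (fun j => negb (Nat.eqb i j)) (seq 1 N)) (fun j => qpoch_inf (s i * / s j) q))).
  intros i Hi. apply in_seq in Hi.
  apply (laurent_limit_cprod N _ (fun j s => qpoch_inf (s i * / s j) q)).
  intros j Hj. apply filter_In in Hj. destruct Hj as [Hj _]. apply in_seq in Hj.
  apply laurent_limit_qpoch_inf; [exact Ht|].
  apply laurent_limit_div; lia.
Qed.

Lemma laurent_limit_power_sum (m : Z) :
  laurent_limit N (fun s => csum (seq 1 N) (fun i => Cpowz (s i) m)).
Proof.
  apply (laurent_limit_csum N (seq 1 N) (fun i s => Cpowz (s i) m)).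
  intros i Hi. apply in_seq in Hi. apply laurent_limit_Cpowz. lia.
Qed.

Lemma laurent_limit_wilson (m : Z) : laurent_limit N (wilson_integrand m).
Proof.
  apply laurent_limit_mult; [|apply laurent_limit_power_sum].
  apply laurent_limit_mult; [apply laurent_limit_root_prod|].
  apply laurent_limit_matter, Ht.
Qed.

(** Everything except the theta product and the Vandermonde factor is symmetric, so [CT_vandermonde]
    applies. The exponent -k-N pays for the charge and for the s_i^N of [root_prod_vandermonde]. *)
Lemma charge_CT_wilson (m k : Z) :
  charge_CT N (wilson_integrand m) k =
  RtoC (INR (fact N)) * csum (seq 1 N) (fun i => Iint q N (t * x) i m k).
Proof.
  set (w := fun s => matter q N (t * x) s * csum (seq 1 N) (fun i => Cpowz (s i) m) *
    mono N (fun _ => - k - Z.of_nat N)%Z s).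
  assert (Hw : laurent_limit N w).
  { apply laurent_limit_mult; [|apply laurent_limit_mono].
    apply laurent_limit_mult; [apply laurent_limit_matter, Ht|apply laurent_limit_power_sum]. }
  assert (Hu : laurent_limit N (fun s => theta_alt q N s * w s))
    by (apply laurent_limit_mult; [apply laurent_limit_theta_alt, Ht|exact Hw]).
  transitivity (CT N (fun s => theta_alt q N s * w s * vandermonde N s)).
  - apply CT_ext. intros s Hs. unfold wilson_integrand, w.
    rewrite <- mono_const by exact Hs.
    replace (mono N (fun _ => - k)%Z s) with
      (mono N (fun _ => Z.of_nat N) s * mono N (fun _ => - k - Z.of_nat N)%Z s).
    + transitivity ((root_prod q N s * mono N (fun _ => Z.of_nat N) s) *
        (matter q N (t * x) s * csum (seq 1 N) (fun i => Cpowz (s i) m) *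
         mono N (fun _ => - k - Z.of_nat N)%Z s)); [ring|].
      rewrite (root_prod_vandermonde q N s Ht Hs). ring.
    + rewrite <- mono_add by exact Hs. apply mono_ext. intros; lia.
  - rewrite (CT_vandermonde N N); [|lia|exact Hu|].
    + f_equal. unfold moment.
      rewrite (csum_ext _ (fun i => Iint q N (t * x) i m k) (fun i => CT N (fun s =>
        theta_alt q N s * matter q N (t * x) s * mono N (charge_exp k i m) s)))
        by reflexivity.
      rewrite <- (CT_csum N (seq 1 N) (fun i s =>
        theta_alt q N s * matter q N (t * x) s * mono N (charge_exp k i m) s)).
      2: { intros i _. apply laurent_limit_moment, laurent_limit_Jint, Ht. }
      apply CT_ext. intros s Hs. unfold w. rewrite csum_scal.
      rewrite (csum_ext_seq N (fun i => mono N (charge_exp k i m) s)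
        (fun i => mono N (charge_exp k 0 0) s * Cpowz (s i) m)).
      2: { intros i Hi. rewrite <- (mono_delta N i m s Hi), <- mono_add by exact Hs.
           apply mono_ext. intros l _. unfold charge_exp. nat_tests. }
      rewrite csum_scal.
      (* The staircase supplies N - l, and (N - l) + (-k - N) = -l - k. *)
      replace (mono N (charge_exp k 0 0) s) with
        (mono N (fun _ => - k - Z.of_nat N)%Z s * mono N (staircase N) s).
      2: { rewrite <- mono_add by exact Hs. apply mono_ext. intros l Hl.
           unfold charge_exp, staircase. nat_tests. }
      ring.
    + intros j s Hj Hs. rewrite theta_alt_swap by assumption.
      replace (w (fun i => s (swap j i))) with (w s); [ring|]. unfold w, matter.
      rewrite (cprod_swap j N (fun i => qpoch_inf (t * x * s i) q)) by exact Hj.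
      rewrite (csum_swap j N (fun i => Cpowz (s i) m)) by exact Hj.
      now rewrite mono_swap.
Qed.

(** [kappa] is the inverse of I_{1,0,0}. With a = t x the powers of t are -N n from (-a/q)^(N n) and
    N n (n+1) from the triangular exponent, in total N n^2. *)
Lemma kappa_Iint_0 (n : nat) :
  kappa * Iint q N (t * x) 1 0 (Z.of_nat n) =
  Cpowz (- x) (Z.of_nat N * Z.of_nat n) * Cpowz t (Z.of_nat N * Z.of_nat n * Z.of_nat n) /
  qpoch q q n.
Proof.
  assert (Hq := qpoch_neq0 q n Ht).
  assert (E := Iint_0_nat q N (t * x) Ht q_neq0 tx_neq0 HN n).
  rewrite Iint_0_0 in E by (assumption || exact q_neq0).
  assert (EK := CT_theta_prod q Ht q_neq0 N HN). fold kappa in EK.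
  replace (kappa * Iint q N (t * x) 1 0 (Z.of_nat n)) with
    (kappa * (Iint q N (t * x) 1 0 (Z.of_nat n) * qpoch q q n) / qpoch q q n)
    by (field; exact Hq).
  rewrite E.
  replace (kappa * (Cpown (- (t * x / q)) (N * n) * Cpown q (N * triangular n) *
    CT N (theta_prod q N))) with
    (Cpown (- (t * x / q)) (N * n) * Cpown q (N * triangular n) *
      (kappa * CT N (theta_prod q N))) by ring.
  rewrite EK, Cmult_1_r. f_equal.
  replace (- (t * x / q)) with (- x * / t) by (unfold q; field; exact Ht0).
  assert (Hmx : - x <> 0).
  { intros H. apply Hx. replace x with (- - x) by ring. rewrite H. ring. }
  unfold q. rewrite !Cpown_mul_l, <- !Nat2Z.inj_mul, !Cpowz_nat, <- Cpown_add.
  replace (N * triangular n + N * triangular n)%nat with (N * n * n + N * n)%nat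
    by (generalize (triangular_double n); nia).
  rewrite Cpown_add.
  replace (Cpown (/ t) (N * n)) with (/ Cpown t (N * n)).
  - field. now apply Cpown_neq0.
  - rewrite <- !Cpowz_nat. symmetry. now apply Cpowz_inv_l.
Qed.

(** Follows I_{1,0,k}, I_{1,1,k}, I_{i,i,k}, I_{i,m,k} with k = n + 1; the m steps give the power
    (t/x)^m. *)
Lemma kappa_Iint_hook (i n : nat) (m : Z) : (1 <= i <= N)%nat ->
  (Z.of_nat i <= m <= Z.of_nat N)%Z ->
  kappa * Iint q N (t * x) i m (Z.of_nat (S n)) =
  Cpowz (-1) (Z.of_nat N * Z.of_nat (S n) + 1) * Cpowz x (Z.of_nat N * Z.of_nat (S n) - m) *
  Cpowz t (Z.of_nat N * Z.of_nat (S n) * Z.of_nat (S n) + m - 2 * Z.of_nat i * Z.of_nat (S n)) /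
  qpoch q q n.
Proof.
  intros Hi Hm. set (k := Z.of_nat (S n)).
  assert (Hq := qpoch_neq0 q n Ht). assert (Hq' := one_minus_pow_neq0 q (S n) Ht ltac:(lia)).
  replace m with (Z.of_nat (i + Z.to_nat (m - Z.of_nat i))) at 1 by lia.
  set (d := Z.to_nat (m - Z.of_nat i)).
  rewrite (Iint_raise_iter q N (t * x) Ht q_neq0 tx_neq0) by lia.
  rewrite (Iint_diag q N (t * x) Ht q_neq0 tx_neq0 HN) by lia.
  assert (EF := Iint_first q N (t * x) Ht q_neq0 HN k).
  assert (E0 := kappa_Iint_0 (S n)). fold k in E0. rewrite qpoch_S in E0.
  assert (Htx : t / x <> 0) by (apply Cmult_neq_0; [exact Ht0|now apply Cinv_nz]).
  replace (q / (t * x)) with (t / x) by (unfold q; field; auto).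
  replace (t * x / q) with (/ (t / x)) in EF by (unfold q; field; auto).
  assert (E1 : Iint q N (t * x) 1 1 k = t / x * ((1 - Cpowz q (- k)) * Iint q N (t * x) 1 0 k)).
  { rewrite <- EF. field. auto. }
  rewrite E1.
  assert (Hqk : Cpowz q k <> 0) by (apply Cpowz_neq0, q_neq0).
  transitivity (Cpown (t / x) d * Cpown (Cpowz q (- k) * (t / x)) (i - 1) * (t / x) *
    (1 - Cpowz q (- k)) * (kappa * Iint q N (t * x) 1 0 k)); [ring|].
  rewrite E0.
  (* The factor 1 - q^k cancels the last one of (q;q)_k, and the minus sign is the extra 1 in the
     exponent of -1. *)
  replace (1 - Cpowz q (- k)) with (- Cpowz q (- k) * (1 - q * Cpown q n)).
  2: { change (q * Cpown q n) with (Cpown q (S n)). rewrite <- (Cpowz_nat q (S n)). fold k.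
       rewrite Cpowz_opp by exact q_neq0. field. exact Hqk. }
  assert (EP : Cpown (t / x) d * Cpown (Cpowz q (- k) * (t / x)) (i - 1) * (t / x) *
      Cpowz q (- k) = Cpowz t m * Cpowz x (- m) * Cpowz t (- (2 * Z.of_nat i * k))).
  { rewrite Cpown_mul_l.
    transitivity ((Cpown (t / x) d * (Cpown (t / x) (i - 1) * (t / x))) *
      (Cpown (Cpowz q (- k)) (i - 1) * Cpowz q (- k))); [ring|].
    assert (HS : forall z, Cpown z (i - 1) * z = Cpown z i).
    { intros z. replace i with (S (i - 1)) at 2 by lia. simpl. ring. }
    rewrite !HS, <- Cpown_add.
    replace (d + i)%nat with (Z.to_nat m) by lia.
    rewrite <- (Cpowz_nat (t / x)), Z2Nat.id by lia. unfold Cdiv.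
    rewrite Cpowz_mul_l by (try exact Ht0; now apply Cinv_nz).
    rewrite Cpowz_inv_l, <- (Cpowz_opp x) by exact Hx. f_equal.
    rewrite <- Cpowz_Cpown by exact q_neq0. unfold q.
    rewrite Cpowz_mul_l, <- Cpowz_add by exact Ht0. f_equal. lia. }
  replace (- x) with (-1 * x) by ring.
  assert (H1 : RtoC (-1) <> 0) by (intros E; inversion E; lra).
  rewrite Cpowz_mul_l by assumption.
  replace (Z.of_nat N * k * k + m - 2 * Z.of_nat i * k)%Z with
    (m + - (2 * Z.of_nat i * k) + Z.of_nat N * k * k)%Z by lia.
  replace (Z.of_nat N * k - m)%Z with (- m + Z.of_nat N * k)%Z by lia.
  rewrite !(Cpowz_add t), (Cpowz_add x), (Cpowz_succ (-1)) by assumption.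
  transitivity (- (Cpown (t / x) d * Cpown (Cpowz q (- k) * (t / x)) (i - 1) * (t / x) *
      Cpowz q (- k)) * (Cpowz (-1) (Z.of_nat N * k) * Cpowz x (Z.of_nat N * k) *
      Cpowz t (Z.of_nat N * k * k)) / qpoch q q n).
  - field. split; [exact Hx|split; [exact Hq|exact Hq']].
  - rewrite EP. field. exact Hq.
Qed.

(** The zero cases of [Ybase] have two causes: a repeated exponent for 0 < m < N - i + 1, and the
    degree bound of [Iint_below] for small k. *)
Lemma Ybase_Iint (i : nat) (m k : Z) : (1 <= i <= N)%nat -> (0 <= m <= Z.of_nat N)%Z ->
  Ybase N i m k x t = kappa * Iint q N (t * x) (N + 1 - i) m k.
Proof.
  intros Hi Hm. unfold Ybase.
  destruct (m =? 0)%Z eqn:E0.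
  - apply Z.eqb_eq in E0; subst m. rewrite (Iint_0 q N (t * x) (N + 1 - i) 1).
    destruct (0 <=? k)%Z eqn:Ek.
    + apply Z.leb_le in Ek. rewrite <- (Z2Nat.id k) at 5 by exact Ek.
      rewrite kappa_Iint_0, Z2Nat.id by exact Ek. reflexivity.
    + apply Z.leb_gt in Ek. rewrite Iint_below by (assumption || exact q_neq0 || nia). ring.
  - apply Z.eqb_neq in E0.
    destruct (_ && _ && _)%bool eqn:E.
    + apply andb_prop in E. destruct E as [E E3]. apply andb_prop in E. destruct E as [E1 E2].
      apply Z.leb_le in E1, E2. apply Z.ltb_lt in E3.
      assert (Ek : k = Z.of_nat (S (Z.to_nat (k - 1)))) by lia.
      set (n := Z.to_nat (k - 1)) in *. clearbody n. subst k.
      rewrite kappa_Iint_hook by lia.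
      replace (2 * (Z.of_nat N + 1 - Z.of_nat i) * Z.of_nat (S n))%Z with
        (2 * Z.of_nat (N + 1 - i) * Z.of_nat (S n))%Z by lia. reflexivity.
    + destruct (Z_lt_le_dec m (Z.of_nat N - Z.of_nat i + 1)) as [Hlt|Hge].
      * rewrite Iint_vanish by (assumption || lia). ring.
      * destruct (Z_lt_le_dec 0 k) as [Hk|Hk].
        -- exfalso. rewrite (proj2 (Z.leb_le _ _)), (proj2 (Z.leb_le _ _)),
             (proj2 (Z.ltb_lt _ _)) in E by lia. discriminate.
        -- rewrite Iint_below by (assumption || exact q_neq0 || nia). ring.
Qed.

(** Outside 0..N each recursive call either lands in that range, where no fuel is consumed, or
    decreases |m|. The disjunction is needed because a call may land at a value larger than the
    remaining fuel. *)
Lemma Yfuel_Iint (fuel i : nat) (m k : Z) : (1 <= i <= N)%nat ->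
  ((0 <= m <= Z.of_nat N) \/ (Z.abs m <= Z.of_nat fuel))%Z ->
  Yfuel fuel N i m k x t = kappa * Iint q N (t * x) (N + 1 - i) m k.
Proof.
  intros Hi. revert m k. induction fuel as [|fuel IH]; intros m k Hm; cbn [Yfuel];
    destruct (_ && _)%bool eqn:E; try (apply andb_prop in E; destruct E as [E1 E2];
      apply Z.leb_le in E1, E2; now apply Ybase_Iint).
  - exfalso. rewrite (proj2 (Z.leb_le _ _)), (proj2 (Z.leb_le _ _)) in E by lia. discriminate.
  - assert (Hout : (m < 0 \/ Z.of_nat N < m)%Z).
    { destruct (Z_lt_le_dec m 0); [now left|]. destruct (Z_lt_le_dec (Z.of_nat N) m); [now right|].
      exfalso. rewrite (proj2 (Z.leb_le _ _)), (proj2 (Z.leb_le _ _)) in E by lia. discriminate. }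
    assert (Esg : Cpowz (-1) (Z.of_nat N - 1) = Cpown (-1) (N - 1))
      by (rewrite <- Cpowz_nat; f_equal; lia).
    assert (Hsg := Cpown_m1_sq (N - 1)).
    assert (Et : forall e, Cpowz t (2 * e) = Cpowz q e).
    { intros e. unfold q. rewrite Cpowz_mul_l, <- Cpowz_add by exact Ht0. f_equal. lia. }
    destruct (Z.of_nat N <? m)%Z eqn:EN.
    + apply Z.ltb_lt in EN. rewrite !IH by lia. rewrite Et.
      (* Used at m - 1 and solved for the term with the largest exponent. *)
      assert (R := Iint_rec q N (t * x) Ht q_neq0 HN (N + 1 - i) (m - 1) k ltac:(lia)).
      replace (m - 1 + 1)%Z with m in R by lia.
      replace (1 - Z.of_nat (N + 1 - i) - k + (m - 1))%Z with
        (m + Z.of_nat i - k - Z.of_nat N - 1)%Z in R by lia.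
      replace (m - 1 - Z.of_nat N)%Z with (m - Z.of_nat N - 1)%Z in R by lia.
      replace (t * x / q) with (x / t) in R by (unfold q; field; exact Ht0).
      replace (Cpowz (-1) (Z.of_nat N)) with (-1 * Cpown (-1) (N - 1)).
      2: { rewrite <- Esg, <- Cpowz_succ by (intros H; inversion H; lra). f_equal. lia. }
      set (I1 := Iint q N (t * x) (N + 1 - i) (m - 1) k) in *.
      set (I2 := Iint q N (t * x) (N + 1 - i) m k) in *.
      set (I3 := Iint q N (t * x) (N + 1 - i) (m - Z.of_nat N - 1) (k - 1)) in *.
      transitivity (t / x * kappa * (I1 - Cpown (-1) (N - 1) *
        Cpowz q (m + Z.of_nat i - k - Z.of_nat N - 1) * I3)); [ring|].
      rewrite <- R. field. auto.
    + apply Z.ltb_ge in EN. rewrite !IH by lia. rewrite Et, Esg.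
      (* Used at m + N and k + 1 and solved for the right-hand term. *)
      assert (R := Iint_rec q N (t * x) Ht q_neq0 HN (N + 1 - i) (m + Z.of_nat N) (k + 1) ltac:(lia)).
      replace (1 - Z.of_nat (N + 1 - i) - (k + 1) + (m + Z.of_nat N))%Z with
        (- (k - Z.of_nat i - m + 1))%Z in R by lia.
      replace (m + Z.of_nat N - Z.of_nat N)%Z with m in R by lia.
      replace (k + 1 - 1)%Z with k in R by lia.
      replace (t * x / q) with (x / t) in R by (unfold q; field; exact Ht0).
      rewrite Cpowz_opp in R by exact q_neq0.
      set (I1 := Iint q N (t * x) (N + 1 - i) (m + Z.of_nat N) (k + 1)) in *.
      set (I2 := Iint q N (t * x) (N + 1 - i) (m + Z.of_nat N + 1) (k + 1)) in *.
      set (I3 := Iint q N (t * x) (N + 1 - i) m k) in *.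
      set (e := (k - Z.of_nat i - m + 1)%Z) in *.
      assert (He : Cpowz q e <> 0) by (apply Cpowz_neq0, q_neq0).
      transitivity (Cpown (-1) (N - 1) * Cpowz q e * kappa * (I1 - x / t * I2)); [ring|].
      rewrite R. transitivity ((Cpown (-1) (N - 1) * Cpown (-1) (N - 1)) * (kappa * I3)).
      * field. exact He.
      * rewrite Hsg. ring.
Qed.

Lemma Yfun_Iint (i : nat) (m k : Z) : (1 <= i <= N)%nat ->
  Yfun N i m k x t = kappa * Iint q N (t * x) (N + 1 - i) m k.
Proof. intros Hi. apply Yfuel_Iint; [exact Hi|]. right. lia. Qed.
End Final.

(* t plays the role of q^{1/2}; q = t^2 with |q| < 1, q <> 0. *)
Theorem theorem1p4 (N : nat) (HN : (2 <= N)%nat) (m : Z) (x t : C)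
  (Hx : x <> 0) (Ht0 : t <> 0) (Ht : Cmod (t * t) < 1) :
  is_series
    (fun n : nat =>
       csum (seq 1 N) (fun i =>
         Yfun N i m (Zceil_div m (Z.of_nat N) + Z.of_nat n)%Z x t))
    (Wloop N m x t).
Proof.
  assert (HN1 : (1 <= N)%nat) by lia.
  set (q := t * t). set (kappa := Cpown (qpoch_inf q q) (N - 1)).
  set (c := kappa * / RtoC (INR (fact N))).
  assert (Hfact : RtoC (INR (fact N)) <> 0).
  { intros E. apply (INR_fact_neq_0 N). now inversion E. }
  assert (Hf := laurent_limit_wilson N x t HN1 Ht m).
  set (f := fun s => c * wilson_integrand N x t m s).
  assert (Hcf : laurent_limit N f)
    by (apply laurent_limit_mult; [apply laurent_limit_const|exact Hf]).
  assert (Hterm : forall k, charge_CT N f k = csum (seq 1 N) (fun i => Yfun N i m k x t)).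
  { intros k. transitivity (c * charge_CT N (wilson_integrand N x t m) k).
    - unfold charge_CT. rewrite <- CT_scal by (now apply laurent_limit_charge).
      apply CT_ext. intros s _. unfold f. ring.
    - rewrite charge_CT_wilson by assumption.
      rewrite (csum_ext_seq N (fun i => Yfun N i m k x t)
        (fun i => kappa * Iint q N (t * x) (N + 1 - i) m k))
        by (intros i Hi; now apply Yfun_Iint).
      (* The functions Y and the integrals number the variables in opposite orders, which the sum
         over i does not see. *)
      rewrite csum_scal, (csum_rev N (fun i => Iint q N (t * x) i m k)).
      unfold c. fold q. field. exact Hfact. }
  assert (EW : Wloop N m x t = su_int N f).
  { unfold Wloop. fold q kappa c.
    destruct (su_int_approx N _ HN1 Hf) as [HI _].
    unfold su_int, f. rewrite (proj2 (torus_int_scal _ _ c HI)). f_equal.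
    apply torus_int_ext. intros l Hl. rewrite svar_su_var by (try apply Hl; exact HN).
    unfold wilson_integrand, root_prod, matter. fold q. do 2 f_equal.
    apply cprod_ext. intros i _. f_equal. ring. }
  rewrite EW.
  apply (is_series_ext (fun n => charge_CT N f (Zceil_div m (Z.of_nat N) + Z.of_nat n))).
  { intros n. apply Hterm. }
  apply su_int_series; [exact HN1|exact Hcf|].
  (* k below the ceiling of m/N means N k < m, the range of [Iint_below]. *)
  intros k Hk. rewrite Hterm. apply csum_zero. intros i Hi. apply in_seq in Hi.
  rewrite Yfun_Iint by (assumption || lia).
  rewrite Iint_below; [ring|exact Ht|lia|].
  unfold Zceil_div in Hk.
  assert (Hdiv := Z.div_mod (- m) (Z.of_nat N) ltac:(lia)).
  assert (Hmod := Z.mod_pos_bound (- m) (Z.of_nat N) ltac:(lia)). nia.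
Qed.
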